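(* Given $\rho_0$ from the interval $0<\rho_0<1$, there exists a number $T_0=T_0(\rho_0,\lambda_1)$ such that for all $t_0\ge T_0$ (with $t_0\le T$) and for arbitrary $\varphi\in H$ the function $W(t_0,\rho)=\|u(t_0)\|^2$, where $u$ is the solution of the forward problem of order $\rho$ with datum $\varphi$ on $(0,T]$, decreases monotonically with respect to $\rho\in[\rho_0,1]$.
   Context: $H$ is a separable Hilbert space with scalar product $(\cdot,\cdot)$ and norm $\|\cdot\|$, and $A:H\to H$ is an arbitrary positive self-adjoint operator in $H$ having a complete system of orthonormal eigenfunctions $\{v_k\}$ in $H$ and a countable set of eigenvalues $\lambda_k$, $Av_k=\lambda_kv_k$, with $0<\lambda_1\le\lambda_2\le\cdots$. Integrals and derivatives of $H$-valued functions are understood in the strong sense. For $\sigma<0$, the fractional integral of order $\sigma$ of a function $h$ defined on $[0,\infty)$ is $$\partial_t^{\sigma}h(t)=\frac{1}{\Gamma(-\sigma)}\int_0^t\frac{h(\xi)}{(t-\xi)^{\sigma+1}}\,d\xi,\quad t>0,$$ provided the right-hand side exists, where $\Gamma$ is Euler's gamma function. For $0<\rho<1$ the Riemann-Liouville fractional derivative of order $\rho$ is $\partial_t^\rho h(t)=\frac{d}{dt}\partial_t^{\rho-1}h(t)$; for $\rho=1$ it is the ordinary derivative $\partial_th=\frac{d}{dt}h$. The forward problem of order $\rho$ with datum $\varphi\in H$ on $(0,T]$ is $$\partial_t^\rho u(t)+Au(t)=0,\quad 0<t\le T;\qquad \lim_{t\to0}\partial_t^{\rho-1}u(t)=\varphi,$$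 where for $\rho=1$ the initial condition has the form $u(0)=\varphi$. A solution is a function $u(t)$ with $\partial_t^\rho u(t),\,Au(t)\in C((0,T];H)$ (continuous functions on $(0,T]$ with values in $H$) satisfying the equation and the initial condition. The solution is unique and has the form $$u(t)=\sum_{k=1}^\infty t^{\rho-1}E_{\rho,\rho}(-\lambda_kt^\rho)(\varphi,v_k)v_k,\qquad E_{\rho,\mu}(t)=\sum_{k=0}^\infty\frac{t^k}{\Gamma(\rho k+\mu)}.$$ *)

(* Defs.v *)
From HB Require Import structures.
From mathcomp Require Import all_boot all_order all_algebra.
From mathcomp Require Import complex.
From mathcomp Require Import all_classical all_reals all_analysis.

Set Implicit Arguments.
Unset Strict Implicit.
Unset Printing Implicit Defensive.

Import Order.TTheory GRing.Theory Num.Theory numFieldNormedType.Exports.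

Local Open Scope classical_set_scope.
Local Open Scope ring_scope.

(* The scalar field of the Hilbert space is either the real field [R] or the
   complex field [R[i]]; time, orders and eigenvalues always live in [R]. *)
Variant scalar_kind := RealScalars | ComplexScalars.

Definition scalars (R : realType) (k : scalar_kind) : numFieldType :=
  match k with
  | RealScalars => R
  | ComplexScalars => (R[i])%C
  end.

Definition ofR (R : realType) (k : scalar_kind) : R -> scalars R k :=
  match k return R -> scalars R k with
  | RealScalars => fun r => r
  | ComplexScalars => fun r => (r%:C)%C
  end.

Definition reS (R : realType) (k : scalar_kind) : scalars R k -> R :=
  match k return scalars R k -> R with
  | RealScalars => fun z => z
  | ComplexScalars => fun z => complex.Re z
  end.

Definition conjS (R : realType) (k : scalar_kind) :
    scalars R k -> scalars R k :=
  match k return scalars R k -> scalars R k with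
  | RealScalars => fun z => z
  | ComplexScalars => fun z : (R[i])%C => Num.conj z
  end.

Section Hilbert.
Context (R : realType) (k : scalar_kind).
Context (H : completeNormedModType (scalars R k)).

(* [H] is complete, so it is a Hilbert space as soon as its norm comes from a
   scalar product. *)
Definition norm_of_dot (inner : {dot H for @conjS R k}) : Prop :=
  forall x : H, `|x| ^+ 2 = inner x x.

Definition separable_space : Prop :=
  exists2 S : set H, countable S & dense S.

Context (inner : {dot H for @conjS R k}).

(* An unbounded operator is a function [A] used only on its domain [D]. *)
Definition densely_defined_linear (D : set H) (A : H -> H) : Prop :=
  [/\ dense D, D 0 &
      forall (a : scalars R k) (x y : H), D x -> D y ->
        D (a *: x + y) /\ A (a *: x + y) = a *: A x + A y].

(* The left-hand side says that [(y, z)] is in the graph of the adjoint. *)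
Definition self_adjoint (D : set H) (A : H -> H) : Prop :=
  forall y z : H,
    (forall x, D x -> inner (A x) y = inner x z) <-> (D y /\ z = A y).

Definition positive_operator (D : set H) (A : H -> H) : Prop :=
  forall x, D x -> 0 <= inner (A x) x.

Definition complete_orthonormal (v : nat -> H) : Prop :=
  (forall i j, inner (v i) (v j) = (i == j)%:R) /\
  (forall x, (forall j, inner x (v j) = 0) -> x = 0).

(* Eigenvalues are indexed from [0]: the first one is [lambda 0]. *)
Definition eigen_system (D : set H) (A : H -> H)
    (v : nat -> H) (lambda : nat -> R) : Prop :=
  [/\ complete_orthonormal v,
      forall j, D (v j) /\ A (v j) = ofR k (lambda j) *: v j,
      0 < lambda 0%N &
      forall i j, (i <= j)%N -> lambda i <= lambda j].

End Hilbert.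

Section Bochner.
Context (R : realType) (k : scalar_kind).
Context (H : completeNormedModType (scalars R k)).

Record step_fun := StepFun {
  sf_size : nat;
  sf_set : 'I_sf_size -> set R;
  sf_val : 'I_sf_size -> H }.

Definition sf_eval (s : step_fun) (x : R) : H :=
  \sum_(i < sf_size s) (\1_(@sf_set s i) x : scalars R k) *: @sf_val s i.

Definition sf_integral (s : step_fun) : H :=
  \sum_(i < sf_size s)
    ofR k (fine (lebesgue_measure (@sf_set s i))) *: @sf_val s i.

Definition sf_wf (D : set R) (s : step_fun) : Prop :=
  forall i, [/\ measurable (@sf_set s i), @sf_set s i `<=` D &
                (lebesgue_measure (@sf_set s i) < +oo)%E].

(* Bochner integral with respect to Lebesgue measure: [f] is Bochner
   integrable on [D] with integral [l]. *)
Definition is_bochner_integral (D : set R) (f : R -> H) (l : H) : Prop :=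
  exists s : nat -> step_fun,
    [/\ forall n, sf_wf D (s n),
        {ae lebesgue_measure, forall x : R, D x ->
           sf_eval (s n) x @[n --> \oo] --> f x},
        (\int[lebesgue_measure]_(x in D)
            (reS `|f x - sf_eval (s n) x|)%:E)%E @[n --> \oo] --> 0%E &
        sf_integral (s n) @[n --> \oo] --> l].

End Bochner.

(* Only used for [0 < x]. *)
Definition Gamma (R : realType) (x : R) : R :=
  Rintegral lebesgue_measure `]0, +oo[
    (fun t : R => t `^ (x - 1) * expR (- t)).

Section Fractional.
Context (R : realType) (k : scalar_kind).
Context (H : completeNormedModType (scalars R k)).

(* [is_frac_integral sigma h t l], for [sigma <= 0]: the fractional integral of
   order [sigma] of [h] at [t] exists and is [l]; order [0] is the identity. *)
Definition is_frac_integral (sigma : R) (h : R -> H) (t : R) (l : H) : Prop :=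
  if sigma == 0 then l = h t
  else exists2 I : H,
    is_bochner_integral `]0, t[
      (fun xi : R => ofR k ((t - xi) `^ (- (sigma + 1))) *: h xi) I &
    l = ofR k (Gamma (- sigma))^-1 *: I.

(* Strong derivative at [t] of a function on (0, T]; one-sided at [t = T]. *)
Definition is_strong_derivative (T : R) (g : R -> H) (t : R) (w : H) : Prop :=
  ofR k (s - t)^-1 *: (g s - g t) @[s --> within `]0, T] t^'] --> w.

(* Below, [g] is the fractional integral of [u] of order [rho - 1], and [w] its
   Riemann-Liouville derivative of order [rho].  Only the values on (0, T] of
   [u], [g] and [w] matter, except for [u 0] when [rho = 1].  In that case
   [g = u] and the initial condition is [u 0 = phi], [u] being continuous from
   the right at [0]. *)
Definition forward_solution (D : set H) (A : H -> H) (rho T : R) (phi : H)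
    (u : R -> H) : Prop :=
  exists g w : R -> H,
    [/\ forall t : R, 0 < t <= T -> is_frac_integral (rho - 1) u t (g t),
        forall t : R, 0 < t <= T -> is_strong_derivative T g t (w t),
        {within `]0, T], continuous w},
        (forall t : R, 0 < t <= T -> D (u t)) /\
          {within `]0, T], continuous (A \o u)} &
        [/\ forall t : R, 0 < t <= T -> w t + A (u t) = 0,
            g t @[t --> 0^'+] --> phi &
            rho = 1 -> u 0 = phi]].

End Fractional.

(* Main.v *)
(* Expanding [u] in the eigenvectors reduces the claim to scalars.  Put [x = 1 - rho] and let [*] be
   convolution on (0, T).  The coefficient of [u] along an eigenvector with eigenvalue [l] is a
   constant times [y], the solution of [q * y + l (1 * 1) * y = 1 * 1] with
   [q s = s^x / Gamma (1 + x)].  Multiplication by the time variable is a derivation [D] of the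
   convolution algebra, and uniqueness gives [D y = rho E * y] with [E = 1 - l 1 * y]; hence [y] is
   positive, [l y] is a sub-probability density and its tail [E t] is [O (t^-rho)].  For two orders
   [rho1 < rho2], the densities [a], [b] satisfy an exact identity expressing
   [l t^2 (a t - b t)] as [P * (a * b)] plus convolutions of [N], [M] with combinations of words in
   [a] and [b] whose coefficients add up to zero, where [P], [N], [M] are differences of powers.
   Words have mass close to one, so for large [t] the right-hand side is [P t] up to a smaller
   error, and [P t >= w (rho2 - rho1) t^x1] uniformly in [l]. *)
Require Import Defs.
From HB Require Import structures.
From mathcomp Require Import all_boot all_order all_algebra.
From mathcomp Require Import complex.
From mathcomp Require Import all_classical all_reals all_analysis.
From mathcomp Require Import measurable_realfun.
From mathcomp Require Import ring lra zify.

Set Implicit Arguments.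
Unset Strict Implicit.
Unset Printing Implicit Defensive.

Import Order.TTheory GRing.Theory Num.Theory numFieldNormedType.Exports.

Local Open Scope classical_set_scope.
Local Open Scope ring_scope.

(** * Convolution of integrable functions *)

(** The threshold must be uniform in the eigenvalue and in the gap between the orders. Separate
    expansions of [a] and [b] cannot give this, since their errors do not shrink with [rho2 - rho1];
    in the identity every kernel is a difference of two powers and so carries the factor [x1 - x2],
    while the eigenvalue enters the errors only through a lower bound. The identity can be
    understood through Laplace transforms, with variable p: the density becomes l / (l + p^rho), [D]
    becomes - d/dp, and for small p the leading part of l D (D a) is x (1 - x) p^(-1-x), the
    transform of x (1 - x) q. Two derivations are taken because one would leave a multiple of
    p^(-x), whose kernel degenerates to a Dirac mass at order one, whereas s^x is bounded near 0 and
    slowly varying for every order. [N] and [M] are controlled only up to a factor [1 + ln t] and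
    could hide the main term; but convolving a slowly varying kernel with a word of mass close to
    one hardly changes it, so with weights of sum zero their contributions cancel to main order. *)

Section affine.
Context {R : realType}.
Local Notation mu := (@lebesgue_measure R).

Let aff (a b : R) : measurableTypeR R -> measurableTypeR R := fun x => a * x + b.

Lemma measurable_affine (a b : R) : measurable_fun setT (aff a b).
Proof. by apply: measurable_funD => //; exact: measurable_funM. Qed.

(** By uniqueness of Lebesgue measure only half-open intervals have to be checked; for [a < 0] the
    preimage is closed at the other end, which does not change its length. *)
Lemma lebesgue_measure_affine (a b : R) (A : set R) : a != 0 -> measurable A ->
  (`|a|%:E * pushforward mu (aff a b) A = mu A)%E.
Proof.
move=> a0 mA.
have a1 : 0 <= `|a| by [].
have maff := measurable_affine a b.
pose m := measure_function_pushforward__canonical__measure_function_Measure mu maff.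
pose ms : {measure set (measurableTypeR R) -> \bar R} := mscale (NngNum a1) m.
apply/esym; apply: (@lebesgue_measure_unique R ms) => // _ [[c d] _ <-].
rewrite /ms /m /=.
rewrite /mscale/= /pushforward.
have [ap|an|] := ltgtP 0 a; last by move=> a00; rewrite -a00 eqxx in a0.
- have -> : (fun x => a * x + b) @^-1` `]c, d]%classic = `](c - b) / a, (d - b) / a]%classic.
    by apply/seteqP; split => x /=; rewrite !in_itv/= ltr_pdivrMr// ler_pdivlMr// (mulrC x) ltrBlDr lerBrDr.
  rewrite !lebesgue_measure_itv/= !lte_fin ltr_pM2r ?invr_gt0// ltrD2r; case: ifPn => _; last by rewrite mule0.
  by rewrite -!EFinB -EFinM gtr0_norm//; congr EFin; field; rewrite gt_eqF.
- have -> : (fun x => a * x + b) @^-1` `]c, d]%classic = `[(d - b) / a, (c - b) / a[%classic.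
    apply/seteqP; split => x /=; rewrite !in_itv/= ltr_ndivlMr// ler_ndivrMr// (mulrC x) ltrBlDr lerBrDr andbC//.
  rewrite !lebesgue_measure_itv/= !lte_fin ltr_nM2r ?invr_lt0// ltrD2r; case: ifPn => _; last by rewrite mule0.
  by rewrite -!EFinB -EFinM ltr0_norm//; congr EFin; field; rewrite lt_eqF.
Qed.

Lemma ge0_integral_affine (a b : R) (f : R -> \bar R) : a != 0 ->
  measurable_fun setT f -> (forall x, 0 <= f x)%E ->
  (\int[mu]_x f x = `|a|%:E * \int[mu]_x f (a * x + b)%R)%E.
Proof.
move=> a0 mf f0.
have a1 : 0 <= `|a| by [].
have maff := measurable_affine a b.
pose m := measure_function_pushforward__canonical__measure_function_Measure mu maff.
pose ms : {measure set (measurableTypeR R) -> \bar R} := mscale (NngNum a1) m.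
rewrite (eq_measure_integral ms); last first.
  by move=> A mA _; exact/esym/lebesgue_measure_affine.
rewrite ge0_integral_mscale//; congr (_ * _)%E.
by rewrite ge0_integral_pushforward// preimage_setT.
Qed.

Lemma integrable_affine (a b : R) (f : R -> R) : a != 0 ->
  mu.-integrable setT (EFin \o f) -> mu.-integrable setT (EFin \o (fun x => f (a * x + b))).
Proof.
move=> a0 /integrableP[mf fi]; apply/integrableP; split.
  apply/measurable_EFinP; apply: measurableT_comp; last exact: measurable_affine.
  exact/measurable_EFinP.
move: fi; rewrite (ge0_integral_affine b a0)//; last exact: measurableT_comp.
move=> h; have := lte_mul_pinfty _ _ h; move=> /(_ `|a|^-1%:E).
rewrite muleA -EFinM mulVf ?normr_eq0// mul1e; exact.
Qed.

Lemma integral_affine_posneg (a b : R) (F : R -> \bar R) : a != 0 -> measurable_fun setT F ->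
  (\int[mu]_x F^\+ x = `|a|%:E * \int[mu]_x (fun x => F (a * x + b)%R)^\+ x)%E /\
  (\int[mu]_x F^\- x = `|a|%:E * \int[mu]_x (fun x => F (a * x + b)%R)^\- x)%E.
Proof.
move=> a0 mF; split.
- rewrite [LHS](ge0_integral_affine b a0 (measurable_funepos mF))//.
  by have -> : ((fun x => F (a * x + b)%R)^\+ = F^\+ \o (fun x => a * x + b)%R)%E by exact: funepos_comp.
- rewrite [LHS](ge0_integral_affine b a0 (measurable_funeneg mF))//.
  by have -> : ((fun x => F (a * x + b)%R)^\- = F^\- \o (fun x => a * x + b)%R)%E by exact: funeneg_comp.
Qed.

Lemma Rintegral_affine (a b : R) (f : R -> R) : a != 0 ->
  mu.-integrable setT (EFin \o f) ->
  \int[mu]_x f x = `|a| * \int[mu]_x f (a * x + b).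
Proof.
move=> a0 fi; have [mf _] := integrableP _ _ _ fi.
have fi' := integrable_affine b a0 fi.
rewrite /Rintegral -[`|a|]/(fine `|a|%:E) -fineM//; last exact: integrable_fin_num.
congr fine; rewrite integralE [in RHS]integralE.
rewrite muleBr//; last first.
  apply: fin_num_adde_defl; rewrite fin_numN; apply: integrable_fin_num => //.
  exact: integrable_funeneg.
have [ep en] := integral_affine_posneg b a0 mf.
by congr (_ - _)%E; [exact: ep|exact: en].
Qed.

End affine.

Section convolution.
Context {R : realType}.
Local Notation mu := (@lebesgue_measure R).
Implicit Types f g h : R -> R.

Definition L1 (f : R -> R) := mu.-integrable setT (EFin \o f).

Lemma L1_meas f : L1 f -> measurable_fun setT f.
Proof. by move=> /integrableP[/measurable_EFinP]. Qed.

Lemma ae_imp (P Q : R -> Prop) : (forall x, P x -> Q x) ->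
  {ae mu, forall x, P x} -> {ae mu, forall x, Q x}.
Proof.
move=> PQ; apply: filterS; last exact: PQ.
exact: (ae_filter_ringOfSetsType (@lebesgue_measure R)).
Qed.

Lemma ae_imp2 (P Q S : R -> Prop) : (forall x, P x -> Q x -> S x) ->
  {ae mu, forall x, P x} -> {ae mu, forall x, Q x} -> {ae mu, forall x, S x}.
Proof.
move=> PQ; apply: filterS2; last exact: PQ.
exact: (ae_filter_ringOfSetsType (@lebesgue_measure R)).
Qed.

(** One of the two parts is infinite, so the extended integral is infinite ([+oo - +oo] counts as
    [-oo]) and [fine] sends it to 0. With this default value, identities such as [convolC] hold at
    every point and not only almost everywhere. *)
Lemma Rintegral_not_integrable f (mf : measurable_fun setT f) :
  ~ L1 f -> \int[mu]_x f x = 0.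
Proof.
move=> nf; rewrite /Rintegral integralE.
have mf' : measurable_fun setT (EFin \o f) by exact/measurable_EFinP.
set p := (\int[mu]_x _)%E; set n := (\int[mu]_x (_^\- x))%E.
have p0 : (0 <= p)%E by exact: integral_ge0.
have n0 : (0 <= n)%E by exact: integral_ge0.
suff : p = +oo%E \/ n = +oo%E.
  by move: p0 n0; case: p n => [p| |] [n| |] //= _ _ [].
have [py|py] := eqVneq p +oo%E; first by left.
have [ny|ny] := eqVneq n +oo%E; first by right.
exfalso; apply: nf; apply/integrableP; split => //.
rewrite (_ : (fun x => _) = (EFin \o f)^\+ \+ (EFin \o f)^\-)%E; last first.
  by rewrite -fune_abse.
rewrite ge0_integralD//; first last.
- exact: measurable_funeneg.
- exact: measurable_funepos.
by rewrite lte_add_pinfty// ltey.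
Qed.

Lemma RintegralZl_meas f (mf : measurable_fun setT f) (c : R) :
  \int[mu]_x (c * f x) = c * \int[mu]_x f x.
Proof.
have [->|c0] := eqVneq c 0.
  rewrite mul0r; under eq_Rintegral do rewrite mul0r.
  by rewrite Rintegral_cst// mul0r.
have [fi|nf] := pselect (L1 f); first by rewrite RintegralZl.
rewrite !Rintegral_not_integrable ?mulr0//.
  exact: measurable_funM.
move=> cf; apply: nf; rewrite /L1 (_ : f = fun x => c^-1 * (c * f x)).
  by apply: (integrableZl measurableT c^-1 cf).
by apply/funext => x; rewrite mulrA mulVf// mul1r.
Qed.

(** The inner [Rintegral] is the [fine] of an extended integral that is finite only for almost every
    point. The exchange is made on the extended integrals, and [fine] is removed almost everywhere
    on both sides. *)
Lemma RFubini (p : R * R -> R) :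
  (mu \x mu)%E.-integrable setT (EFin \o p) ->
  \int[mu]_x \int[mu]_y p (x, y) = \int[mu]_y \int[mu]_x p (x, y).
Proof.
move=> ip; have mp := measurable_int _ ip.
have := Fubini ip; rewrite /Rintegral => e.
transitivity (fine (\int[mu]_x \int[mu]_y (p (x, y))%:E)%E).
  congr fine; apply: ae_eq_integral; first exact: measurableT.
  - apply/measurable_EFinP/measurableT_comp => //; exact: measurable_fubini_F ip.
  - exact: measurable_fubini_F ip.
  - have := ae_integrable1 ip; apply: filterS => x ix _.
    by rewrite fineK//; exact: integrable_fin_num ix.
rewrite [in LHS]e; congr fine; apply: ae_eq_integral; first exact: measurableT.
- exact: measurable_fubini_G ip.
- apply/measurable_EFinP/measurableT_comp => //; exact: measurable_fubini_G ip.
- have := ae_integrable2 ip; apply: filterS => x ix _.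
  by rewrite fineK//; exact: integrable_fin_num ix.
Qed.

Definition convol f g t := \int[mu]_s (f (t - s) * g s).

Lemma measurable_shift2 f : measurable_fun setT f ->
  measurable_fun setT (fun z : measurableTypeR R * measurableTypeR R => f (z.1 - z.2)).
Proof.
move=> mf; apply: (measurableT_comp mf).
by apply: measurable_funB; [exact: measurable_fst|exact: measurable_snd].
Qed.

(** Tonelli with the first variable inside: translation invariance turns the inner integral into
    [|g y|] times the L1 norm of [f]. *)
Lemma conv_prod_integrable f g : L1 f -> L1 g ->
  (mu \x mu)%E.-integrable setT (EFin \o (fun z : R * R => f (z.1 - z.2) * g z.2)).
Proof.
move=> fi gi; have mf := L1_meas fi; have mg := L1_meas gi.
apply/integrable21ltyP.
  apply/measurable_EFinP; apply: measurable_funM; first exact: measurable_shift2.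
  by apply: measurableT_comp.
have [_ fy] := integrableP _ _ _ fi.
have [_ gy] := integrableP _ _ _ gi.
have -> : (\int[mu]_y \int[mu]_x `|(f (x - y) * g y)%:E| =
  \int[mu]_y (`|(g y)%:E| * \int[mu]_x `|(f x)%:E|))%E.
  apply: eq_integral => y _.
  rewrite (ge0_integral_affine (a := 1) (- y) _ (f := fun x => `|(f x)%:E|%E))//; last first.
    by apply: measurableT_comp => //; exact/measurable_EFinP.
  rewrite normr1 mul1e -ge0_integralZl//; last first.
    do 3 apply: measurableT_comp => //.
    exact: measurable_affine.
  by apply: eq_integral => x _; rewrite EFinM abseM muleC mul1r.
rewrite ge0_integralZr//.
- rewrite lte_mul_pinfty//; first exact: integral_ge0.
  by rewrite ge0_fin_numE//; exact: integral_ge0.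
- by apply: measurableT_comp => //; exact/measurable_EFinP.
- exact: integral_ge0.
Qed.

Lemma L1_conv f g : L1 f -> L1 g -> L1 (convol f g).
Proof.
move=> fi gi; have ip := conv_prod_integrable fi gi.
have := integrable_fubini_F ip => h.
have mF := measurable_int _ h.
apply: le_integrable h => //.
  by apply/measurable_EFinP; apply: measurableT_comp.
move=> x _ /=; rewrite /convol /Rintegral /fubini_F/=.
set e := (X in fine X); rewrite -/e; case: e => [r| |] //=.
  by rewrite normr0 leey.
by rewrite normr0 leey.
Qed.

Lemma conv_ae_integrable f g : L1 f -> L1 g ->
  {ae mu, forall t, L1 (fun s => f (t - s) * g s)}.
Proof. by move=> fi gi; have := ae_integrable1 (conv_prod_integrable fi gi). Qed.

Lemma convolC f g : L1 f -> L1 g -> convol f g = convol g f.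
Proof.
move=> fi gi; apply/funext => t; rewrite /convol.
have mf := L1_meas fi; have mg := L1_meas gi.
have mfg : measurable_fun setT (fun s : R => f (t - s) * g s).
  apply: measurable_funM => //; apply: (measurableT_comp mf).
  exact: measurable_funB.
have mgf : measurable_fun setT (fun s : R => g (t - s) * f s).
  apply: measurable_funM => //; apply: (measurableT_comp mg).
  exact: measurable_funB.
have e u : t - (-1 * u + t) = u by ring.
have e' u : -1 * u + t = t - u by ring.
have [i|ni] := pselect (L1 (fun s => f (t - s) * g s)).
  rewrite (Rintegral_affine (a := -1) t _ i) ?oppr_eq0 ?oner_eq0// normrN1 mul1r.
  by apply: eq_Rintegral => u _; rewrite e e' mulrC.
rewrite !Rintegral_not_integrable// => i; apply: ni.
have := integrable_affine (a := -1) t _ i; rewrite oppr_eq0 oner_eq0 => /(_ isT).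
by apply: eq_integrable => // u _ /=; rewrite e e' mulrC.
Qed.


Lemma le_L1 f g : measurable_fun setT f -> (forall x, `|f x| <= `|g x|) -> L1 g -> L1 f.
Proof.
move=> mf fg; apply: le_integrable => //; first exact/measurable_EFinP.
by move=> x _; rewrite /= lee_fin.
Qed.

Lemma L1_abs f : L1 f -> L1 (fun x => `|f x|).
Proof.
by move=> fi; apply: (le_L1 _ _ fi) => [|x]; [apply: measurableT_comp => //; exact: L1_meas|rewrite normr_id].
Qed.

Lemma L1D f g : L1 f -> L1 g -> L1 (fun x => f x + g x).
Proof. by move=> fi gi; apply: (integrableD measurableT fi gi). Qed.

Lemma L1Z (c : R) f : L1 f -> L1 (fun x => c * f x).
Proof. by move=> fi; apply: (integrableZl measurableT c fi). Qed.

Lemma L1N f : L1 f -> L1 (fun x => - f x).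
Proof. by move=> /(L1Z (-1)); apply: eq_integrable => // x _ /=; rewrite mulN1r. Qed.

Lemma ae_eq_Rintegral f g : measurable_fun setT f -> measurable_fun setT g ->
  {ae mu, forall x, f x = g x} -> \int[mu]_x f x = \int[mu]_x g x.
Proof.
move=> mf mg fg; congr fine; apply: ae_eq_integral => //; try exact/measurable_EFinP.
by apply: (ae_imp _ fg) => x /= -> _.
Qed.

(** As a function of [t], the double integral of the absolute values is itself the convolution [k]
    of [|f|] with [e]; [k] is integrable, hence finite for almost every [t]. *)
Lemma conv_triple_integrable f g h : L1 f -> L1 g -> L1 h ->
  {ae mu, forall t, (mu \x mu)%E.-integrable setT
    (EFin \o (fun z : R * R => f (t - z.1) * (g (z.1 - z.2) * h z.2)))}.
Proof.
move=> fi gi hi; have mf := L1_meas fi.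
have ip := conv_prod_integrable gi hi; have mp := measurable_int _ ip.
pose e s := (\int[mu]_r `|(g (s - r) * h r)%:E|)%E.
have me : measurable_fun setT e.
  have := @measurable_fun_fubini_tonelli_F _ _ _ _ _ mu (abse \o (EFin \o (fun z : R * R => g (z.1 - z.2) * h z.2))).
  by apply; [exact: measurableT_comp|move=> z; exact: abse_ge0].
have e0 s : (0 <= e s)%E by exact: integral_ge0.
have eoo : (\int[mu]_s e s < +oo)%E by exact: ((integrable12ltyP _ _ mp).1 ip).
pose k t := (\int[mu]_s (`|(f (t - s)%R)%:E| * e s))%E.
have mfe : measurable_fun setT (fun z : R * R => (`|(f (z.1 - z.2)%R)%:E| * e z.2)%E).
  apply: emeasurable_funM; last exact: measurableT_comp.
  apply: measurableT_comp => //; apply/measurable_EFinP; exact: measurable_shift2.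
have mk : measurable_fun setT k.
  have := @measurable_fun_fubini_tonelli_F _ _ _ _ _ mu (fun z : R * R => (`|(f (z.1 - z.2)%R)%:E| * e z.2)%E).
  by apply => // z; exact: mule_ge0.
have k0 t : (0 <= k t)%E by apply: integral_ge0 => s _; exact: mule_ge0.
have koo : (\int[mu]_t k t < +oo)%E.
  have -> : (\int[mu]_t k t = \int[mu]_s \int[mu]_x (`|(f (x - s)%R)%:E| * e s))%E.
    apply: (@fubini_tonelli _ _ _ _ _ mu mu (fun z : R * R => (`|(f (z.1 - z.2)%R)%:E| * e z.2)%E)) => // z.
    exact: mule_ge0.
  have -> : (\int[mu]_s (\int[mu]_x (`|(f (x - s)%R)%:E| * e s)) = (\int[mu]_x `|(f x)%:E|) * \int[mu]_s e s)%E.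
    rewrite -ge0_integralZl//; last exact: integral_ge0.
    apply: eq_integral => s _; rewrite ge0_integralZr//; last first.
      apply: measurableT_comp => //; apply/measurable_EFinP; apply: measurableT_comp => //.
      exact: measurable_funB.
    congr (_ * _)%E.
    rewrite [RHS](ge0_integral_affine (a := 1) (- s) _ (f := fun x => `|(f x)%:E|%E))//; last first.
      by apply: measurableT_comp => //; exact/measurable_EFinP.
    by rewrite normr1 mul1e; apply: eq_integral => x _; rewrite mul1r.
  have [_ foo] := integrableP _ _ _ fi.
  rewrite lte_mul_pinfty//; first exact: integral_ge0.
  by rewrite ge0_fin_numE//; exact: integral_ge0.
have ik : mu.-integrable setT k.
  apply/integrableP; split => //.
  by have -> : (fun t => `|k t|)%E = k by apply/funext => t; rewrite gee0_abs.
have := integrable_ae measurableT ik; apply: filterS => t /(_ I) kt.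
apply/integrable12ltyP.
  apply/measurable_EFinP; apply: measurable_funM; last exact/measurable_EFinP.
  apply: (measurableT_comp mf); exact: measurable_funB.
suff <- : k t = (\int[mu]_x \int[mu]_y `|(f (t - x) * (g (x - y) * h y))%:E|)%E by rewrite -ge0_fin_numE.
apply: eq_integral => s _.
rewrite /e -ge0_integralZl//; last first.
  apply: measurableT_comp => //; apply/measurable_EFinP; apply: measurable_funM; last exact: L1_meas.
  apply: measurableT_comp; [exact: L1_meas|exact: measurable_funB].
by apply: eq_integral => r _; rewrite -abseM.
Qed.

Lemma convolA f g h : L1 f -> L1 g -> L1 h ->
  {ae mu, forall t, convol f (convol g h) t = convol (convol f g) h t}.
Proof.
move=> fi gi hi; have := conv_triple_integrable fi gi hi.
have mf := L1_meas fi; have mg := L1_meas gi; have mh := L1_meas hi.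
apply: ae_imp => t /RFubini /= eF.
rewrite /convol.
transitivity (\int[mu]_x \int[mu]_y (f (t - x) * (g (x - y) * h y))).
  apply: eq_Rintegral => x _; rewrite RintegralZl_meas; [exact: erefl|].
  apply: measurable_funM; last exact: mh; apply: (measurableT_comp mg); exact: measurable_funB.
rewrite eF; apply: eq_Rintegral => y _.
have ma : measurable_fun setT (fun x : R => f (t - x) * g (x - y)).
  apply: measurable_funM.
    by apply: (measurableT_comp mf); exact: measurable_funB.
  by apply: (measurableT_comp mg); exact: measurable_funB.
have -> : \int[mu]_x (f (t - x) * (g (x - y) * h y)) = h y * \int[mu]_x (f (t - x) * g (x - y)).
  by rewrite -RintegralZl_meas//; apply: eq_Rintegral => x _; ring.
rewrite mulrC; congr (_ * _).
have mb : measurable_fun setT (fun x : R => f (t - y - x) * g x).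
  apply: measurable_funM; last exact: mg; apply: (measurableT_comp mf); exact: measurable_funB.
(* Translation by [y] carries one integrand to the other, so both are integrable or neither is; in
   the latter case both integrals have the default value 0. *)
have [i|ni] := pselect (L1 (fun x => f (t - x) * g (x - y))).
  rewrite (Rintegral_affine (a := 1) y _ i) ?oner_eq0// normr1 mul1r.
  by apply: eq_Rintegral => x _; rewrite mul1r addrK opprD addrA [t - x - y]addrAC.
rewrite !Rintegral_not_integrable// => i; apply: ni.
have := integrable_affine (a := 1) (- y) _ i; rewrite oner_eq0 => /(_ isT).
apply: eq_integrable => // x _ /=; rewrite mul1r; congr (f _ * _)%:E; ring.
Qed.

End convolution.

(** * The convolution algebra on (0, T) *)

Section algebra.
Context {R : realType} (T : R).
Local Notation mu := (@lebesgue_measure R).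
Implicit Types f g h : R -> R.

Definition causal f := L1 f /\ forall s, s <= 0 -> f s = 0.

Definition eqT f g := {ae mu, forall s, s < T -> f s = g s}.

Lemma eqT_refl f : eqT f f.
Proof. by apply: aeW => x _. Qed.

Lemma eqT_sym f g : eqT f g -> eqT g f.
Proof. by apply: ae_imp => x fg xT; rewrite fg. Qed.

Lemma eqT_trans f g h : eqT f g -> eqT g h -> eqT f h.
Proof. by apply: ae_imp2 => x fg gh xT; rewrite fg// gh. Qed.

Lemma causal_conv f g : causal f -> causal g -> causal (convol f g).
Proof.
move=> [fi f0] [gi g0]; split; first exact: L1_conv.
move=> t t0; rewrite /convol; transitivity (\int[mu]_s (0 : R)); last first.
  by rewrite Rintegral_cst// mul0r.
apply: eq_Rintegral => s _; have [s0|s0] := leP s 0; first by rewrite g0// mulr0.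
by rewrite f0 ?mul0r//; lra.
Qed.

Lemma causalD f g : causal f -> causal g -> causal (fun x => f x + g x).
Proof.
by move=> [fi f0] [gi g0]; split => [|s s0]; [exact: L1D|rewrite f0// g0// addr0].
Qed.

Lemma causalZ (c : R) f : causal f -> causal (fun x => c * f x).
Proof. by move=> [fi f0]; split => [|s s0]; [exact: L1Z|rewrite f0// mulr0]. Qed.

Lemma causalN f : causal f -> causal (fun x => - f x).
Proof. by move=> [fi f0]; split => [|s s0]; [exact: L1N|rewrite f0// oppr0]. Qed.

Lemma L1_0 : L1 (fun=> 0 : R).
Proof. exact: integrable0. Qed.

Lemma causal0 : causal (fun=> 0).
Proof. by split => //; exact: L1_0. Qed.

Lemma measurable_conv_arg f g t : measurable_fun setT f -> measurable_fun setT g ->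
  measurable_fun setT (fun s : R => f (t - s) * g s).
Proof.
move=> mf mg; apply: measurable_funM => //; apply: (measurableT_comp mf).
exact: measurable_funB.
Qed.

(** [f] vanishes on the negative axis, so [convol f g t] with [t <= T] involves [g] only below [T].
    Hence [eqT] is a congruence for convolution, although all functions live on the whole line. *)
Lemma conv_eqTr f g g' : causal f -> causal g -> causal g' -> eqT g g' ->
  forall t, t <= T -> convol f g t = convol f g' t.
Proof.
move=> [fi f0] [gi g0] [gi' g0'] gg t tT; rewrite /convol.
apply: ae_eq_Rintegral; try by apply: measurable_conv_arg; exact: L1_meas.
apply: ae_imp gg => s ggs.
have [sT|Ts] := ltP s T; first by rewrite ggs.
by rewrite f0 ?mul0r//; lra.
Qed.

Lemma conv_eqT f f' g g' : causal f -> causal f' -> causal g -> causal g' ->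
  eqT f f' -> eqT g g' -> forall t, t <= T -> convol f g t = convol f' g' t.
Proof.
move=> cf cf' cg cg' ff gg t tT.
rewrite (conv_eqTr cf cg cg' gg)// convolC; [|exact: cf.1|exact: cg'.1].
rewrite (conv_eqTr cg' cf cf' ff)// convolC//; [exact: cg'.1|exact: cf'.1].
Qed.

Lemma convDr f g h : L1 f -> L1 g -> L1 h ->
  eqT (convol f (fun x => g x + h x)) (fun x => convol f g x + convol f h x).
Proof.
move=> fi gi hi; apply: ae_imp2 (conv_ae_integrable fi gi) (conv_ae_integrable fi hi).
move=> t ig ih _; rewrite /convol -RintegralD//.
by apply: eq_Rintegral => s _; rewrite mulrDr.
Qed.

Lemma convZr (c : R) f g t : L1 f -> L1 g ->
  convol f (fun x => c * g x) t = c * convol f g t.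
Proof.
move=> fi gi; rewrite /convol -RintegralZl_meas; last first.
  by apply: measurable_conv_arg; exact: L1_meas.
by apply: eq_Rintegral => s _; rewrite mulrCA.
Qed.

(* multiplication by the time variable, cut off at T to stay integrable *)
Definition tmul f : R -> R := fun s => if s < T then s * f s else 0.

Lemma measurable_tmul f : measurable_fun setT f -> measurable_fun setT (tmul f).
Proof.
move=> mf; apply: measurable_fun_ifT => //; last exact: measurable_funM.
by apply: measurable_fun_ltr.
Qed.

Lemma causal_tmul f : causal f -> causal (tmul f).
Proof.
move=> [fi f0]; split; last by move=> s s0; rewrite /tmul f0// mulr0 if_same.
apply: (le_L1 _ _ (L1Z T fi)); first by apply: measurable_tmul; exact: L1_meas.
move=> s; rewrite /tmul; case: ifPn => [sT|_]; last by rewrite normr0.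
have [s0|s0] := leP s 0; first by rewrite f0// !mulr0.
rewrite !normrM ler_wpM2r// !ger0_norm; lra.
Qed.

Lemma tmul_eqT f g : eqT f g -> eqT (tmul f) (tmul g).
Proof. by apply: ae_imp => s fg sT; rewrite /tmul sT fg. Qed.

(** The Leibniz rule, from t = (t - s) + s under the integral. The integrand lives on [0 < s < t],
    so for [t < T] no cut-off acts. *)
Lemma tmul_conv f g : causal f -> causal g ->
  eqT (tmul (convol f g)) (fun x => convol (tmul f) g x + convol f (tmul g) x).
Proof.
move=> cf cg; have cf' := causal_tmul cf; have cg' := causal_tmul cg.
apply: ae_imp2 (conv_ae_integrable cf'.1 cg.1) (conv_ae_integrable cf.1 cg'.1).
move=> t i1 i2 tT; rewrite /tmul tT /convol -RintegralD// -RintegralZl_meas; last first.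
  by apply: measurable_conv_arg; [exact: L1_meas cf.1|exact: L1_meas cg.1].
apply: eq_Rintegral => s _; rewrite /tmul.
have [s0|s0] := leP s 0; first by rewrite (cg.2 _ s0) !(mulr0,if_same,addr0).
have [st|ts] := leP t s.
  have ts0 : t - s <= 0 by lra.
  by rewrite (cf.2 _ ts0) !(mulr0,mul0r,if_same,addr0).
have -> : t - s < T by lra.
have -> : s < T by lra.
by ring.
Qed.

Definition cfun := {f : R -> R | causal f}.

Definition ceq (f g : cfun) := eqT (sval f) (sval g).

(** Quotient by [ceq], encoded as the set of classes with chosen representatives. Leibniz equality
    turns functions modulo [eqT] into elements of a commutative ring, so that identities between
    convolutions can be left to [ring]. *)
Definition cls := {S : set cfun | exists f : cfun, S = ceq f}.

Definition cpi (f : cfun) : cls := exist _ (ceq f) (ex_intro _ f erefl).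

Definition crepr (x : cls) : cfun := sval (cid (svalP x)).

Lemma crepr_pi x : cpi (crepr x) = x.
Proof.
by case: x => S eS; rewrite /crepr; case: cid => f /= Sf; apply: eq_exist => /=.
Qed.

Lemma cpiP (f g : cfun) : cpi f = cpi g <-> ceq f g.
Proof.
split=> [[/(congr1 (fun S => S g))]|fg].
  move=> e; have : ceq g g by exact: eqT_refl.
  by rewrite -e.
apply: eq_exist; apply/funext => h; apply/propext; split => H.
  exact: eqT_trans (eqT_sym fg) H.
exact: eqT_trans fg H.
Qed.

Lemma crepr_eq (f : cfun) : eqT (sval (crepr (cpi f))) (sval f).
Proof. by have /cpiP := crepr_pi (cpi f). Qed.

Definition mkc f (cf : causal f) : cls := cpi (exist _ f cf).

Definition cval (x : cls) : R -> R := sval (crepr x).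

Lemma causal_cval x : causal (cval x).
Proof. exact: (svalP (crepr x)). Qed.

Lemma cval_mk f (cf : causal f) : eqT (cval (mkc cf)) f.
Proof. exact: crepr_eq (exist _ f cf). Qed.

Lemma mkcP f g (cf : causal f) (cg : causal g) : mkc cf = mkc cg <-> eqT f g.
Proof. by rewrite /mkc; split=> [/cpiP|H]; [|apply/cpiP]. Qed.

Lemma mkc_cval x (c : causal (cval x)) : mkc c = x.
Proof.
rewrite -[RHS]crepr_pi /mkc; congr cpi; rewrite /cval in c *.
by case: (crepr x) c => f cf c /=; congr exist; exact: Prop_irrelevance.
Qed.

Lemma clsP x y : eqT (cval x) (cval y) <-> x = y.
Proof.
split=> [|->]; last exact: eqT_refl.
by rewrite -[X in _ -> X = _](mkc_cval (causal_cval x)) -[X in _ -> _ = X](mkc_cval (causal_cval y)) => /mkcP.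
Qed.

Definition cadd x y := mkc (causalD (causal_cval x) (causal_cval y)).
Definition copp x := mkc (causalN (causal_cval x)).
Definition cmul x y := mkc (causal_conv (causal_cval x) (causal_cval y)).
Definition cscale (c : R) x := mkc (causalZ c (causal_cval x)).
Definition cD x := mkc (causal_tmul (causal_cval x)).
Definition czero := mkc causal0.

Lemma cval_add x y : eqT (cval (cadd x y)) (fun t => cval x t + cval y t).
Proof. exact: cval_mk. Qed.
Lemma cval_opp x : eqT (cval (copp x)) (fun t => - cval x t).
Proof. exact: cval_mk. Qed.
Lemma cval_scale c x : eqT (cval (cscale c x)) (fun t => c * cval x t).
Proof. exact: cval_mk. Qed.
Lemma cval_mul x y : eqT (cval (cmul x y)) (convol (cval x) (cval y)).
Proof. exact: cval_mk. Qed.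
Lemma cval_D x : eqT (cval (cD x)) (tmul (cval x)).
Proof. exact: cval_mk. Qed.

HB.instance Definition _ := gen_eqMixin cls.
HB.instance Definition _ := gen_choiceMixin cls.

Lemma caddA : associative cadd.
Proof.
move=> x y z; apply/mkcP.
by apply: ae_imp2 (cval_add y z) (cval_add x y) => t e1 e2 tT; rewrite e1// e2// addrA.
Qed.

Lemma caddC : commutative cadd.
Proof. by move=> x y; apply/mkcP; apply: aeW => t _; rewrite addrC. Qed.

Lemma cadd0 : left_id czero cadd.
Proof.
move=> x; apply/clsP; apply: ae_imp2 (cval_add czero x) (cval_mk causal0) => t e1 e2 tT.
by rewrite e1// e2// add0r.
Qed.

Lemma caddN : left_inverse czero copp cadd.
Proof.
move=> x; apply/mkcP; apply: ae_imp (cval_opp x) => t e tT.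
by rewrite e// addNr.
Qed.

HB.instance Definition _ := GRing.isZmodule.Build cls caddA caddC cadd0 caddN.

Lemma cmulA : associative cmul.
Proof.
move=> x y z; apply/mkcP.
have cx := causal_cval x; have cy := causal_cval y; have cz := causal_cval z.
have := convolA cx.1 cy.1 cz.1; apply: ae_imp => t e tT.
have -> : convol (cval x) (cval (cmul y z)) t = convol (cval x) (convol (cval y) (cval z)) t.
  apply: (conv_eqTr cx (causal_cval _) (causal_conv cy cz) (cval_mul y z)); exact: ltW.
rewrite e; symmetry; apply: (conv_eqT (causal_cval _) (causal_conv cx cy) cz cz (cval_mul x y) (eqT_refl _)).
exact: ltW.
Qed.

Lemma cmulC : commutative cmul.
Proof.
move=> x y; apply/mkcP; apply: aeW => t _; rewrite convolC//; exact: (causal_cval _).1.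
Qed.

Lemma cmulDr x y z : cmul x (y + z) = cmul x y + cmul x z.
Proof.
apply/mkcP.
have cx := causal_cval x; have cy := causal_cval y; have cz := causal_cval z.
have e1 := cval_mul x y; have e2 := cval_mul x z.
apply: ae_imp2 (ae_imp2 (fun t a b => conj a b) e1 e2) (convDr cx.1 cy.1 cz.1) => t [a b] c tT.
rewrite a// b// -c//; apply: (conv_eqTr cx (causal_cval _) (causalD cy cz) (cval_add y z)).
exact: ltW.
Qed.

Lemma cscaleA a b x : cscale a (cscale b x) = cscale (a * b) x.
Proof.
by apply/mkcP; apply: ae_imp (cval_scale b x) => t e tT; rewrite e// mulrA.
Qed.

Lemma cscale1 x : cscale 1 x = x.
Proof. by apply/clsP; apply: ae_imp (cval_scale 1 x) => t e tT; rewrite e// mul1r. Qed.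

Lemma cscaleDr a x y : cscale a (x + y) = cscale a x + cscale a y.
Proof.
apply/mkcP; apply: ae_imp2 (ae_imp2 (fun t a b => conj a b) (cval_scale a x) (cval_scale a y)) (cval_add x y).
by move=> t [e1 e2] e tT; rewrite e// e1// e2// mulrDr.
Qed.

Lemma cscaleDl x a b : cscale (a + b) x = cscale a x + cscale b x.
Proof.
apply/mkcP; apply: ae_imp2 (cval_scale a x) (cval_scale b x).
by move=> t e1 e2 tT; rewrite e1// e2// mulrDl.
Qed.

Lemma cscaleMr a x y : cmul x (cscale a y) = cscale a (cmul x y).
Proof.
have cx := causal_cval x; have cy := causal_cval y.
apply/mkcP; apply: ae_imp (cval_mul x y) => t e tT; rewrite e// -(convZr a t cx.1 cy.1).
apply: (conv_eqTr cx (causal_cval _) (causalZ a cy) (cval_scale a y)); exact: ltW.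
Qed.

Lemma cmulDl x y z : cmul (x + y) z = cmul x z + cmul y z.
Proof. by rewrite ![cmul _ z]cmulC cmulDr. Qed.

Lemma cscaleMl a x y : cmul (cscale a x) y = cscale a (cmul x y).
Proof. by rewrite ![cmul _ y]cmulC cscaleMr. Qed.

Lemma cDM x y : cD (cmul x y) = cmul (cD x) y + cmul x (cD y).
Proof.
have cx := causal_cval x; have cy := causal_cval y.
have e1 := cval_mul (cD x) y; have e2 := cval_mul x (cD y).
apply/mkcP; apply: ae_imp2 (ae_imp2 (fun t a b => conj a b) e1 e2)
  (eqT_trans (tmul_eqT (cval_mul x y)) (tmul_conv cx cy)) => t [a b] e tT.
rewrite e// a// b//; congr (_ + _); apply: conv_eqT => //; try exact: ltW;
  try exact: causal_cval; try exact: causal_tmul; try exact: eqT_refl; exact/eqT_sym/cval_D.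
Qed.

Lemma cDD x y : cD (x + y) = cD x + cD y.
Proof.
apply/mkcP; apply: ae_imp2 (ae_imp2 (fun t a b => conj a b) (cval_D x) (cval_D y)) (cval_add x y).
by move=> t [e1 e2] e tT; rewrite e1// e2// /tmul tT e// mulrDr.
Qed.

Lemma cDZ a x : cD (cscale a x) = cscale a (cD x).
Proof.
apply/mkcP; apply: ae_imp2 (cval_scale a x) (cval_D x).
by move=> t e1 e2 tT; rewrite e2// /tmul tT e1// mulrCA.
Qed.

(* the algebra with a unit adjoined: (c, x) stands for c times the Dirac mass plus x *)
Definition calg := (R * cls)%type.

HB.instance Definition _ := Choice.on calg.
HB.instance Definition _ := GRing.Zmodule.on calg.

Definition amul (p q : calg) : calg :=
  (p.1 * q.1, cscale p.1 q.2 + cscale q.1 p.2 + cmul p.2 q.2).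

Definition aone : calg := (1, 0).

Lemma cscale0 a : cscale a 0 = 0.
Proof. by apply: (addIr (cscale a 0)); rewrite -cscaleDr !add0r. Qed.
Lemma cscale0l x : cscale 0 x = 0.
Proof. by apply: (addIr (cscale 0 x)); rewrite -cscaleDl !add0r. Qed.
Lemma cmulr0 x : cmul x 0 = 0.
Proof. by apply: (addIr (cmul x 0)); rewrite -cmulDr !add0r. Qed.

Lemma amulC : commutative amul.
Proof. by move=> p q; rewrite /amul mulrC [cmul _ _]cmulC [cscale p.1 _ + _]addrC. Qed.

Lemma amul1 : left_id aone amul.
Proof. by move=> [a x]; rewrite /amul/= mul1r cscale1 cscale0 cmulC cmulr0 !addr0. Qed.

Lemma amulDl : left_distributive amul +%R.
Proof.
move=> [a x] [b y] [c z]; rewrite /amul/=; congr pair => /=; first by rewrite mulrDl.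
by rewrite cscaleDl cscaleDr cmulDl !addrA; rewrite [LHS](ACl (1*3*5*2*4*6)).
Qed.

(** The computation behind [amulA], over an abstract module: it rests on bilinearity and
    associativity of the product alone, and rewriting then meets no class of functions. *)
Lemma unitization_assoc (V : zmodType) (sc : R -> V -> V) (ml : V -> V -> V) :
  (forall a x y, sc a (x + y) = sc a x + sc a y) ->
  (forall a b x, sc a (sc b x) = sc (a * b) x) ->
  (forall x y z, ml x (y + z) = ml x y + ml x z) ->
  (forall x y z, ml (x + y) z = ml x z + ml y z) ->
  (forall a x y, ml x (sc a y) = sc a (ml x y)) ->
  (forall a x y, ml (sc a x) y = sc a (ml x y)) ->
  (forall x y z, ml x (ml y z) = ml (ml x y) z) ->
  forall a b c x y z,
  sc a (sc b z + sc c y + ml y z) + sc (b * c) x + ml x (sc b z + sc c y + ml y z) =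
  sc (a * b) z + sc c (sc a y + sc b x + ml x y) + ml (sc a y + sc b x + ml x y) z.
Proof.
move=> scD scA mlDr mlDl mlZr mlZl mlA a b c x y z.
rewrite !scD !scA !mlDr !mlDl !mlZr !mlZl !mlA !addrA.
by rewrite (mulrC c a) (mulrC c b) [LHS](ACl (1*2*4*6*3*5*7)).
Qed.

Lemma amulA : associative amul.
Proof.
move=> [a x] [b y] [c z]; rewrite /amul/=; congr pair => /=; first by rewrite mulrA.
apply: unitization_assoc => *.
- exact: cscaleDr.
- exact: cscaleA.
- exact: cmulDr.
- exact: cmulDl.
- exact: cscaleMr.
- exact: cscaleMl.
- exact: cmulA.
Qed.

Lemma aone_neq0 : aone != 0.
Proof. by apply/eqP => -[/eqP]; rewrite oner_eq0. Qed.

HB.instance Definition _ :=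
  GRing.Zmodule_isComNzRing.Build calg amulA amulC amul1 amulDl aone_neq0.

Definition acst (c : R) : calg := (c, 0).
Definition ain (x : cls) : calg := (0, x).
(** The scalar component is sent to 0 because the Dirac mass sits at time 0; this is what makes [aD]
    a derivation of the unital algebra. *)
Definition aD (p : calg) : calg := ain (cD p.2).

Lemma acstD a b : acst (a + b) = acst a + acst b.
Proof. by rewrite /acst; congr pair; rewrite addr0. Qed.

Lemma acstM a b : acst (a * b) = acst a * acst b.
Proof. by congr pair => /=; rewrite !cscale0 cmulr0 !addr0. Qed.

Lemma acstN a : acst (- a) = - acst a.
Proof. by congr pair; rewrite /= oppr0. Qed.

Lemma acst0 : acst 0 = 0. Proof. by []. Qed.
Lemma acst1 : acst 1 = 1. Proof. by []. Qed.

Lemma aDD p q : aD (p + q) = aD p + aD q.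
Proof. by rewrite /aD cDD; congr pair; rewrite addr0. Qed.

Lemma aDcst c : aD (acst c) = 0.
Proof.
rewrite /aD /acst /=; congr pair; apply: (addIr (cD 0)).
by rewrite -cDD !add0r.
Qed.

Lemma aDM p q : aD (p * q) = aD p * q + p * aD q.
Proof.
case: p q => [a x] [b y]; rewrite /aD /ain; congr pair; rewrite /= ?mul0r ?mulr0 ?addr0//.
by rewrite !cDD !cDZ cDM !cscale0l addr0 add0r !addrA [LHS](ACl (2*3*1*4)).
Qed.

Lemma acst_mul c x : acst c * ain x = ain (cscale c x).
Proof. by congr pair => /=; rewrite ?mulr0// cscale0l cmulC cmulr0 !addr0. Qed.

Lemma ain_mul x y : ain x * ain y = ain (cmul x y).
Proof. by congr pair => /=; rewrite ?mulr0// !cscale0l !add0r. Qed.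

Lemma ain_add x y : ain x + ain y = ain (x + y).
Proof. by congr pair; rewrite addr0. Qed.

Lemma ain_inj : injective ain. Proof. by move=> x y []. Qed.

End algebra.

(** * Power functions and the gamma function *)

Section calculus.
Context {R : realType}.
Local Notation mu := (@lebesgue_measure R).

Lemma integrable_realD (D : set R) (f g : R -> R) : measurable D ->
  mu.-integrable D (EFin \o f) -> mu.-integrable D (EFin \o g) ->
  mu.-integrable D (EFin \o (fun x => f x + g x)).
Proof. by move=> mD fi gi; apply: (integrableD _ fi gi). Qed.

Lemma integrable_realB (D : set R) (f g : R -> R) : measurable D ->
  mu.-integrable D (EFin \o f) -> mu.-integrable D (EFin \o g) ->
  mu.-integrable D (EFin \o (fun x => f x - g x)).
Proof. by move=> mD fi gi; apply: (integrableB _ fi gi). Qed.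

Lemma integrable_realZl (D : set R) (c : R) (f : R -> R) : measurable D ->
  mu.-integrable D (EFin \o f) -> mu.-integrable D (EFin \o (fun x => c * f x)).
Proof. by move=> mD fi; apply: (integrableZl _ c fi). Qed.

Lemma integrable_realZr (D : set R) (c : R) (f : R -> R) : measurable D ->
  mu.-integrable D (EFin \o f) -> mu.-integrable D (EFin \o (fun x => f x * c)).
Proof.
move=> mD /(integrable_realZl c mD); under [X in EFin \o X]eq_fun do rewrite mulrC.
exact.
Qed.

Lemma integrable_real_norm (D : set R) (f : R -> R) : measurable D ->
  mu.-integrable D (EFin \o f) -> mu.-integrable D (EFin \o (fun x => `|f x|)).
Proof.
move=> mD fi; have [/measurable_EFinP mf _] := integrableP _ _ _ fi.
apply: le_integrable fi => //.
  by apply/measurable_EFinP; apply: measurableT_comp.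
by move=> x _ /=; rewrite normr_id.
Qed.

Lemma FTC2_pos (f F : R -> R) (a b : R) : 0 < a -> a < b ->
  (forall x : R, 0 < x -> is_derive x 1 F (f x)) ->
  (forall x : R, 0 < x -> {for x, continuous f}) ->
  (\int[mu]_(x in `[a, b]%classic) (f x)%:E = (F b)%:E - (F a)%:E)%E.
Proof.
move=> a0 ab dF cf.
have cF x : 0 < x -> {for x, continuous F}.
  move=> x0; apply: differentiable_continuous; apply/derivable1_diffP.
  by have [] := dF _ x0.
apply: continuous_FTC2 => //.
- apply: continuous_in_subspaceT => x; rewrite inE/= in_itv/= => /andP[ax _].
  by apply: cf; exact: lt_le_trans ax.
- split.
  + move=> x; rewrite in_itv/= => /andP[ax _]; have [] := dF x _ => //.
    exact: lt_trans ax.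
  + by apply: cvg_at_right_filter; exact: cF.
  + by apply: cvg_at_left_filter; apply: cF; exact: lt_trans ab.
- move=> x; rewrite in_itv/= => /andP[ax _]; have x0 : 0 < x by exact: lt_trans ax.
  by rewrite derive1E; have [_ ->] := dF _ x0.
Qed.

(** Monotone convergence along intervals that exhaust []0, b]]; positivity of [f] there takes the
    place of integrability at 0. *)
Lemma ge0_FTC2_0 (f F : R -> R) (b : R) : 0 < b ->
  (forall x : R, 0 < x -> is_derive x 1 F (f x)) ->
  (forall x : R, 0 < x -> {for x, continuous f}) ->
  (forall x : R, 0 < x <= b -> 0 <= f x) ->
  F x @[x --> 0^'+] --> 0 ->
  (\int[mu]_(x in `]0%R, b]) (f x)%:E = (F b)%:E)%E.
Proof.
move=> b0 dF cf f0 F0.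
have mf : measurable_fun (`]0%R, +oo[ : set R) f.
  apply: open_continuous_measurable_fun => // x; rewrite inE/= in_itv/= andbT; exact: cf.
(* [n.+2] rather than [n.+1] keeps every interval nondegenerate, as [FTC2_pos] requires. *)
pose A n := `[b / n.+2%:R, b]%classic.
have An n : 0 < b / n.+2%:R by rewrite divr_gt0.
have AE : \bigcup_n A n = `]0, b]%classic.
  apply/seteqP; split => [x [n _]|x]; rewrite /A /= !in_itv/=.
    by move=> /andP[h ->]; rewrite andbT; exact: lt_le_trans h.
  move=> /andP[x0 xb].
  have [|n] := @ltr_add_invr R 0 (x / b); first by rewrite divr_gt0.
  rewrite add0r => nx; exists n => //=; rewrite /A/= in_itv/= xb andbT.
  rewrite ler_pdivrMr// mulrC -ler_pdivrMr// ltW//.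
  apply: (@lt_trans _ _ n.+1%:R); last by rewrite ltr_nat.
  by rewrite -invf_div -[ltRHS]invrK ltf_pV2 ?posrE ?invr_gt0 ?divr_gt0.
have : (\int[mu]_(x in A i) (EFin \o f) x @[i --> \oo] --> \int[mu]_(x in \bigcup_n A n) (EFin \o f) x)%E.
  apply: ge0_nondecreasing_set_cvg_integral.
  - apply/nondecreasing_seqP => n; rewrite subsetEset => x; rewrite /A/= !in_itv/= => /andP[h ->].
    rewrite andbT; apply: le_trans h; rewrite ler_pM2l// lef_pV2 ?posrE// ler_nat//.
  - by move=> n; exact: measurable_itv.
  - move=> n; apply/measurable_EFinP; apply: measurable_funS mf => // x; rewrite /A/= !in_itv/= andbT => /andP[h _].
    exact: lt_le_trans h.
  - move=> n x; rewrite /A/= in_itv/= lee_fin => /andP[h xb]; apply: f0; rewrite xb andbT.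
    exact: lt_le_trans h.
rewrite AE.
have -> : (fun i => (\int[mu]_(x in A i) (EFin \o f) x)%E) = (fun i => (F b - F (b / i.+2%:R))%:E).
  apply/funext => i; rewrite FTC2_pos// ltr_pdivrMr// ltr_pMr// ltr1n//.
move=> h; apply: (cvg_unique _ h) => //.
change ((F b - F (b / i.+2%:R))%:E @[i --> \oo] --> (F b)%:E).
rewrite -[X in _ --> X%:E]subr0; apply: cvg_EFin; first by apply: nearW.
apply: cvgB; first exact: cvg_cst.
apply: ((cvg_at_rightP _ _ _).1 F0) => //; split => //.
rewrite -(mulr0 b); apply: cvgM; first exact: cvg_cst.
by rewrite (cvg_shiftS (@harmonic R)); exact: cvg_harmonic.
Qed.

Lemma integrable_setU (A B : set R) (f : R -> R) : measurable A -> measurable B ->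
  measurable_fun (A `|` B) f ->
  mu.-integrable A (EFin \o f) -> mu.-integrable B (EFin \o f) ->
  mu.-integrable (A `|` B) (EFin \o f).
Proof.
move=> mA mB mf fA fB; apply/integrableP; split; first exact/measurable_EFinP.
have mB' : measurable (B `\` A) by exact: measurableD.
have fB' : mu.-integrable (B `\` A) (EFin \o f).
  by apply: integrableS fB => //; exact: subDsetl.
have [_ oA] := integrableP _ _ _ fA; have [_ oB] := integrableP _ _ _ fB'.
have <- : A `|` (B `\` A) = A `|` B.
  apply/seteqP; split => x; first by case=> [Ax|[Bx _]]; [left|right].
  by case=> Ax; [left|have [?|?] := pselect (A x); [left|right]].
rewrite ge0_integral_setU//; first exact: lte_add_pinfty.
  apply: measurableT_comp => //; apply/measurable_EFinP.
  by apply: measurable_funS mf => //; [exact: measurableU|move=> x [Ax|[Bx _]]; [left|right]].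
by apply/disj_setPS => x [Ax [_ nAx]].
Qed.

Lemma ger0_integrable (D : set R) (f : R -> R) : measurable D -> measurable_fun D f ->
  (forall x, D x -> 0 <= f x) -> (\int[mu]_(x in D) (f x)%:E < +oo)%E ->
  mu.-integrable D (EFin \o f).
Proof.
move=> mD mf f0 fo; apply/integrableP; split; first exact/measurable_EFinP.
rewrite (_ : \int[mu]_(x in D) _ = \int[mu]_(x in D) (f x)%:E)%E//.
by apply: eq_integral => x; rewrite inE => Dx /=; rewrite ger0_norm// f0.
Qed.

Lemma continuous_powR_pos (a x : R) : 0 < x -> {for x, continuous (fun s => s `^ a)}.
Proof.
move=> x0; apply: differentiable_continuous; apply/derivable1_diffP.
by have [] := is_derive1_powR a x0.
Qed.

Lemma integral_powR (a t : R) : -1 < a -> 0 < t ->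
  (\int[mu]_(s in `]0%R, t]) (s `^ a)%:E = (t `^ (a + 1) / (a + 1))%:E)%E.
Proof.
move=> a1 t0; have a10 : 0 < a + 1 by lra.
apply: (@ge0_FTC2_0 (fun s => s `^ a) (fun s => s `^ (a + 1) / (a + 1))) => //.
- move=> x x0; have := is_derive1_powR (a + 1) x0; rewrite addrK => h.
  have -> : x `^ a = (a + 1)^-1 * ((a + 1) * x `^ a) by field; rewrite gt_eqF.
  under eq_fun do rewrite mulrC.
  exact: is_deriveZ.
- by move=> x x0; exact: continuous_powR_pos.
- by move=> x _; exact: powR_ge0.
- rewrite -[X in _ --> X](mul0r (a + 1)^-1); apply: cvgM; last exact: cvg_cst.
  exact: powR_cvg0.
Qed.

Lemma integrable_powR (a t : R) : -1 < a ->
  mu.-integrable `]0, t] (EFin \o (fun s => s `^ a)).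
Proof.
move=> a1; have [t0|t0] := ltP 0 t; last first.
  by rewrite set_itv_ge ?bnd_simp -?leNgt//; exact: integrable_set0.
apply: ger0_integrable => //.
- by apply: measurable_funTS; exact: measurable_powR.
- by move=> x _; exact: powR_ge0.
- by rewrite integral_powR// ltry.
Qed.

(* crude but uniform domination: the constant 216 is 6 ^ 3, from 1 + u <= e^u at u = t / 6 *)
Lemma powR_expR_le (a t : R) : a <= 3 -> 1 <= t -> t `^ a * expR (- t) <= 216 * expR (- (t / 2)).
Proof.
move=> a3 t1.
have h : t `^ a <= 216 * expR (t / 2).
  apply: (le_trans (ler_powR t1 a3)).
  rewrite -[3]/(3%:R) powR_mulrn; last lra.
  have -> : t / 2 = 3%:R * (t / 6) by field.
  rewrite expRM_natl -[216]/((6 * 6 * 6)%N%:R) .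
  have h6 : t / 6 <= expR (t / 6) by have := expR_ge1Dx (t / 6); lra.
  have -> : t ^+ 3 = 216 * (t / 6) ^+ 3 by field.
  rewrite ler_pM2l//; apply: lerXn2r => //; rewrite nnegrE ?expR_ge0//; clear -t1; lra.
have -> : - (t / 2) = t / 2 + - t by field.
by rewrite expRD mulrA ler_wpM2r// expR_ge0.
Qed.

Lemma integrable_expR_half : mu.-integrable `[1, +oo[ (EFin \o (fun t => 216 * expR (- (t / 2)))).
Proof.
suff : mu.-integrable `[1%R, +oo[ (EFin \o (fun t => expR (- (t / 2)))).
  by move=> h; apply: (integrableZl _ 216 h).
have h : mu.-integrable setT (EFin \o exponential_pdf (2^-1 : R)).
  by apply: integrable_exponential_pdf; lra.
have h1 : mu.-integrable `[1%R, +oo[ (EFin \o exponential_pdf (2^-1 : R)).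
  by apply: integrableS h.
have h2 : mu.-integrable `[1%R, +oo[ (fun x => 2%:E * (EFin \o exponential_pdf (2^-1 : R)) x)%E.
  by apply: integrableZl h1.
apply: eq_integrable h2 => //= x.
rewrite inE/= in_itv/= andbT => x1; rewrite exponential_pdfE; last lra.
by rewrite -EFinM; congr EFin; rewrite mulrA mulfV// mul1r mulNr mulrC.
Qed.

Lemma integrable_gamma (a : R) : -1 < a -> a <= 3 ->
  mu.-integrable `]0, +oo[ (EFin \o (fun t => t `^ a * expR (- t))).
Proof.
move=> a1 a3.
have mg : measurable_fun setT (fun t : R => t `^ a * expR (- t)).
  by apply: measurable_funM; [exact: measurable_powR|apply: measurableT_comp => //; exact: measurable_funN].
have -> : `]0%R, +oo[%classic = `]0%R, 1%R] `|` `]1%R, +oo[ :> set R.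
  by rewrite -itv_bndbnd_setU// bnd_simp.
apply: integrable_setU => //; first exact: measurable_funTS.
- apply: le_integrable (integrable_powR 1 a1) => //.
    by apply/measurable_EFinP; exact: measurable_funTS.
  move=> x; rewrite /= in_itv/= => /andP[x0 x1]; rewrite lee_fin.
  rewrite !ger0_norm ?mulr_ge0 ?powR_ge0 ?expR_ge0// ler_piMr ?powR_ge0//.
  by rewrite -expR0 ler_expR; lra.
- have h : mu.-integrable `]1%R, +oo[ (EFin \o (fun t : R => 216 * expR (- (t / 2)))).
    by apply: integrableS integrable_expR_half => // x; rewrite /= !in_itv/= !andbT => /ltW.
  apply: le_integrable h => //.
    by apply/measurable_EFinP; exact: measurable_funTS.
  move=> x; rewrite /= in_itv/= andbT => x1; rewrite lee_fin.
  rewrite !ger0_norm ?mulr_ge0 ?powR_ge0 ?expR_ge0//.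
  by apply: powR_expR_le => //; exact: ltW.
Qed.

Lemma GammaE (x : R) : Gamma x = \int[mu]_(t in `]0, +oo[) (t `^ (x - 1) * expR (- t)).
Proof. by []. Qed.

Lemma Rintegral_powR (a t : R) : -1 < a -> 0 <= t ->
  \int[mu]_(s in `]0, t]) (s `^ a) = t `^ (a + 1) / (a + 1).
Proof.
move=> a1; rewrite le_eqVlt => /predU1P[<-|t0].
  by rewrite set_itv_ge ?bnd_simp ?ltxx// Rintegral_set0 powR0 ?mul0r//; lra.
by rewrite /Rintegral integral_powR.
Qed.

(* Both halves of [0, +oo[ are handled by FTC: the integrand (x - t) t^(x-1) e^(-t) changes sign at t = x. *)
Lemma GammaS (x : R) : 0 < x -> x <= 1 -> Gamma (x + 1) = x * Gamma x.
Proof.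
move=> x0 x1; rewrite !GammaE addrK.
have i1 : mu.-integrable `]0, +oo[ (EFin \o (fun t : R => t `^ (x - 1) * expR (- t))).
  by apply: integrable_gamma; lra.
have i2 : mu.-integrable `]0, +oo[ (EFin \o (fun t : R => t `^ x * expR (- t))).
  by apply: integrable_gamma; lra.
apply/eqP; rewrite -subr_eq0 -opprB oppr_eq0 -RintegralZl// -RintegralB//; last first.
  by apply: (integrableZl _ x i1).
pose F (t : R) := t `^ x * expR (- t).
pose f (t : R) := x * (t `^ (x - 1) * expR (- t)) - t `^ x * expR (- t).
have dF (t : R) : 0 < t -> is_derive t 1 F (f t).
  move=> t0; have h1 := is_derive1_powR x t0.
  have h2 : is_derive t 1 (fun s : R => expR (- s)) (- expR (- t)).
    by apply: is_derive_eq; rewrite /GRing.scale/=; ring.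
  apply: is_derive_eq; rewrite /f /GRing.scale/=; ring.
have fE (t : R) : 0 < t -> f t = (x - t) * (t `^ (x - 1) * expR (- t)).
  move=> t0; rewrite /f -(mulr_powRB1 (ltW t0) x0); ring.
have cf (t : R) : 0 < t -> {for t, continuous f}.
  move=> t0; have c1 a := @continuous_powR_pos a t t0.
  have ce : {for t, continuous (fun s : R => expR (- s))}.
    by apply: continuous_comp; [exact: opp_continuous|exact: continuous_expR].
  apply: cvgB; last by apply: cvgM; [exact: c1|exact: ce].
  by apply: cvgM; [exact: cvg_cst|apply: cvgM; [exact: c1|exact: ce]].
have F0 : F t @[t --> 0^'+] --> 0.
  rewrite -[X in _ --> X](mul0r (expR (- 0))); apply: cvgM; first exact: powR_cvg0.
  apply: cvg_at_right_filter.
  by apply: continuous_comp; [exact: opp_continuous|exact: continuous_expR].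
have Fy : F t @[t --> +oo] --> 0.
  apply: (@squeeze_cvgr _ _ _ _ (fun=> 0) (fun t => 216 * expR (- (t / 2)))).
  - near=> t; rewrite mulr_ge0 ?powR_ge0 ?expR_ge0//= powR_expR_le//; lra.
  - exact: cvg_cst.
  - rewrite -[X in _ --> X](mulr0 216); apply: cvgM; first exact: cvg_cst.
    apply: (@cvg_comp _ _ _ (fun t : R => t / 2) (fun t => expR (- t)) _ +oo).
      apply/cvgryPge => M; near=> u; rewrite ler_pdivlMr//; near: u; exact: nbhs_pinfty_ge.
    exact: cvgr_expR.
have e1 : (\int[mu]_(t in `]0%R, x]) (f t)%:E = (F x)%:E)%E.
  apply: ge0_FTC2_0 => // t /andP[t0 tx]; rewrite fE// mulr_ge0 ?mulr_ge0 ?powR_ge0 ?expR_ge0//; lra.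
have e2 : (\int[mu]_(t in `[x, +oo[) (f t)%:E = (0 - F x)%:E)%E.
  apply: le0_continuous_FTC2y => //.
  - move=> t xt; have t0 : 0 < t by exact: lt_le_trans xt.
    rewrite fE// mulr_le0_ge0 ?mulr_ge0 ?powR_ge0 ?expR_ge0//; lra.
  - apply: continuous_in_subspaceT => t; rewrite inE/= in_itv/= andbT => xt.
    by apply: cf; exact: lt_le_trans xt.
  - apply: cvg_at_right_filter; apply: differentiable_continuous; apply/derivable1_diffP.
    by have [] := dF _ x0.
  - by move=> t xt; have [] := dF t (lt_trans x0 xt).
  - by move=> t; rewrite in_itv/= andbT => xt; rewrite derive1E; have [_ ->] := dF t (lt_trans x0 xt).
have if_ : mu.-integrable `]0, +oo[ (EFin \o f).
  by apply: integrable_realB => //; exact: integrable_realZl.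
have s : `]0%R, +oo[%classic = `]0%R, x] `|` `]x, +oo[ :> set R.
  by rewrite -itv_bndbnd_setU// bnd_simp ltW.
rewrite -[X in X == _]/(\int[mu]_(t in `]0, +oo[) f t) s Rintegral_setU//; last 2 first.
- by rewrite -s.
- by apply/disj_setPS => t [] /=; rewrite !in_itv/= andbT => /andP[_ tx] /lt_le_trans /(_ tx); rewrite ltxx.
rewrite Rintegral_itv_obnd_cbnd; last first.
  apply: integrableS if_ => // t; rewrite /= !in_itv/= !andbT; exact: lt_trans.
by rewrite /Rintegral e1 e2/=; apply/eqP; ring.
Unshelve. all: by end_near.
Qed.

Lemma Gamma1 : Gamma 1 = 1 :> R.
Proof.
rewrite GammaE subrr.
have e : (\int[mu]_(t in `[0%R, +oo[) (expR (- t))%:E = 0%:E - (- expR (- 0))%:E)%E.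
  apply: (@ge0_continuous_FTC2y _ (fun t => expR (- t)) (fun t => - expR (- t))).
  - by move=> t _; exact: expR_ge0.
  - by apply: continuous_subspaceT => t; apply: continuous_comp; [exact: opp_continuous|exact: continuous_expR].
  - by rewrite -[X in _ --> X]oppr0; apply: cvgN; exact: cvgr_expR.
  - by move=> t _; apply: ex_derive.
  - apply: cvg_at_right_filter; apply: cvgN.
    by apply: continuous_comp; [exact: opp_continuous|exact: continuous_expR].
  - by move=> t _; rewrite derive1E; apply: derive_val; apply: is_derive_eq; rewrite /GRing.scale/=; ring.
under eq_Rintegral do rewrite powRr0 mul1r.
rewrite Rintegral_itv_obnd_cbnd.
  by rewrite /Rintegral e/= oppr0 expR0; ring.
have h : mu.-integrable `]0, +oo[ (EFin \o (fun t : R => t `^ 0 * expR (- t))).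
  by apply: integrable_gamma; lra.
by apply: eq_integrable h => //= t _; rewrite powRr0 mul1r.
Qed.


Lemma powR_exp (s x : R) : 0 < s -> s `^ x = expR (x * ln s).
Proof. by move=> s0; rewrite /powR gt_eqF. Qed.

(** From [1 - expR (- z) <= z] at [z = (y - x) * ln s]. The explicit factor [y - x] is what later
    makes every error proportional to the gap between the two orders. *)
Lemma powR_sub_ge1 (s x y : R) : 1 <= s -> x <= y ->
  0 <= s `^ y - s `^ x <= (y - x) * ln s * s `^ y.
Proof.
move=> s1 xy; have s0 : 0 < s by lra.
rewrite subr_ge0 ler_powR//=.
have -> : s `^ x = s `^ y * expR (- ((y - x) * ln s)).
  by rewrite !powR_exp// -expRD; congr expR; ring.
have := expR_ge1Dx (- ((y - x) * ln s)); have := powR_gt0 y s0 => p h.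
rewrite -[X in X - _]mulr1 -mulrBr mulrC ler_pM2r//; lra.
Qed.

Lemma powR_sub_le1 (s x y : R) : 0 < s <= 1 -> x <= y ->
  0 <= s `^ x - s `^ y <= (y - x) * (- ln s) * s `^ x.
Proof.
move=> /andP[s0 s1] xy.
rewrite subr_ge0 ger_powR ?s0//=.
have -> : s `^ y = s `^ x * expR (- ((y - x) * (- ln s))).
  by rewrite !powR_exp// -expRD; congr expR; ring.
have := expR_ge1Dx (- ((y - x) * (- ln s))); have := powR_gt0 x s0 => p h.
rewrite -[X in X - _]mulr1 -mulrBr mulrC ler_pM2r//; lra.
Qed.

(** The inequality ln z < z at z = s^(-1/2): the logarithm at 0 is traded for an integrable
    power. *)
Lemma opp_ln_le (s : R) : 0 < s -> - ln s <= 2 * s `^ (- 2^-1).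
Proof.
move=> s0; have p : 0 < s `^ (- 2^-1) by exact: powR_gt0.
by have := ln_sublinear p; rewrite ln_powR; lra.
Qed.

Lemma integrable_gammaS (x : R) : 0 <= x <= 1 ->
  mu.-integrable `]0, +oo[ (EFin \o (fun t : R => t `^ x * expR (- t))).
Proof. by move=> /andP[x0 x1]; apply: integrable_gamma; lra. Qed.

Lemma Gamma_succE (x : R) :
  Gamma (x + 1) = \int[mu]_(t in `]0, +oo[) (t `^ x * expR (- t)).
Proof. by rewrite GammaE addrK. Qed.

(** On []0, 1]] the integrand is at least t e^(-1), whose integral is e^(-1) / 2. *)
Lemma Gamma_lower (x : R) : 0 <= x <= 1 -> expR (- 1) / 2 <= Gamma (x + 1).
Proof.
move=> x01; have /andP[x0 x1] := x01; rewrite Gamma_succE.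
have ix := integrable_gammaS x01.
have ix1 : mu.-integrable `]0, 1] (EFin \o (fun t : R => t `^ x * expR (- t))).
  by apply: integrableS ix => // t; rewrite /= !in_itv/= andbT => /andP[].
have i1 : mu.-integrable `]0%R, 1%R] (EFin \o (fun t : R => t `^ 1 * expR (- 1))).
  by apply: integrable_realZr => //; apply: integrable_powR; lra.
have -> : expR (-1) / 2 = \int[mu]_(t in `]0%R, 1%R]) (t `^ 1 * expR (- 1)).
  rewrite RintegralZr//; last by apply: integrable_powR; lra.
  rewrite Rintegral_powR; [|lra|lra].
  by rewrite powR1 mulrC -[1 + 1]/(2%:R : R); congr (_ * _); field.
have s : `]0%R, +oo[%classic = `]0%R, 1%R] `|` `]1%R, +oo[ :> set R.
  by rewrite -itv_bndbnd_setU// bnd_simp.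
rewrite s Rintegral_setU//; last 2 first.
- by rewrite -s.
- by apply/disj_setPS => t [] /=; rewrite !in_itv/= andbT => /andP[_ tx] /lt_le_trans /(_ tx); rewrite ltxx.
apply: (@le_trans _ _ (\int[mu]_(t in `]0%R, 1%R]) (t `^ x * expR (- t)))); last first.
  by rewrite lerDl Rintegral_ge0// => t _; rewrite mulr_ge0 ?powR_ge0 ?expR_ge0.
apply: le_Rintegral => // t; rewrite /= in_itv/= => /andP[t0 t1].
apply: ler_pM; rewrite ?powR_ge0 ?expR_ge0//; first by rewrite ger_powR ?t0.
by rewrite ler_expR; lra.
Qed.

Lemma Gamma_succ_gt0 (x : R) : 0 <= x <= 1 -> 0 < Gamma (x + 1).
Proof. by move=> /Gamma_lower; apply: lt_le_trans; rewrite divr_gt0 ?expR_gt0. Qed.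

(** The difference of the integrands is estimated pointwise by the gap times one dominating function
    [k], the same for all orders. Its first term handles [t <= 1] through [opp_ln_le], its second
    handles [t > 1] through ln t <= t and t^y <= t. *)
Lemma Gamma_lip : exists2 K : R, 0 < K & forall x y : R, 0 <= x -> x <= y -> y <= 1 ->
  `|Gamma (y + 1) - Gamma (x + 1)| <= K * (y - x).
Proof.
pose k (t : R) := 2 * (t `^ (- 2^-1) * expR (- t)) + t `^ 2 * expR (- t).
have ik : mu.-integrable `]0, +oo[ (EFin \o k).
  apply: (@integrableD _ _ _ mu `]0%R, +oo[ _ (EFin \o (fun t : R => 2 * (t `^ (- 2^-1) * expR (- t)))) (EFin \o (fun t : R => t `^ 2 * expR (- t)))) => //.
    apply: (@integrableZl _ _ _ mu `]0%R, +oo[ _ 2 (EFin \o (fun t : R => t `^ (- 2^-1) * expR (- t)))) => //.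
    by apply: integrable_gamma; lra.
  by apply: integrable_gamma; lra.
have k0 t : 0 <= k t by rewrite addr_ge0 ?mulr_ge0 ?powR_ge0 ?expR_ge0.
exists (\int[mu]_(t in `]0, +oo[) k t + 1).
  by rewrite ltr_wpDl// Rintegral_ge0.
move=> x y x0 xy y1.
have ix : mu.-integrable `]0, +oo[ (EFin \o (fun t : R => t `^ x * expR (- t))).
  by apply: integrable_gammaS; lra.
have iy : mu.-integrable `]0, +oo[ (EFin \o (fun t : R => t `^ y * expR (- t))).
  by apply: integrable_gammaS; lra.
rewrite !Gamma_succE -RintegralB//.
have id : mu.-integrable `]0, +oo[ (EFin \o (fun t : R => t `^ y * expR (- t) - t `^ x * expR (- t))).
  by apply: (integrableB _ iy ix).
apply: (le_trans (le_normr_Rintegral _ id)) => //.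
apply: (@le_trans _ _ (\int[mu]_(t in `]0, +oo[) ((y - x) * k t))); last first.
  rewrite RintegralZl// mulrC ler_wpM2r//; lra.
apply: le_Rintegral => //.
- exact: integrable_real_norm.
- exact: integrable_realZl.
move=> t; rewrite /= in_itv/= andbT => t0.
rewrite -mulrBl normrM (ger0_norm (expR_ge0 _)) /k mulrA -mulrDl mulrA ler_wpM2r ?expR_ge0//.
have [t1|t1] := leP t 1.
  have t01 : 0 < t <= 1 by rewrite t0.
  have /andP[h1 h2] := powR_sub_le1 t01 xy.
  rewrite distrC ger0_norm//; apply: (le_trans h2); rewrite -mulrA ler_wpM2l ?subr_ge0//.
  have h3 := opp_ln_le t0; have h4 : t `^ x <= 1 by rewrite -(powRr0 t) ger_powR.
  have h5 := powR_ge0 t 2; have h6 := powR_ge0 t x.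
  have h7 : 0 <= - ln t by rewrite oppr_ge0 ln_le0.
  nra.
have t1' := ltW t1; have /andP[h1 h2] := powR_sub_ge1 t1' xy.
rewrite ger0_norm//; apply: (le_trans h2); rewrite -mulrA ler_wpM2l ?subr_ge0//.
have h3 := ln_sublinear t0; have h4 : t `^ y <= t by rewrite -[leRHS]powRr1 ?ler_powR// ltW.
have h5 : t `^ 2 = t * t by rewrite -[2]/(2%:R) powR_mulrn ?expr2// ltW.
have h6 := powR_ge0 t y; have h8 := powR_ge0 t (- 2^-1).
have h7 : 0 <= ln t by exact: ln_ge0.
rewrite h5; nra.
Qed.

End calculus.

(** * From almost every point to every point *)

Section ae_continuity.
Context {R : realType}.
Local Notation mu := (@lebesgue_measure R).

(** A nonempty open interval has positive measure, so it cannot lie inside the exceptional null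
    set. *)
Lemma ae_dense (a b : R) (P : R -> Prop) :
  {ae mu, forall x, a < x < b -> P x} ->
  forall x e, a < x < b -> 0 < e -> exists y, [/\ `|y - x| < e, a < y < b & P y].
Proof.
move=> [N [mN N0 subN]] x e /andP[ax xb] e0; apply: contrapT => nex.
pose c := Num.max a (x - e); pose d := Num.min b (x + e).
have cd : c < d by rewrite /c /d gt_max !lt_min; apply/andP; split; apply/andP; split; lra.
have : (mu `]c, d[ <= mu N)%E.
  apply: le_measure; rewrite ?inE//= => y /=; rewrite in_itv/= /c /d gt_max lt_min.
  move=> /andP[/andP[ay xy] /andP[yb yx]]; apply: subN => /= Py; apply: nex; exists y; split.
  - by rewrite ltr_norml; apply/andP; split; lra.
  - by rewrite ay.
  - by apply: Py; rewrite ay.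
rewrite N0 lebesgue_measure_itv/= lte_fin cd -EFinB lee_fin; lra.
Qed.

Lemma ae_ge0_continuous (a b : R) (g : R -> R) :
  {ae mu, forall x, a < x < b -> 0 <= g x} ->
  forall x, a < x < b -> {for x, continuous g} -> 0 <= g x.
Proof.
move=> h x axb cg; rewrite leNgt; apply/negP => gx.
have : \forall y \near x, g y < 0 by exact: (cvgr_lt _ cg _ gx).
move=> /nbhs_ballP[e /= e0 be].
have [y [yx yab gy]] := ae_dense h axb e0.
by have := be y; rewrite /ball/= distrC => /(_ yx); lra.
Qed.

Lemma ae_eq0_continuous (a b : R) (g : R -> R) :
  {ae mu, forall x, a < x < b -> g x = 0} ->
  forall x, a < x < b -> {for x, continuous g} -> g x = 0.
Proof.
move=> h x axb cg; apply/eqP; rewrite eq_le; apply/andP; split.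
  rewrite -oppr_ge0; apply: (@ae_ge0_continuous a b (fun x => - g x)) => //; last exact: cvgN.
  by apply: ae_imp h => y gy yab; rewrite gy// oppr0.
by apply: (@ae_ge0_continuous a b g) => //; apply: ae_imp h => y gy yab; rewrite gy.
Qed.

End ae_continuity.

(** * Functions as algebra elements: integration, power kernels, Volterra uniqueness *)

Section embedding.
Context {R : realType} (T : R).
Local Notation mu := (@lebesgue_measure R).
Implicit Types f g : R -> R.
Local Notation causal := (@causal R).
Local Notation eqT := (@eqT R T).

(** Total, with the class 0 as default off the causal functions; so [emb] takes a bare function, and
    causality is asked only by the lemmas about it. *)
Definition cls_of f : cls T :=
  match pselect (causal f) with left cf => mkc T cf | right _ => 0 end.

Lemma cls_ofE f : causal f -> eqT (cval (cls_of f)) f.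
Proof. by move=> cf; rewrite /cls_of; case: pselect => // cf'; exact: cval_mk. Qed.

Definition emb f : calg T := ain (cls_of f).

Lemma embP f g : causal f -> causal g -> emb f = emb g <-> eqT f g.
Proof.
move=> cf cg; split=> [/ain_inj e|e].
  by apply: eqT_trans (cls_ofE cg); rewrite -e; exact/eqT_sym/cls_ofE.
congr ain; apply/clsP; apply: eqT_trans (cls_ofE cf) _.
exact: eqT_trans e (eqT_sym (cls_ofE cg)).
Qed.

Lemma embD f g : causal f -> causal g -> emb f + emb g = emb (fun x => f x + g x).
Proof.
move=> cf cg; rewrite /emb ain_add; congr ain; apply/clsP.
apply: eqT_trans (cval_add _ _) _; apply: eqT_trans (eqT_sym (cls_ofE (causalD cf cg))).
by apply: ae_imp2 (cls_ofE cf) (cls_ofE cg) => t e1 e2 tT; rewrite e1// e2.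
Qed.

Lemma embZ c f : causal f -> acst T c * emb f = emb (fun x => c * f x).
Proof.
move=> cf; rewrite /emb acst_mul; congr ain; apply/clsP.
apply: eqT_trans (cval_scale _ _) _; apply: eqT_trans (eqT_sym (cls_ofE (causalZ c cf))).
by apply: ae_imp (cls_ofE cf) => t e1 tT; rewrite e1.
Qed.

Lemma embM f g : causal f -> causal g -> emb f * emb g = emb (convol f g).
Proof.
move=> cf cg; rewrite /emb ain_mul; congr ain; apply/clsP.
apply: eqT_trans (cval_mul _ _) _; apply: eqT_trans (eqT_sym (cls_ofE (causal_conv cf cg))).
apply: aeW => t tT; apply: (@conv_eqT _ T) => //; try exact: causal_cval; try exact: cls_ofE.
exact: ltW.
Qed.

Lemma emb_aD f : causal f -> aD (emb f) = emb (tmul T f).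
Proof.
move=> cf; rewrite /aD/=; congr ain; apply/clsP.
apply: eqT_trans (cval_D _) _; apply: eqT_trans (eqT_sym (cls_ofE (causal_tmul T cf))).
by apply: tmul_eqT; exact: cls_ofE.
Qed.

Lemma emb0 : emb (fun=> 0) = 0.
Proof.
congr ain; apply/clsP; apply: eqT_trans (cls_ofE (@causal0 R)) _.
exact: eqT_sym (cval_mk T (@causal0 R)).
Qed.

(** The cut at [T] makes nonnegative powers integrable on the line. For [eqT], [pw 0] is the
    Heaviside function. *)
Definition pw (x : R) : R -> R := fun s => if (0 < s) && (s < T) then s `^ x else 0.

Lemma pw_in x s : 0 < s < T -> pw x s = s `^ x.
Proof. by rewrite /pw => ->. Qed.

Lemma pw_ge0 x s : 0 <= pw x s.
Proof. by rewrite /pw; case: ifP => // _; exact: powR_ge0. Qed.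

Lemma L1_restrict (D : set R) f : measurable D -> mu.-integrable D (EFin \o f) -> L1 (f \_ D).
Proof.
move=> mD fi; rewrite /L1 -restrict_EFin.
by have /integrable_mkcond := fi; apply.
Qed.

Lemma pwE x : pw x = (fun s => s `^ x) \_ `]0, T[.
Proof. by apply/funext => s; rewrite /pw patchE mem_setE in_itv. Qed.

Lemma causal_pw x : -1 < x -> causal (pw x).
Proof.
move=> x1; split; last by move=> s s0; rewrite /pw ltNge s0.
rewrite pwE; apply: L1_restrict => //.
apply: integrableS (integrable_powR T x1) => // s.
by rewrite /= !in_itv/= => /andP[-> /ltW].
Qed.

Definition prim f t := \int[mu]_(s in `]0, t[) f s.

Lemma prim_conv f t : causal f -> t <= T -> convol (pw 0) f t = prim f t.
Proof.
move=> [fi f0] tT; rewrite /convol /prim [RHS]Rintegral_mkcond.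
apply: eq_Rintegral => s _; rewrite patchE mem_setE in_itv/= /pw powRr0 subr_gt0.
have [s0|s0] := leP s 0; first by rewrite f0// mulr0.
rewrite /=; have [st|st] := ltP s t; last by rewrite mul0r.
have -> : t - s < T by lra.
by rewrite /= mul1r.
Qed.

Lemma L1_integrableS (D : set R) f : measurable D -> L1 f -> mu.-integrable D (EFin \o f).
Proof. by move=> mD fi; apply: integrableS fi. Qed.

Lemma Rintegral_subset_le (D : set R) f : measurable D -> L1 f -> (forall s, 0 <= f s) ->
  \int[mu]_(s in D) f s <= \int[mu]_s f s.
Proof.
move=> mD fi f0; rewrite Rintegral_mkcond; apply: le_Rintegral => //.
  by apply: L1_restrict => //; exact: L1_integrableS.
by move=> s _; rewrite patchE; case: ifP.
Qed.

Lemma prim_cc f t : L1 f -> 0 <= t -> prim f t = \int[mu]_(s in `[0, t]) f s.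
Proof.
move=> fi; rewrite le_eqVlt => /predU1P[<-|t0].
  by rewrite /prim set_itvoo0 Rintegral_set0 set_itv1 Rintegral_set1.
rewrite /prim Rintegral_itv_bndo_bndc; last by apply: L1_integrableS.
by rewrite Rintegral_itv_obnd_cbnd//; apply: L1_integrableS.
Qed.

Lemma prim_continuous f t : L1 f -> 0 < t -> {for t, continuous (prim f)}.
Proof.
move=> fi t0.
have h : {within `[0, t + 1], continuous (fun x : R => \int[mu]_(s in `[0%R, x]) f s)}.
  by apply: parameterized_integral_continuous; [lra|exact: L1_integrableS].
have ct : {for t, continuous (fun x : R => \int[mu]_(s in `[0%R, x]) f s)}.
  have t01 : 0 < t + 1 by lra.
  move: h => /(continuous_within_itvP _ t01)[h _ _]; apply: h; rewrite in_itv/=; apply/andP; split; lra.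
rewrite /prop_for /continuous_at prim_cc//; last lra.
apply: cvg_trans ct; apply: near_eq_cvg; near=> x; rewrite prim_cc//.
by apply: ltW; near: x; exact: lt_nbhsr.
Unshelve. all: by end_near.
Qed.

Lemma prim_cvg0 f : L1 f -> prim f t @[t --> 0^'+] --> 0.
Proof.
move=> fi.
have h : {within `[0, 1], continuous (fun x : R => \int[mu]_(s in `[0%R, x]) f s)}.
  by apply: parameterized_integral_continuous; [lra|exact: L1_integrableS].
have := h => /(continuous_within_itvP _ ltr01)[_ + _].
rewrite set_itv1 Rintegral_set1; apply: cvg_trans; apply: near_eq_cvg; near=> x.
by rewrite prim_cc.
Unshelve. all: by end_near.
Qed.

Lemma causal_Ny f t : causal f -> 0 <= t -> \int[mu]_(s in `]-oo, t]) f s = prim f t.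
Proof.
move=> [fi f0] t0; rewrite prim_cc// [LHS]Rintegral_mkcond [RHS]Rintegral_mkcond; apply: eq_Rintegral => s _.
rewrite !patchE !mem_setE !in_itv/=.
have [s0|s0] := leP 0 s; first by [].
by rewrite f0 ?(ltW s0)//; case: (s <= t).
Qed.

(** Lebesgue differentiation: almost everywhere [f] is the derivative of its primitive, and the
    primitive, being continuous, vanishes at every point of the interval. *)
Lemma prim_eq0 f : causal f -> eqT (prim f) (fun=> 0) -> eqT f (fun=> 0).
Proof.
move=> cf pf0; have [fi f0] := cf.
have p0 t : 0 < t < T -> prim f t = 0.
  move=> t0T; apply: (@ae_eq0_continuous _ 0 T) => //.
    by apply: ae_imp pf0 => s h /andP[_ sT]; exact: h.
  by apply: prim_continuous => //; case/andP: t0T.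
have fl : locally_integrable [set: R] f.
  by apply: open_integrable_locally => //; exact: openT.
have fN y : mu.-integrable `]-oo, y] (EFin \o f) by exact: L1_integrableS.
have := FTC1Ny fN fl; apply: ae_imp => x [_ xf] xT.
have [x0|x0] := leP x 0; first by rewrite f0.
rewrite -xf derive1E (@near_eq_derive _ _ _ _ (fun=> 0)); first exact: derive_cst.
near=> y; rewrite causal_Ny//; last first.
  by apply: ltW; near: y; exact: lt_nbhsr.
apply: p0; apply/andP; split; near: y; [exact: lt_nbhsr|exact: lt_nbhsl].
Unshelve. all: by end_near.
Qed.

Lemma Rintegral_conv f g : L1 f -> L1 g ->
  \int[mu]_t convol f g t = \int[mu]_t f t * \int[mu]_t g t.
Proof.
move=> fi gi; have := RFubini (conv_prod_integrable fi gi) => /= e.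
rewrite /convol e -RintegralZl//; apply: eq_Rintegral => s _.
have fs : L1 (fun x => f (x - s)).
  have := integrable_affine (a := 1) (- s) _ fi; rewrite oner_eq0 => /(_ isT).
  by apply: eq_integrable => // x _ /=; rewrite mul1r.
rewrite RintegralZr//; congr (_ * _).
rewrite (Rintegral_affine (a := 1) (- s) _ fi) ?oner_eq0// normr1 mul1r.
by apply: eq_Rintegral => x _; rewrite mul1r.
Qed.


Lemma fstM (p q : calg T) : (p * q).1 = p.1 * q.1. Proof. by []. Qed.
Lemma fstD (p q : calg T) : (p + q).1 = p.1 + q.1. Proof. by []. Qed.
Lemma fstN (p : calg T) : (- p).1 = - p.1. Proof. by []. Qed.
Lemma fst_emb f : (emb f).1 = 0. Proof. by []. Qed.
Lemma fst_aD (p : calg T) : (aD p).1 = 0. Proof. by []. Qed.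

Lemma emb_cval (p : calg T) : p.1 = 0 -> p = emb (cval p.2).
Proof.
move: p => [a x] /= ->; congr pair; apply/clsP; apply: eqT_sym.
by apply: cls_ofE; exact: causal_cval.
Qed.

Definition oo : calg T := emb (pw 0).

Lemma causal_pw0 : causal (pw 0). Proof. by apply: causal_pw; lra. Qed.

Lemma emb_oo f : causal f -> oo * emb f = emb (convol (pw 0) f).
Proof. by move=> cf; rewrite embM//; exact: causal_pw0. Qed.

(** Convolution with [oo] is integration from 0, which is injective. This serves as division in the
    algebra. *)
Lemma oo_cancel (p : calg T) : p.1 = 0 -> oo * p = 0 -> p = 0.
Proof.
move=> /emb_cval ->; move: (cval p.2) (causal_cval p.2) => f cf.
have cc := causal_conv causal_pw0 cf.
rewrite emb_oo// -emb0 => /embP e; apply/embP => //; first exact: causal0.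
apply: prim_eq0 => //; apply: ae_imp (e cc (@causal0 R)) => t h tT.
by rewrite -prim_conv ?h// ltW.
Qed.

Lemma oo_inj (p q : calg T) : p.1 = q.1 -> oo * p = oo * q -> p = q.
Proof.
move=> e1 e; apply/eqP; rewrite -subr_eq0; apply/eqP; apply: oo_cancel.
  by rewrite fstD fstN e1 subrr.
by rewrite mulrBr e subrr.
Qed.

Lemma prim_pw x t : -1 < x -> 0 < t < T -> prim (pw x) t = t `^ (x + 1) / (x + 1).
Proof.
move=> x1 /andP[t0 tT]; rewrite -Rintegral_powR//; last exact: ltW.
rewrite /prim Rintegral_itv_bndo_bndc; last first.
  by apply: L1_integrableS => //; exact: (causal_pw x1).1.
apply: eq_Rintegral => s; rewrite inE/= in_itv/= => /andP[s0 st].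
by rewrite pw_in// s0 (le_lt_trans st).
Qed.

Lemma aD_pw x : -1 < x -> aD (emb (pw x)) = acst T (x + 1) * (oo * emb (pw x)).
Proof.
move=> x1; have cx := causal_pw x1; have co := causal_conv causal_pw0 cx.
rewrite emb_oo// embZ// emb_aD//; apply/embP.
- exact: causal_tmul.
- exact: causalZ.
apply: aeW => t tT; rewrite /tmul tT.
have [t0|t0] := leP t 0; first by rewrite cx.2// (causal_conv causal_pw0 cx).2// !mulr0.
rewrite prim_conv//; last exact: ltW.
rewrite prim_pw ?t0// pw_in ?t0// mulrCA mulfV ?mulr1; last by apply: lt0r_neq0; lra.
by rewrite -(@mulr_powRB1 _ t (x + 1)) ?ltW//; [rewrite addrK|lra].
Qed.

Lemma aD_oo : aD oo = oo * oo.
Proof. by rewrite /oo aD_pw ?add0r ?acst1 ?mul1r//; lra. Qed.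

(** The Euler beta integral B(1 - x, 1 + x). *)
Definition betaB x := \int[mu]_(s in `]0, 1[) ((1 - s) `^ x * s `^ (- x)).

Lemma pw_conv_integrable x t : 0 <= x < 1 -> 0 < t < T ->
  L1 (fun s => pw x (t - s) * pw (- x) s).
Proof.
move=> /andP[x0 x1] /andP[t0 tT].
have cx : causal (pw (- x)) by apply: causal_pw; lra.
apply: (le_L1 _ _ (L1Z (T `^ x) cx.1)).
  apply: measurable_conv_arg; apply: L1_meas; last exact: cx.1.
  by apply: (causal_pw _).1; lra.
move=> s; rewrite !normrM; apply: ler_wpM2r => //.
rewrite !ger0_norm ?pw_ge0 ?powR_ge0// /pw; case: ifP; last by rewrite powR_ge0.
move=> /andP[h1 h2]; apply: ge0_ler_powR => //; rewrite ?nnegrE; lra.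
Qed.

Lemma pw_conv x t : 0 <= x < 1 -> 0 < t < T ->
  convol (pw x) (pw (- x)) t = betaB x * t.
Proof.
move=> x01 t0T; have /andP[t0 tT] := t0T; rewrite /convol.
have i := pw_conv_integrable x01 t0T.
rewrite (Rintegral_affine (a := t) 0 _ i) ?gt_eqF// gtr0_norm// mulrC; congr (_ * _).
rewrite /betaB [RHS]Rintegral_mkcond; apply: eq_Rintegral => s _.
rewrite patchE mem_setE in_itv/= addr0.
case: ifP => [/andP[s0 s1]|].
  have ts : 0 < t * s by rewrite mulr_gt0.
  have ts1 : t * s < t by rewrite gtr_pMr.
  rewrite !pw_in ?ts ?(lt_trans ts1)//; last by apply/andP; split; lra.
  have -> : t - t * s = t * (1 - s) by ring.
  rewrite !powRM ?ltW//; last lra.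
  have -> : t `^ x * (1 - s) `^ x * (t `^ (- x) * s `^ (- x)) = (t `^ x * t `^ (- x)) * ((1 - s) `^ x * s `^ (- x)) by ring.
  by rewrite -powRD ?(gt_eqF t0) ?implybT// subrr powRr0 mul1r.
move=> /negP h; rewrite /pw; case: ifP; last by rewrite mul0r.
move=> /andP[h1 h2]; case: ifP; last by rewrite mulr0.
move=> /andP[h3 h4]; exfalso; apply: h; apply/andP; split.
  by rewrite -(pmulr_rgt0 _ t0).
by rewrite -(ltr_pM2l t0) mulr1; lra.
Qed.

(** Read off from the convolution at [T / 2], restricted to []0, T / 4[]: there [T / 2 - s >= T / 4]
    and [s <= T], which bounds the integrand below by the positive constant [m]. *)
Lemma betaB_gt0 x : 0 < T -> 0 <= x < 1 -> 0 < betaB x.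
Proof.
move=> T0 x01; have /andP[x0 x1] := x01.
have t0T : 0 < T / 2 < T by apply/andP; split; lra.
have := pw_conv x01 t0T => e.
suff : 0 < betaB x * (T / 2) by rewrite pmulr_lgt0//; lra.
rewrite -e; have i := pw_conv_integrable x01 t0T.
pose D := `]0%R, T / 4[%classic : set R.
pose m := (T / 4) `^ x * T `^ (- x).
have m0 : 0 < m by rewrite mulr_gt0 ?powR_gt0//; lra.
have muD : mu D = (T / 4)%:E.
  rewrite /D lebesgue_measure_itv/= lte_fin ifT; last lra.
  by rewrite -EFinB subr0.
apply: (@lt_le_trans _ _ (\int[mu]_(s in D) m)).
  rewrite Rintegral_cst//; last exact: measurable_itv.
  change (0 < m * fine (mu D)); rewrite muD; apply: mulr_gt0 => //=; lra.
have mD : measurable D by exact: measurable_itv.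
apply: (@le_trans _ _ (\int[mu]_(s in D) (pw x (T / 2 - s) * pw (- x) s))); last first.
  by apply: Rintegral_subset_le => // s; rewrite mulr_ge0// pw_ge0.
apply: le_Rintegral => //.
- have h : mu.-integrable `]0%R, T / 4] (EFin \o (fun s : R => s `^ 0 * m)).
    by apply: integrable_realZr => //; apply: integrable_powR; lra.
  have h' : mu.-integrable D (EFin \o (fun s : R => s `^ 0 * m)).
    apply: integrableS h => // s; rewrite /D /= !in_itv/= => /andP[-> /ltW]; exact.
  by apply: eq_integrable h' => // s _ /=; rewrite powRr0 mul1r.
- exact: L1_integrableS.
move=> s; rewrite /D/= in_itv/= => /andP[s0 s4].
rewrite !pw_in; [|apply/andP; split; lra|apply/andP; split; lra].
apply: ler_pM; rewrite ?powR_ge0//.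
  by apply: ge0_ler_powR; rewrite ?nnegrE; lra.
rewrite !powRN lef_pV2 ?posrE ?powR_gt0//.
by apply: ge0_ler_powR; rewrite ?nnegrE; lra.
Qed.

(** Up to a constant, s^(-x) inverts s^x modulo double integration. Together with [oo_cancel] this
    turns an equation with kernel [pw x] into a Volterra equation of the second kind. *)
Lemma pw_mul x : 0 <= x < 1 -> emb (pw x) * emb (pw (- x)) = acst T (betaB x) * (oo * oo).
Proof.
move=> x01; have /andP[x0 x1] := x01.
have cx : causal (pw x) by apply: causal_pw; lra.
have cy : causal (pw (- x)) by apply: causal_pw; lra.
have co := causal_conv causal_pw0 causal_pw0.
rewrite embM// [oo * oo]emb_oo ?embZ//; last exact: causal_pw0.
apply/embP.
- exact: causal_conv.
- exact: causalZ.
apply: aeW => t tT; have [t0|t0] := leP t 0.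
  by rewrite (causal_conv cx cy).2// co.2// mulr0.
rewrite pw_conv ?t0// prim_conv; [|exact: causal_pw0|exact: ltW].
by rewrite prim_pw ?t0// add0r divr1 powRr1// ltW.
Qed.

(** At u = p s this gives up the power s^(-a) in exchange for the small factor p^(-a), which makes
    the weighted norm of the kernel small in [volterra_uniq]. *)
Lemma expR_le_powR (a u : R) : 0 < a <= 1 -> 0 < u -> expR (- u) <= u `^ (- a).
Proof.
move=> /andP[a0 a1] u0; rewrite expRN powRN lef_pV2 ?posrE ?expR_gt0 ?powR_gt0//.
have [u1|u1] := leP u 1.
  apply: (@le_trans _ _ 1); last by rewrite -expR0 ler_expR ltW.
  by rewrite -(powRr0 u) ger_powR ?u0// ltW.
apply: (@le_trans _ _ u); last by have := expR_ge1Dx u; lra.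
by rewrite -[leRHS]powRr1 ?ler_powR// ltW.
Qed.

(* Weighted L1 norms: for p large, convolution with c s^(-x) contracts the norm of weight e^(-p s). *)
Lemma volterra_uniq x c f : 0 <= x < 1 -> causal f ->
  eqT f (fun t => c * convol (pw (- x)) f t) -> eqT f (fun=> 0).
Proof.
move=> /andP[x0 x1] cf e; have [fi f0] := cf.
have [T0|T0] := leP T 0.
  by apply: aeW => t tT; rewrite f0// (le_trans (ltW tT)).
(* Half of the available margin: [- x - a > -1], so the worsened kernel s^(-x-a) is still
   integrable. *)
pose a := (1 - x) / 2.
pose J := \int[mu]_s pw (- x - a) s.
have I0 : 0 <= J by apply: Rintegral_ge0 => s _; exact: pw_ge0.
(* Chosen so that p^(-a) = 1 / M, which makes the contraction factor [|c| * (M^-1 * J)] less than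
   1. *)
pose M := `|c| * J + 1.
have M0 : 0 < M by rewrite ltr_wpDl// mulr_ge0.
pose p := M `^ a^-1.
have a0 : 0 < a <= 1 by rewrite /a; apply/andP; split; lra.
have p0 : 0 < p by exact: powR_gt0.
have pa : p `^ (- a) = M^-1.
  rewrite /p -powRrM mulrN mulVf ?powRN ?powRr1 ?ltW//.
  by case/andP: a0 => /gt_eqF ->.
pose k s := expR (- (p * s)) * pw (- x) s.
pose h s := if s < T then expR (- (p * s)) * `|f s| else 0.
have me : measurable_fun setT (fun s : R => expR (- (p * s))).
  by apply: measurableT_comp => //; apply: measurable_funN; exact: measurable_funM.
have ck : causal (pw (- x)) by apply: causal_pw; lra.
have e1 s : 0 <= s -> expR (- (p * s)) <= 1.
  by move=> s0; rewrite -expR0 ler_expR oppr_le0 mulr_ge0// ltW.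
have ik : L1 k.
  apply: (le_L1 _ _ ck.1); first by apply: measurable_funM => //; exact: L1_meas ck.1.
  move=> s; rewrite /k normrM ger0_norm ?expR_ge0//.
  have [s0|s0] := leP s 0; first by rewrite ck.2// normr0 mulr0.
  by rewrite ler_piMl// e1// ltW.
have ih : L1 h.
  apply: (le_L1 _ _ fi).
    apply: measurable_fun_ifT => //; first by apply: measurable_fun_ltr.
    by apply: measurable_funM => //; apply: measurableT_comp => //; exact: L1_meas.
  move=> s; rewrite /h; case: ifP => _; last by rewrite normr0.
  rewrite normrM normr_id ger0_norm ?expR_ge0//.
  have [s0|s0] := leP s 0; first by rewrite f0// normr0 mulr0.
  by rewrite ler_piMl// e1// ltW.
have h0 s : 0 <= h s by rewrite /h; case: ifP => // _; rewrite mulr_ge0 ?expR_ge0.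
have k0 s : 0 <= k s by rewrite mulr_ge0 ?expR_ge0 ?pw_ge0.
have ikh := L1_conv ik ih.
have hle : {ae mu, forall t, h t <= `|c| * convol k h t}.
  apply: ae_imp2 e (ae_imp2 (fun t a b => conj a b) (conv_ae_integrable ck.1 fi) (conv_ae_integrable ik ih)).
  move=> t et [it it'].
  have c0 : 0 <= convol k h t by apply: Rintegral_ge0 => s _; rewrite mulr_ge0.
  rewrite {1}/h; case: ifP => tT; last by rewrite mulr_ge0.
  rewrite et// normrM mulrCA ler_wpM2l//.
  rewrite {1}/convol.
  apply: (@le_trans _ _ (expR (- (p * t)) * \int[mu]_s `|pw (- x) (t - s) * f s|)).
    by rewrite ler_wpM2l ?expR_ge0// le_normr_Rintegral.
  rewrite -RintegralZl//; last exact: L1_abs it.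
  apply: le_Rintegral => //; first exact: L1Z (L1_abs it).
  move=> s _; rewrite /k /h normrM ger0_norm ?pw_ge0//.
  have [s0|s0] := leP s 0; first by rewrite f0// normr0 !mulr0 if_same mulr0.
  have [st|st] := leP t s; first by rewrite ck.2 ?subr_le0// !(mulr0, mul0r).
  rewrite (lt_trans st tT) mulrACA -expRD.
  by rewrite (_ : - (p * (t - s)) + - (p * s) = - (p * t)) ?mulrA//; ring.
have ineq : \int[mu]_t h t <= `|c| * (\int[mu]_t k t * \int[mu]_t h t).
  rewrite -Rintegral_conv// -RintegralZl//.
  rewrite /Rintegral fine_le//.
  - exact: integrable_fin_num.
  - by apply: integrable_fin_num => //; exact: L1Z.
  apply: ae_ge0_le_integral => //.
  - by move=> s _; rewrite lee_fin.
  - by have [] := integrableP _ _ _ ih.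
  - by move=> s _; rewrite lee_fin mulr_ge0//; apply: Rintegral_ge0 => r _; rewrite mulr_ge0.
  - by have [] := integrableP _ _ _ (L1Z `|c| ikh).
  - by apply: ae_imp hle => t ht _; rewrite lee_fin.
have kle : \int[mu]_t k t <= M^-1 * J.
  rewrite -RintegralZl//; last by apply: (causal_pw _).1; rewrite /a; lra.
  apply: le_Rintegral => //.
    by apply: L1Z; apply: (causal_pw _).1; rewrite /a; lra.
  move=> s _; rewrite /k /pw; case: ifP => /andP; last by rewrite !mulr0.
  move=> [s0 sT]; rewrite powRD; last by rewrite (gt_eqF s0) implybT.
  rewrite mulrCA [leLHS]mulrC ler_wpM2l ?powR_ge0// -pa -(powRM _ (ltW p0) (ltW s0)).
  by apply: expR_le_powR => //; rewrite mulr_gt0.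
have cM : `|c| * (M^-1 * J) < 1.
  by rewrite mulrCA mulrC ltr_pdivrMr// mul1r /M ltrDl.
have hz : \int[mu]_t h t = 0.
  have hh : 0 <= \int[mu]_t h t by exact: Rintegral_ge0.
  apply/eqP; rewrite eq_le hh andbT leNgt; apply/negP => hp.
  have : `|c| * (\int[mu]_t k t * \int[mu]_t h t) < \int[mu]_t h t.
    rewrite mulrA -[ltRHS]mul1r ltr_pM2r//; apply: le_lt_trans cM.
    by rewrite ler_wpM2l.
  by rewrite ltNge ineq.
have hae : {ae mu, forall t, h t = 0}.
  have mh : measurable_fun setT (EFin \o h) by have [] := integrableP _ _ _ ih.
  have := (@ae_eq_integral_abs _ _ _ mu setT measurableT (EFin \o h) mh).1.
  rewrite (_ : (\int[mu]_(x in setT) _ = \int[mu]_x (h x)%:E)%E); last first.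
    by apply: eq_integral => s _ /=; rewrite ger0_norm.
  have -> : (\int[mu]_x (h x)%:E = 0)%E.
    by rewrite -[LHS]fineK ?integrable_fin_num// -[fine _]/(\int[mu]_x h x) hz.
  by move=> /(_ erefl); apply: ae_imp => s hs; have [] := hs I.
apply: ae_imp hae => t + tT; rewrite /h tT => /eqP.
by rewrite mulf_eq0 gt_eqF ?expR_gt0//= normr_eq0 => /eqP.
Qed.

End embedding.

(* Sealed: conversion tests between classes of functions diverge otherwise. *)
Opaque amul cmul cscale cadd cD mkc cls_of aD acst emb.

(** * The scalar equation: reformulation and uniqueness *)

Section scalar.
Context {R : realType}.
Local Notation mu := (@lebesgue_measure R).

(* the exponent [x] stands for [1 - rho] *)
Definition scalar_solution (T x lam eta : R) (y : R -> R) : Prop :=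
  [/\ forall t, 0 < t < T -> {for t, continuous y},
      mu.-integrable `]0, T[ (EFin \o y) &
      forall t, 0 < t < T ->
        (if x == 0 then y t else
          (Gamma x)^-1 * \int[mu]_(s in `]0, t[) ((t - s) `^ (x - 1) * y s))
        = eta - lam * prim y t].

Lemma convol_itv (f g : R -> R) t : causal f -> causal g ->
  convol f g t = \int[mu]_(s in `]0, t[) (f (t - s) * g s).
Proof.
move=> [fi f0] [gi g0]; rewrite /convol [RHS]Rintegral_mkcond; apply: eq_Rintegral => s _.
rewrite patchE mem_setE in_itv/=; case: ifP => // /negP h.
have [s0|s0] := leP s 0; first by rewrite g0// mulr0.
have [ts|ts] := leP t s; first by rewrite f0 ?mul0r// subr_le0.
by exfalso; apply: h; rewrite s0.
Qed.

Lemma ae_ge0_left (a b : R) (g : R -> R) : a < b ->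
  {ae mu, forall x, a < x < b -> 0 <= g x} -> {for b, continuous g} -> 0 <= g b.
Proof.
move=> ab h cg; rewrite leNgt; apply/negP => gx.
have : \forall y \near b, g y < 0 by exact: (cvgr_lt _ cg _ gx).
move=> /nbhs_ballP[e /= e0 be].
pose d := Num.min e (b - a) / 2.
have d0 : 0 < d by rewrite divr_gt0// lt_min e0 subr_gt0.
have de : d <= e / 2 by rewrite /d ler_pM2r ?invr_gt0// ge_min lexx.
have da : d <= (b - a) / 2 by rewrite /d ler_pM2r ?invr_gt0// ge_min lexx orbT.
have bd : a < b - d < b by apply/andP; split; lra.
have [y [yx yab gy]] := ae_dense h bd d0.
have := be y; rewrite /ball/= => /(_ _)/wrap[]; last by rewrite ltNge gy.
move: yx; rewrite !ltr_norml => /andP[h1 h2]; move/andP: yab => [h3 h4].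
apply/andP; split; lra.
Qed.

Lemma fst_mulr (T : R) (p q : calg T) : q.1 = 0 -> (p * q).1 = 0.
Proof. by move=> q0; rewrite fstM q0 mulr0. Qed.

Lemma acst_mulV (T : R) (a : R) : a != 0 -> acst T a * acst T a^-1 = 1.
Proof. by move=> a0; rewrite -acstM mulfV//; exact: acst1. Qed.

Section solution.
Variables (T x lam eta : R) (y : R -> R).
Hypotheses (T_gt0 : 0 < T) (x_ge0 : 0 <= x) (x_lt1 : x < 1).
Hypothesis sol : scalar_solution T x lam eta y.

Local Notation g := (Gamma (x + 1)).
Local Notation y0 := (y \_ `]0, T[).
Local Notation Y := (emb T y0).
Local Notation X := (emb T (pw T x)).
Local Notation L := (emb T (pw T (- x))).
Local Notation O := (oo T).
Local Notation c_ := (@acst R T).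

Lemma x01 : 0 <= x < 1. Proof. by rewrite x_ge0 x_lt1. Qed.
Lemma g_gt0 : 0 < g. Proof. by apply: Gamma_succ_gt0; rewrite x_ge0 ltW. Qed.
Lemma cX : causal (pw T x). Proof. by have h := x_ge0; apply: causal_pw; lra. Qed.
Lemma cL : causal (pw T (- x)). Proof. by have h := x_lt1; apply: causal_pw; lra. Qed.
Lemma co : causal (pw T 0). Proof. exact: causal_pw0. Qed.

Lemma y0E t : 0 < t < T -> y0 t = y t.
Proof. by move=> tT; rewrite patchE mem_setE in_itv/= tT. Qed.

Lemma causal_y0 : causal y0.
Proof.
have [_ yi _] := sol; split; first exact: L1_restrict.
by move=> s s0; rewrite patchE mem_setE in_itv/= ltNge s0.
Qed.

Lemma prim_y0 t : t <= T -> prim y t = prim y0 t.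
Proof.
move=> tT; apply: eq_Rintegral => s; rewrite inE/= in_itv/= => /andP[s0 st].
by rewrite y0E// s0 (lt_le_trans st).
Qed.

Lemma causalBZ (c d : R) f h : causal f -> causal h -> causal (fun t : R => c * f t - d * h t).
Proof. by move=> cf ch; apply: causalD; [exact: causalZ|apply: causalN; exact: causalZ]. Qed.

Lemma embBZ (c d : R) f h : causal f -> causal h ->
  emb T (fun t : R => c * f t - d * h t) = c_ c * emb T f - c_ d * emb T h.
Proof.
move=> cf ch; rewrite [c_ c * _]embZ// [c_ d * _]embZ//.
have -> : - emb T (fun t : R => d * h t) = emb T (fun t : R => - (d * h t)).
  have cd := causalZ d ch; have cn := causalN cd.
  apply/eqP; rewrite eq_sym -subr_eq0 opprK embD// -[X in _ == X](emb0 T); apply/eqP; apply/embP.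
  - exact: causalD.
  - exact: causal0.
  by apply: aeW => t _; rewrite addNr.
by rewrite embD//; [exact: causalZ|apply: causalN; exact: causalZ].
Qed.

Lemma emb_rhs : emb T (fun t => eta * pw T 0 t - lam * convol (pw T 0) y0 t) = c_ eta * O - c_ lam * (O * Y).
Proof.
have cy := causal_y0; have cp : causal (convol (pw T 0) y0) by exact: causal_conv co cy.
by rewrite embBZ; [congr (_ - _ * _); rewrite emb_oo|exact: co|exact: cp].
Qed.

(** Integrating the equation once more replaces the kernel s^(x-1) / Gamma(x), which has no meaning
    at [x = 0], by s^x / Gamma(x + 1). Both cases of [scalar_solution] then take the same form, with
    [X] equal to [oo T] at [x = 0]. *)
Lemma volterra_eq : X * Y + c_ (g * lam) * (O * O) * Y = c_ (g * eta) * (O * O).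
Proof.
have cy := causal_y0; have [_ _ sy] := sol; have cx := cX; have co := co.
have cp : causal (convol (pw T 0) y0) by exact: causal_conv.
have rhs := emb_rhs.
have [x0|x0] := eqVneq x 0.
  have g1 : g = 1 by rewrite x0 add0r Gamma1.
  have e : Y = c_ eta * O - c_ lam * (O * Y).
    rewrite -rhs; apply/embP; [exact: cy|exact: causalBZ|].
    apply: aeW => t tT; have [t0|t0] := leP t 0.
      by rewrite cy.2// co.2// cp.2// !mulr0 subr0.
    have t0T : 0 < t < T by rewrite t0.
    rewrite prim_conv//; last exact: ltW.
    rewrite y0E// pw_in// powRr0 mulr1 -prim_y0; last exact: ltW.
    by have := sy t t0T; rewrite x0 eqxx.
  rewrite g1 !mul1r x0 -/(oo T) {1}e; ring.
have xp : 0 < x by rewrite lt_neqAle eq_sym x0 x_ge0.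
have x1 := x_lt1.
have cK : causal (pw T (x - 1)) by apply: causal_pw; lra.
have gE : g = Gamma x * x by rewrite GammaS 1?mulrC// ltW.
have Gx0 : 0 < Gamma x by rewrite -(pmulr_lgt0 _ xp) -gE g_gt0.
have e : c_ (Gamma x)^-1 * (emb T (pw T (x - 1)) * Y) = c_ eta * O - c_ lam * (O * Y).
  have ck := causal_conv cK cy.
  rewrite -rhs [emb T (pw T (x - 1)) * _]embM// [c_ _ * _]embZ//; apply/embP; [exact: causalZ|exact: causalBZ|].
  apply: aeW => t tT; have [t0|t0] := leP t 0.
    by rewrite ck.2// co.2// cp.2// !mulr0 subr0.
  have t0T : 0 < t < T by rewrite t0.
  rewrite [in RHS]prim_conv//; last exact: ltW.
  rewrite pw_in// powRr0 mulr1 -prim_y0; last exact: ltW.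
  have := sy t t0T; rewrite (negbTE x0) => <-; congr (_ * _).
  rewrite convol_itv//; apply: eq_Rintegral => s; rewrite inE/= in_itv/= => /andP[s0 st].
  rewrite y0E ?s0 ?(lt_trans st)// pw_in// subr_gt0 st /=.
  by apply: le_lt_trans tT; rewrite gerBl ltW.
have eX : O * emb T (pw T (x - 1)) = c_ x^-1 * X.
  rewrite [oo T * _]emb_oo // [c_ _ * _]embZ//; apply/embP; [exact: causal_conv|exact: causalZ|].
  apply: aeW => t tT; have [t0|t0] := leP t 0.
    by rewrite (causal_conv co cK).2// cx.2// mulr0.
  rewrite prim_conv//; last exact: ltW.
  rewrite prim_pw ?t0 //; last by rewrite -subr_gt0 opprK subrK.
  by rewrite subrK pw_in ?t0// mulrC.
have h : c_ (Gamma x) * c_ (Gamma x)^-1 = 1 by apply: acst_mulV; rewrite gt_eqF.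
have h' : c_ x * c_ x^-1 = 1 by exact: acst_mulV.
have -> : X * Y = c_ (Gamma x) * c_ x * (O * (c_ (Gamma x)^-1 * (emb T (pw T (x - 1)) * Y))).
  transitivity ((c_ (Gamma x) * c_ (Gamma x)^-1) * c_ x * (O * emb T (pw T (x - 1))) * Y); last by ring.
  rewrite eX h; transitivity ((c_ x * c_ x^-1) * X * Y); last by ring.
  rewrite h' mul1r; reflexivity.
rewrite e gE !acstM; ring.
Qed.

(** Multiply by [L] and divide by [betaB x]: by [pw_mul] the left side becomes [oo T] squared times
    p + (c / betaB x) L p. Cancelling [oo T] twice leaves a homogeneous Volterra equation with
    kernel s^(-x). *)
Lemma kernel_uniq (c : R) (p : calg T) : p.1 = 0 -> X * p + c_ c * (O * O) * p = 0 -> p = 0.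
Proof.
move=> p0 e; have B0 := betaB_gt0 T_gt0 x01; have cl := cL.
have h : c_ (betaB x) * c_ (betaB x)^-1 = 1 by apply: acst_mulV; rewrite gt_eqF.
have e1 : O * (O * (p + c_ ((betaB x)^-1 * c) * (L * p))) = 0.
  transitivity (c_ (betaB x)^-1 * L * (X * p + c_ c * (O * O) * p)); last by rewrite e mulr0.
  transitivity (O * O * (1 * p + c_ ((betaB x)^-1 * c) * (L * p))); first by rewrite mul1r mulrA.
  rewrite -h acstM; have XL := pw_mul T x01.
  transitivity (c_ (betaB x)^-1 * (c_ (betaB x) * (O * O)) * p + c_ (betaB x)^-1 * L * (c_ c * (O * O) * p)); first by ring.
  by rewrite -XL; ring.
have z1 : (O * (p + c_ ((betaB x)^-1 * c) * (L * p))).1 = 0 by rewrite fstM fst_emb mul0r.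
have z2 : (p + c_ ((betaB x)^-1 * c) * (L * p)).1 = 0.
  by rewrite fstD !fstM fst_emb p0 !(mulr0, mul0r, add0r).
have e2 := oo_cancel z2 (oo_cancel z1 e1).
have [f cf pf] : exists2 f, causal f & p = emb T f.
  by exists (cval p.2); [exact: causal_cval|exact: emb_cval].
rewrite pf -(emb0 T); apply/embP; [by []|exact: causal0|].
apply: (@volterra_uniq R T x (- ((betaB x)^-1 * c))); [exact: x01|exact: cf|].
move: e2; rewrite pf [L * _]embM// => /eqP; rewrite addr_eq0 -mulNr -acstN [c_ _ * _]embZ; last exact: causal_conv.
by move=> /eqP/embP; apply => //; apply: causalZ; exact: causal_conv.
Qed.

End solution.

Lemma scalar_uniq (T x lam : R) (y : R -> R) : 0 < T -> 0 <= x -> x < 1 ->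
  scalar_solution T x lam 0 y -> forall t, 0 < t < T -> y t = 0.
Proof.
move=> T0 x0 x1 sol t tT; have [cy _ _] := sol.
have := volterra_eq x0 x1 sol; rewrite mulr0 acst0 mul0r => e.
have := kernel_uniq T0 x0 x1 (fst_emb T _) e; rewrite -(emb0 T) => /embP.
move=> /(_ (causal_y0 sol) (@causal0 R)) h.
apply: (@ae_eq0_continuous R 0 T) => //; last exact: cy.
by apply: ae_imp h => s hs sT; rewrite -(y0E y sT) hs//; case/andP: sT.
Qed.

End scalar.

(** Apply [D] to the equation for [d] and subtract [(cx + 1) * b + (1 - cx) * (b - cl * (b * d))]
    times the equation itself: what remains is the homogeneous equation for the bracket. In the
    application [a] is the power kernel, [b] the constant function 1, [d] the solution and [1 - cx]
    the order. *)
Lemma resolvent_alg (A : comNzRingType) (D : A -> A) (a b d cg cl cx : A) :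
  (forall p q, D (p + q) = D p + D q) -> (forall p q, D (p * q) = D p * q + p * D q) ->
  D cg = 0 -> D cl = 0 -> D b = b * b -> D a = (cx + 1) * (b * a) ->
  a * d + cg * cl * (b * b) * d = cg * (b * b) ->
  a * (D d - (1 - cx) * ((b - cl * (b * d)) * d)) + cg * cl * (b * b) * (D d - (1 - cx) * ((b - cl * (b * d)) * d)) = 0.
Proof.
move=> DD DM Dcg Dcl Db Da e1.
have e2 : D (a * d + cg * cl * (b * b) * d) = D (cg * (b * b)) by rewrite e1.
move: e2; rewrite !(DD, DM) Dcg Dcl Db Da => e2.
transitivity ((cx + 1) * (b * a) * d + a * D d +
   (((0 * cl + cg * 0) * (b * b) + cg * cl * (b * b * b + b * (b * b))) * d + cg * cl * (b * b) * D d)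
   - (0 * (b * b) + cg * (b * b * b + b * (b * b)))
  - ((cx + 1) * b + (1 - cx) * (b - cl * (b * d))) * (a * d + cg * cl * (b * b) * d - cg * (b * b))); first by ring.
by rewrite e1 e2 !subrr mulr0 subrr.
Qed.

(** * Positivity and tails of scalar solutions *)

Section positivity.
Context {R : realType}.
Local Notation mu := (@lebesgue_measure R).

Lemma convol_le (f p q : R -> R) t : causal f -> causal p -> causal q ->
  L1 (fun s => f (t - s) * p s) -> L1 (fun s => f (t - s) * q s) ->
  (forall s, 0 < s < t -> 0 <= f s) -> (forall s, 0 < s < t -> p s <= q s) ->
  convol f p t <= convol f q t.
Proof.
move=> cf cp cq ip iq f0 pq; apply: le_Rintegral => // s _.
have [s0|s0] := leP s 0; first by rewrite cp.2// cq.2// !mulr0.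
have [ts|ts] := leP t s; first by rewrite cf.2 ?mul0r// subr_le0.
by apply: ler_wpM2l; [apply: f0|apply: pq]; apply/andP; split; lra.
Qed.

(** Bounds that are stable under convolution and strong enough that convolving a slowly varying
    kernel with [w] barely changes it: pointwise decay, total mass at most one, small missing
    mass. *)
Definition tame (T a K : R) (w : R -> R) : Prop :=
  [/\ causal w, forall s, 0 <= w s, forall s, s * w s <= K, \int[mu]_s w s <= 1 &
      forall t, 0 < t < T -> 1 - prim w t <= K * t `^ (- a)].

Lemma integrable_cst_itv (D : set R) (c : R) : measurable D -> (mu D < +oo)%E ->
  mu.-integrable D (EFin \o (fun=> c)).
Proof.
move=> mD fD; apply: measurable_bounded_integrable => //.
exists `|c|; split; first by rewrite num_real.
by move=> M cM s _ /=; exact: ltW.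
Qed.

Lemma mu_itv_oo_fin (a b : R) : (mu `]a, b[ < +oo)%E.
Proof. by rewrite lebesgue_measure_itv/=; case: ifP => _; rewrite -?EFinB ltry. Qed.

Lemma L1_cst_itv (a b c : R) : L1 ((fun=> c) \_ `[a, b]).
Proof.
apply: L1_restrict => //; apply: integrable_cst_itv => //.
by rewrite lebesgue_measure_itv/=; case: ifP => _; rewrite -?EFinB ltry.
Qed.

Lemma convol_bound (f h : R -> R) t M : causal f -> causal h ->
  L1 (fun s => f (t - s) * h s) -> (forall s, 0 < s < t -> `|f s| <= M) ->
  `|convol f h t| <= M * prim (fun s => `|h s|) t.
Proof.
move=> cf ch it fM.
have ih : L1 (fun s => M * ((fun s => `|h s|) \_ `]0, t[) s).
  by apply: L1Z; apply: L1_restrict => //; apply: L1_integrableS => //; exact: L1_abs ch.1.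
apply: (@le_trans _ _ (\int[mu]_s `|f (t - s) * h s|)); first exact: le_normr_Rintegral.
rewrite /prim [in leRHS]Rintegral_mkcond -RintegralZl//; last first.
  by apply: L1_restrict => //; apply: L1_integrableS => //; exact: L1_abs ch.1.
apply: le_Rintegral => //; first exact: L1_abs it.
move=> s _; rewrite patchE mem_setE in_itv/= normrM; case: ifP => [/andP[s0 st]|/negP h'].
  by apply: ler_wpM2r => //; apply: fM; apply/andP; split; lra.
rewrite mulr0; have [s0|s0] := leP s 0; first by rewrite ch.2// normr0 mulr0.
have [st|st] := leP t s; first by rewrite cf.2 ?normr0 ?mul0r// subr_le0.
by exfalso; apply: h'; rewrite s0.
Qed.

Variables (T x lam : R) (y : R -> R).
Hypotheses (T_gt0 : 0 < T) (x_ge0 : 0 <= x) (x_lt1 : x < 1) (lam_gt0 : 0 < lam).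
Hypothesis sol : scalar_solution T x lam 1 y.

Local Notation g := (Gamma (x + 1)).
Local Notation y0 := (y \_ `]0, T[).
Local Notation Y := (emb T y0).
Local Notation X := (emb T (pw T x)).
Local Notation L := (emb T (pw T (- x))).
Local Notation O := (oo T).
Local Notation c_ := (@acst R T).
Local Notation F := (prim y).

(** On (0, T) this is the Mittag-Leffler function of -lam t^rho, the tail [E] of the overview; the
    factor [1 *] matches the shape of [embBZ]. *)
Definition survival (t : R) : R := 1 * pw T 0 t - lam * convol (pw T 0) y0 t.
Local Notation E := (emb T survival).

Lemma causal_conv0 : causal (convol (pw T 0) y0).
Proof. by apply: causal_conv; [exact: causal_pw0|exact: causal_y0 sol]. Qed.

Lemma causal_survival : causal survival.
Proof. by apply: causalBZ; [exact: causal_pw0|exact: causal_conv0]. Qed.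

Lemma survivalE t : 0 < t < T -> survival t = 1 - lam * F t.
Proof.
move=> tT; have /andP[t0 t1] := tT; rewrite /survival pw_in// powRr0 mulr1 prim_conv ?(ltW t1)//; last exact: causal_y0 sol.
by rewrite -prim_y0// ltW.
Qed.

Lemma emb_survival : E = O - c_ lam * (O * Y).
Proof. have := emb_rhs sol; rewrite acst1 mul1r; exact. Qed.

Lemma volterra_eq1 : X * Y + c_ g * c_ lam * (O * O) * Y = c_ g * (O * O).
Proof. by have := volterra_eq x_ge0 x_lt1 sol; rewrite mulr1 acstM. Qed.

Lemma emb_survival_conv : X * Y = c_ g * (O * E).
Proof.
rewrite emb_survival; have := volterra_eq1 => e.
transitivity (X * Y + c_ g * c_ lam * (O * O) * Y - c_ g * c_ lam * (O * O) * Y); first by ring.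
rewrite e; ring.
Qed.

(** In Laplace variables [Y] is 1 / (p^rho + lam) and [E] is p^(rho-1) / (p^rho + lam), so - d/dp of
    the former is rho times the product of the two. The proof gets this from uniqueness: the
    difference of the two sides solves the homogeneous equation. *)
Lemma aD_solution : aD Y = c_ (1 - x) * (E * Y).
Proof.
have h : 0 < g := g_gt0 x_ge0 x_lt1.
have xx : -1 < x by have := x_ge0; lra.
have e1 := volterra_eq1; have eX := aD_pw T xx; rewrite acstD acst1 in eX.
apply/eqP; rewrite -subr_eq0; apply/eqP.
apply: (kernel_uniq T_gt0 x_ge0 x_lt1 (c := g * lam)); first by rewrite fstD fstN !fstM fst_aD fst_emb !mulr0 subrr.
rewrite emb_survival acstD acstN acst1 acstM.
apply: (@resolvent_alg (calg T) (@aD R T)).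
- exact: aDD.
- exact: aDM.
- exact: aDcst.
- exact: aDcst.
- exact: aD_oo.
- exact: eX.
- exact: e1.
Qed.


Local Notation B := (betaB x).

(** This is [emb_survival_conv] multiplied by [L], with [oo T] cancelled. As [survival] is close to
    1 near 0, it makes [F] comparable to t^(1-x) there. *)
Lemma fractional_prim : c_ B * (O * Y) = c_ g * (L * E).
Proof.
have e := emb_survival_conv; have XL := pw_mul T (x01 x_ge0 x_lt1).
have z1 : (c_ B * (O * Y)).1 = 0 by apply: fst_mulr; apply: fst_mulr; exact: fst_emb.
have z2 : (c_ g * (L * E)).1 = 0 by apply: fst_mulr; apply: fst_mulr; exact: fst_emb.
refine (@oo_inj R T (c_ B * (O * Y)) (c_ g * (L * E)) (etrans z1 (esym z2)) _).
transitivity (L * (X * Y)); first (transitivity ((X * L) * Y); [rewrite XL; ring | ring]).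
rewrite e; ring.
Qed.

Lemma ae_fractional_prim : {ae mu, forall t, 0 < t < T ->
  B * F t = g * convol (pw T (- x)) survival t}.
Proof.
have := fractional_prim; have cp := causal_conv0; have cs := causal_survival; have cl := @cL R T x x_lt1.
have cls' := causal_conv cl cs; have cy := causal_y0 sol.
rewrite [oo T * _]emb_oo // [c_ B * _]embZ// [L * _]embM// [c_ g * _]embZ// => /embP.
move=> /(_ (causalZ _ cp) (causalZ _ cls')); apply: ae_imp => t h /andP[t0 tT].
by rewrite -h// prim_conv ?(ltW tT)// -prim_y0// ltW.
Qed.

Lemma prim_solution_continuous t : 0 < t < T -> {for t, continuous F}.
Proof.
move=> /andP[t0 tT]; have [y0i _] := causal_y0 sol.
have := prim_continuous y0i t0; rewrite /prop_for /continuous_at -prim_y0 ?(ltW tT)//.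
apply: cvg_trans; apply: near_eq_cvg; near=> s; rewrite -prim_y0//.
by apply: ltW; near: s; exact: lt_nbhsl.
Unshelve. all: by end_near.
Qed.

Lemma prim_small (f : R -> R) (e : R) : L1 f -> 0 < e ->
  exists2 r, 0 < r < T & forall t, 0 < t < r -> `|prim f t| <= e.
Proof.
move=> fi e0.
have : \forall t \near 0^'+, `|0 - prim f t| < e by apply: (@cvgrPdist_lt _ _ _ _ _ _ _).1 e0; exact: prim_cvg0.
move=> [r /= r0 h]; exists (Num.min r T / 2).
  have T0 := T_gt0; apply/andP; split; first by rewrite divr_gt0// lt_min r0.
  by rewrite ltr_pdivrMr// (le_lt_trans (_ : _ <= T))// ?ge_min ?lexx ?orbT// ltr_pMr// ltr1n.
move=> t /andP[t0]; rewrite ltr_pdivlMr// lt_min => /andP[t1 t2].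
have := h t; rewrite /ball_/= !sub0r !normrN (gtr0_norm t0) => {}h.
have tr : t < r by lra.
exact/ltW/h.
Qed.

Lemma survival_half : exists2 r, 0 < r < T & forall t, 0 < t < r -> 1/2 <= survival t <= 3/2.
Proof.
have l0 := lam_gt0; have e0 : 0 < (2 * lam)^-1 by rewrite invr_gt0; lra.
have [r rT small] := prim_small (causal_y0 sol).1 e0; exists r => // t /andP[t0 tr].
have /andP[r0 r1] := rT; rewrite survivalE; last by rewrite t0 (lt_trans tr).
have := small t; rewrite t0 tr -prim_y0 ?(ltW (lt_trans tr r1))// => /(_ isT).
rewrite ler_norml => /andP[h1 h2].
have e : lam * (2 * lam)^-1 = 1/2 by field; lra.
have := ler_wpM2l (ltW l0) h1; have := ler_wpM2l (ltW l0) h2; rewrite mulrN e => h3 h4.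
apply/andP; split; lra.
Qed.

Lemma prim_near0 : exists2 r, 0 < r < T & exists2 c : R, 0 < c &
  forall t, 0 < t < r -> c * t `^ (1 - x) <= F t <= 3 * (c * t `^ (1 - x)).
Proof.
have [r rT half] := survival_half; exists r => //.
have B0 := betaB_gt0 T_gt0 (x01 x_ge0 x_lt1); have g0 := g_gt0 x_ge0 x_lt1.
have x1 := x_lt1.
(* Half of the coefficient obtained when [survival] is replaced by 1; with [survival] between 1/2
   and 3/2 this gives the factors 1 and 3. *)
exists (g / B / (1 - x) / 2); first by rewrite !divr_gt0//; lra.
have cl := @cL R T x x_lt1; have cs := causal_survival; have co := causal_pw0 T.
have ae : {ae mu, forall t, 0 < t < r ->
   0 <= F t - g / B / (1 - x) / 2 * t `^ (1 - x) /\ 0 <= 3 * (g / B / (1 - x) / 2 * t `^ (1 - x)) - F t}.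
  apply: ae_imp2 ae_fractional_prim (ae_imp2 (fun t a b => conj a b) (conv_ae_integrable cl.1 cs.1) (conv_ae_integrable cl.1 co.1)).
  move=> t eF [i1 i2] /andP[t0 tr]; have /andP[r0 r1] := rT.
  have tT : 0 < t < T by rewrite t0 (lt_trans tr).
  have V : convol (pw T (- x)) (pw T 0) t = t `^ (1 - x) / (1 - x).
    rewrite (convolC cl.1 co.1) prim_conv//; last by case/andP: tT => _ /ltW.
    by rewrite prim_pw//; [rewrite addrC|lra].
  have ppos s : 0 < s < t -> 0 <= pw T (- x) s by rewrite pw_ge0.
  have i2' (c : R) : L1 (fun s => pw T (- x) (t - s) * (c * pw T 0 s)).
    by have := L1Z c i2; apply: eq_integrable => // s _ /=; rewrite mulrCA.
  have cc (c : R) : causal (fun s => c * pw T 0 s) by exact: causalZ.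
  have pw1 s : 0 < s < t -> pw T 0 s = 1.
    by move=> /andP[s0 st]; rewrite pw_in ?powRr0// s0 (lt_trans st)// (lt_trans tr).
  have st_r s : 0 < s < t -> 0 < s < r by move=> /andP[-> /lt_trans]; apply.
  have h1 := convol_le cl (cc (1/2)) cs (i2' _) i1 ppos _.
  have {}h1 := h1 (fun s h => ltac:(rewrite pw1// mulr1; by case/andP: (half s (st_r s h)))).
  have h2 := convol_le cl cs (cc (3/2)) i1 (i2' _) ppos _.
  have {}h2 := h2 (fun s h => ltac:(rewrite pw1// mulr1; by case/andP: (half s (st_r s h)))).
  have V' (c : R) : convol (pw T (- x)) (fun s => c * pw T 0 s) t = c * (t `^ (1 - x) / (1 - x)).
    by rewrite (convZr _ _ cl.1 co.1) V.
  move: h1 h2; rewrite !V' => h1 h2.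
  have -> : F t = g / B * convol (pw T (- x)) survival t.
    by rewrite mulrAC -(eF tT) mulrC mulKf// gt_eqF.
  have gB : 0 <= g / B by rewrite divr_ge0// ltW.
  have := ler_wpM2l gB h1; have := ler_wpM2l gB h2; split; lra.
have cF t : 0 < t < r -> {for t, continuous F}.
  move=> /andP[t0 tr]; apply: prim_solution_continuous; rewrite t0 (lt_trans tr)//; by case/andP: rT.
have cP (c : R) t : 0 < t < r -> {for t, continuous (fun t => c * t `^ (1 - x))}.
  by move=> /andP[t0 _]; apply: continuousM; [exact: cst_continuous|exact: continuous_powR_pos].
move=> t tr; apply/andP; split; rewrite -subr_ge0.
  apply: (@ae_ge0_continuous R 0 r (fun t => F t - g / B / (1 - x) / 2 * t `^ (1 - x))) => //.
    by apply: ae_imp ae => s h sr; case: (h sr).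
  by apply: continuousB; [exact: cF|exact: cP].
apply: (@ae_ge0_continuous R 0 r (fun t => 3 * (g / B / (1 - x) / 2 * t `^ (1 - x)) - F t)) => //.
  by apply: ae_imp ae => s h sr; case: (h sr).
apply: continuousB; last exact: cF.
by apply: continuousM; [exact: cst_continuous|exact: cP].
Qed.

Lemma ae_solution : {ae mu, forall t, 0 < t < T -> t * y t = (1 - x) * convol survival y0 t}.
Proof.
have cs := causal_survival; have cy := causal_y0 sol; have cc := causal_conv cs cy.
have := aD_solution; rewrite emb_aD// [E * _]embM// [c_ (1 - x) * _]embZ// => /embP.
move=> /(_ (causal_tmul T cy) (causalZ _ cc)); apply: ae_imp => t h /andP[t0 tT].
by rewrite -h// /tmul tT y0E// t0.
Qed.

Lemma ae_solution_prim : {ae mu, forall t, 0 < t < T ->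
  t * y t = (1 - x) * (F t - lam * convol (convol (pw T 0) y0) y0 t)}.
Proof.
have cy := causal_y0 sol; have c0 := causal_conv0; have cc := causal_conv c0 cy.
have e : E * Y = O * Y - c_ lam * (O * Y * Y) by rewrite emb_survival; ring.
have := aD_solution; rewrite e [oo T * _]emb_oo// [emb T (convol (pw T 0) y0) * _]embM//.
rewrite emb_aD// -[emb T (convol (pw T 0) y0)]mul1r -acst1 -embBZ//.
rewrite [c_ (1 - x) * _]embZ; last exact: causalBZ.
move=> /embP; move=> /(_ (causal_tmul T cy) (causalZ _ (causalBZ _ _ c0 cc))); apply: ae_imp => t h /andP[t0 tT].
have := h tT; rewrite /tmul tT y0E ?t0// => ->; rewrite mul1r; congr (_ * (_ - _)).
by rewrite prim_conv ?(ltW tT)// -prim_y0// ltW.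
Qed.

(** The sign of [y] is still unknown, so in [ae_solution_prim] the convolution of [F] with [y] is
    bounded through the integral of [|y|], which is small near 0; the term [F] then dominates. *)
Lemma solution_near0 : exists2 r, 0 < r < T & forall t, 0 < t < r -> 0 < y t.
Proof.
have [r /andP[r0 rT] [c c0 cF]] := prim_near0.
(* With [F] at most 3 c t^(1-x), the bound 1 / (6 lam) on the integral of [|y|] keeps the
   convolution term below (c / 2) t^(1-x), half of the lower bound of [F]. *)
have l0 := lam_gt0; have e0 : 0 < (6 * lam)^-1 by rewrite invr_gt0; lra.
have cy := causal_y0 sol; have [r' /andP[r'0 r'T] small] := prim_small (L1_abs cy.1) e0.
have [yc _ _] := sol; have x1 := x_lt1.
pose q : R := Num.min r r'; have q0 : 0 < q by rewrite lt_min r0.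
have qr t : t < q -> t < r /\ t < r' by rewrite lt_min => /andP[].
exists q; first by rewrite q0 gt_min rT.
move=> t /andP[t0 tq].
have cF0 := causal_conv0.
suff : 0 <= t * y t - (1 - x) * (c / 2) * t `^ (1 - x).
  rewrite subr_ge0 => h; rewrite -(pmulr_rgt0 _ t0); apply: lt_le_trans h.
  by rewrite !mulr_gt0 ?powR_gt0//; lra.
apply: (@ae_ge0_continuous R 0 q (fun t => t * y t - (1 - x) * (c / 2) * t `^ (1 - x))); last first.
- apply: continuousB; first apply: continuousM => //.
    by have [tr _] := qr _ tq; apply: yc; rewrite t0 (lt_trans tr).
  by apply: continuousM; [exact: cst_continuous|exact: continuous_powR_pos].
- by rewrite t0.
apply: ae_imp2 ae_solution_prim (conv_ae_integrable cF0.1 cy.1) => {t0 tq}t e it /andP[t0 tq].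
have [tr tr'] := qr _ tq; have tT := lt_trans tr rT; rewrite e ?t0//.
have bnd s : 0 < s < t -> `|convol (pw T 0) y0 s| <= 3 * (c * t `^ (1 - x)).
  move=> /andP[s0 st]; have sT := lt_trans st tT.
  rewrite prim_conv ?(ltW sT)// -prim_y0 ?(ltW sT)//.
  have := cF s; rewrite s0 (lt_trans st) // => /(_ isT) /andP[h1 h2].
  have p0 : 0 <= c * s `^ (1 - x) by rewrite mulr_ge0 ?powR_ge0// ltW.
  have pp : c * s `^ (1 - x) <= c * t `^ (1 - x).
    by rewrite ler_pM2l// ge0_ler_powR ?nnegrE ?subr_ge0 ?(ltW s0) ?(ltW st) ?(ltW t0) ?(ltW x1).
  by rewrite ger0_norm ?(le_trans p0 h1)//; apply: (le_trans h2); rewrite ler_pM2l.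
have := convol_bound cF0 cy it bnd.
have := small t; rewrite t0 tr' => /(_ isT); rewrite ger0_norm; last by apply: Rintegral_ge0 => s _.
have := cF t; rewrite t0 tr => /(_ isT) /andP[h1 h2] h3 h4.
have p0 : 0 <= 3 * (c * t `^ (1 - x)) by rewrite !mulr_ge0 ?powR_ge0// ltW.
have h5 := le_trans h4 (ler_wpM2l p0 h3).
have := ler_norm (convol (convol (pw T 0) y0) y0 t) => /le_trans/(_ h5)/(ler_wpM2l (ltW l0)).
have -> : lam * (3 * (c * t `^ (1 - x)) * (6 * lam)^-1) = c / 2 * t `^ (1 - x) by field; rewrite gt_eqF.
move=> h6; rewrite -mulrA -mulrBr mulr_ge0//; [by rewrite subr_ge0 ltW|clear -T_gt0 x_ge0 x_lt1 lam_gt0 sol h1 h6; lra].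
Qed.

Lemma Gamma_gt0 : x != 0 -> 0 < Gamma x.
Proof.
move=> x0; have xp : 0 < x by rewrite lt_neqAle eq_sym x0 x_ge0.
by rewrite -(pmulr_rgt0 _ xp) -GammaS ?(ltW x_lt1)//; exact: g_gt0 x_ge0 x_lt1.
Qed.

(** The scalar equation itself writes [survival] as a fractional integral of [y], or as [y] when
    [x = 0]; its sign at [t] follows from that of [y] up to [t]. *)
Lemma survival_ge0 t : 0 < t < T -> (forall s, 0 < s <= t -> 0 <= y s) -> 0 <= survival t.
Proof.
move=> tT y_ge0; have [_ _ e] := sol; rewrite survivalE// -e//; case: ifP => x0.
  by apply: y_ge0; rewrite lexx andbT; case/andP: tT.
rewrite mulr_ge0 ?invr_ge0 ?(ltW (Gamma_gt0 (negbT x0)))//.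
apply: Rintegral_ge0 => s; rewrite /= in_itv/= => /andP[s0 st].
by rewrite mulr_ge0 ?powR_ge0// y_ge0// s0 ltW.
Qed.

(** In [ae_solution] all factors are nonnegative before [t1], and lags short enough for [survival]
    to be at least 1/2 contribute a strictly positive amount. The identity holds only almost
    everywhere, so a bound uniform on a left neighbourhood of [t1] is proved and carried to [t1] by
    continuity. *)
Lemma solution_step t1 : 0 < t1 < T -> (forall t, 0 < t < t1 -> 0 < y t) -> 0 < y t1.
Proof.
move=> /andP[t10 t1T] pos; have [r /andP[r0 rT] half] := survival_half.
have [yc _ _] := sol; have x1 := x_lt1.
pose q : R := Num.min r t1 / 2; have q0 : 0 < q by rewrite divr_gt0// lt_min r0.
have qr : q < r by rewrite /q ltr_pdivrMr// gt_min; apply/orP; left; lra.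
have qt : q < t1 by rewrite /q ltr_pdivrMr// gt_min; apply/orP; right; lra.
have cs := causal_survival; have cy := causal_y0 sol.
(* For [t] in []b, t1[] and [s] in [[a, b]] the lag [t - s] lies in []0, q[], within the range of
   [half]; the window has length [q / 2] and does not depend on [t]. *)
pose a := t1 - q; pose b := t1 - q / 2.
have ab : a <= b by rewrite /a /b; lra.
have [m mab mmin] : exists2 m, m \in `[a, b] & forall s, s \in `[a, b] -> y m <= y s.
  apply: EVT_min => //; apply: continuous_in_subspaceT => s; rewrite inE/= in_itv/= => /andP[s1 s2].
  by apply: yc; apply/andP; rewrite /a /b in s1 s2; split; lra.
have m0 : 0 < y m.
  by apply: pos; move: mab; rewrite in_itv/= /a /b => /andP[h1 h2]; apply/andP; split; lra.
suff : 0 <= t1 * y t1 - (1 - x) * (y m / 2 * (q / 2)).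
  rewrite subr_ge0 => h; rewrite -(pmulr_rgt0 _ t10); apply: lt_le_trans h.
  by apply: mulr_gt0; [lra|apply: mulr_gt0; rewrite divr_gt0].
apply: (@ae_ge0_left R b t1 (fun t => t * y t - (1 - x) * (y m / 2 * (q / 2)))); first by rewrite /b; lra.
  apply: ae_imp2 ae_solution (conv_ae_integrable cs.1 cy.1) => t e it /andP[tb tt].
  have t0 : 0 < t by rewrite /b in tb; lra.
  have tT := lt_trans tt t1T.
  rewrite e ?t0// subr_ge0 ler_pM2l ?subr_gt0//.
  have muD : mu `[a, b] = (q / 2)%:E.
    rewrite lebesgue_measure_itv/= lte_fin ifT; last by rewrite /a /b; lra.
    by rewrite -EFinB /a /b; congr (_%:E); lra.
  rewrite (_ : _ * (q / 2) = \int[mu]_(s in `[a, b]) (y m / 2)); last first.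
    by rewrite Rintegral_cst//; change (y m / 2 * (q / 2) = y m / 2 * fine (mu `[a, b])); rewrite muD.
  rewrite [leLHS]Rintegral_mkcond; apply: le_Rintegral => //.
    exact: L1_cst_itv.
  move=> s _; rewrite patchE mem_setE in_itv/=; case: ifP => [sab|_].
    have /andP[sa sb] := sab; rewrite /a /b in sa sb tb.
    have s0T : 0 < s < T by clear -T_gt0 x_ge0 x_lt1 lam_gt0 sol sa sb q0 qt t1T; apply/andP; split; lra.
    have ts : 0 < t - s < r by clear -T_gt0 x_ge0 x_lt1 lam_gt0 sol sb sa tb tt qr q0; apply/andP; split; lra.
    rewrite y0E// mulrC; have /andP[h1 _] := half _ ts.
    have h2 : y m <= y s by apply: mmin; rewrite in_itv/= /a /b sa.
    by apply: ler_pM => //; clear -T_gt0 x_ge0 x_lt1 lam_gt0 sol m0 h1; lra.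
  have [s0|s0] := leP s 0; first by rewrite cy.2// mulr0.
  have [st|st] := leP t s; first by rewrite cs.2 ?mul0r// subr_le0.
  rewrite y0E; last by clear -T_gt0 x_ge0 x_lt1 lam_gt0 sol s0 st tT; apply/andP; split; lra.
  apply: mulr_ge0; last by apply/ltW/pos; clear -T_gt0 x_ge0 x_lt1 lam_gt0 sol s0 st tt; apply/andP; split; lra.
  apply: survival_ge0 => [|r' /andP[h1 h2]]; first by clear -T_gt0 x_ge0 x_lt1 lam_gt0 sol st s0 tT; apply/andP; split; lra.
  by apply/ltW/pos; clear -T_gt0 x_ge0 x_lt1 lam_gt0 sol h1 h2 s0 st tt; apply/andP; split; lra.
apply: continuousB; last exact: cst_continuous.
by apply: continuousM => //; apply: yc; rewrite t10.
Qed.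

(** The infimum of the nonpositive points is positive by [solution_near0], and [y] is positive there
    by [solution_step], hence also on a neighbourhood, which contradicts the infimum. *)
Lemma solution_gt0 t : 0 < t < T -> 0 < y t.
Proof.
move=> /andP[t0 tT]; rewrite ltNge; apply/negP => yt.
have [r /andP[r0 rT] pos] := solution_near0; have [yc _ _] := sol.
pose S := [set s : R | 0 < s < T /\ y s <= 0].
have lbS : lbound S r.
  move=> s [/andP[s0 sT] ys]; rewrite leNgt; apply/negP => sr.
  by have := pos s; rewrite s0 sr => /(_ isT); rewrite ltNge ys.
have hS : has_inf S by split; [exists t; split => //; rewrite t0|exists r].
have t1r : r <= inf S by apply: lb_le_inf => //; case: hS.
have t1t : inf S <= t by apply: ge_inf; [exists r|split => //; rewrite t0].
have t1T : 0 < inf S < T by apply/andP; split; lra.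
have y1 : 0 < y (inf S).
  apply: solution_step => // s /andP[s0 s1]; rewrite ltNge; apply/negP => ys.
  have : inf S <= s by apply: ge_inf; [exists r|split => //; rewrite s0; lra].
  by rewrite leNgt s1.
have : \forall s \near inf S, 0 < y s by exact: (cvgr_gt _ (yc _ t1T) _ y1).
move=> /nbhs_ballP[e /= e0 be].
have [s [/andP[s0 sT] ys] se] := inf_adherent e0 hS.
have s1 : inf S <= s by apply: ge_inf; [exists r|split => //; rewrite s0].
have := be s; rewrite /ball/= distrC ger0_norm ?subr_ge0// ltrBlDl => /(_ se).
by rewrite ltNge ys.
Qed.

Lemma y0_ge0 s : 0 <= y0 s.
Proof.
by rewrite patchE mem_setE in_itv/=; case: ifP => // sT; exact/ltW/solution_gt0.
Qed.

Lemma prim_homo (f : R -> R) s t : L1 f -> (forall s, 0 <= f s) -> s <= t -> prim f s <= prim f t.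
Proof.
move=> fi f0 st; rewrite /prim [leLHS]Rintegral_mkcond [leRHS]Rintegral_mkcond.
apply: le_Rintegral => //; try by apply: L1_restrict => //; exact: L1_integrableS.
move=> u _; rewrite !patchE !mem_setE !in_itv/=; case: ifP => [/andP[u0 us]|_].
  by rewrite u0 (lt_le_trans us).
by case: ifP.
Qed.

Lemma survival_nonneg t : 0 < t < T -> 0 <= survival t.
Proof.
move=> /andP[t0 tT]; apply: survival_ge0; first by rewrite t0.
by move=> s /andP[s0 st]; apply/ltW/solution_gt0; rewrite s0 (le_lt_trans st).
Qed.

Lemma prim_solution_le t : 0 < t < T -> lam * F t <= 1.
Proof. by move=> tT; have := survival_nonneg tT; rewrite survivalE// subr_ge0. Qed.

Lemma survival_le1 t : 0 < t < T -> survival t <= 1.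
Proof.
move=> tT; rewrite survivalE// gerBl mulr_ge0//; first exact: ltW.
rewrite (@prim_y0 R T); last by case/andP: tT => _ /ltW.
by apply: Rintegral_ge0 => s _; exact: y0_ge0.
Qed.

Lemma survival_homo s t : 0 < s -> s <= t -> t < T -> survival t <= survival s.
Proof.
move=> s0 st tT; have sT := le_lt_trans st tT; have t0 := lt_le_trans s0 st.
rewrite !survivalE ?s0 ?t0// lerB// ler_pM2l//.
rewrite (@prim_y0 R T y s (ltW sT)) (@prim_y0 R T y t (ltW tT)).
exact: prim_homo (causal_y0 sol).1 y0_ge0 st.
Qed.

Lemma survival_continuous t : 0 < t < T -> {for t, continuous survival}.
Proof.
move=> tT; have /andP[t0 t1] := tT.
have : {for t, continuous (fun t => 1 - lam * F t)}.
  apply: continuousB; first exact: cst_continuous.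
  by apply: continuousM; [exact: cst_continuous|exact: prim_solution_continuous].
rewrite /prop_for /continuous_at -survivalE//; apply: cvg_trans; apply: near_eq_cvg; near=> s.
rewrite survivalE//; apply/andP; split; near: s; [exact: lt_nbhsr|exact: lt_nbhsl].
Unshelve. all: by end_near.
Qed.

(** In [emb_survival_conv] the left side at [t] is at most t^x F(t) <= t^x / lam, while on the right
    the integral of the decreasing [survival] is at least [t] times its last value. *)
Lemma survival_upper t : 0 < t < T -> survival t <= (g * lam)^-1 * t `^ (x - 1).
Proof.
move=> tT; have g0 : 0 < g := g_gt0 x_ge0 x_lt1; have l0 := lam_gt0.
have cx := @cX R T x x_ge0; have cy := causal_y0 sol; have cs := causal_survival.
have co := causal_pw0 T; have xx := x_ge0.
rewrite -subr_ge0.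
apply: (@ae_ge0_continuous R 0 T (fun t => (g * lam)^-1 * t `^ (x - 1) - survival t)) => //; last first.
  apply: continuousB; last exact: survival_continuous.
  apply: continuousM; first exact: cst_continuous.
  by apply: continuous_powR_pos; case/andP: tT.
have := emb_survival_conv; rewrite [X * _]embM// [oo T * _]embM// [c_ g * _]embZ; last exact: causal_conv.
move=> /embP; move=> /(_ (causal_conv cx cy) (causalZ _ (causal_conv co cs))) h.
apply: ae_imp2 h (conv_ae_integrable cx.1 cy.1) => {tT}t e it /andP[t0 tT].
have {}e := e tT; rewrite prim_conv ?(ltW tT)// in e.
have bnd s : 0 < s < t -> `|pw T x s| <= t `^ x.
  move=> /andP[s0 st]; rewrite pw_in ?s0 ?(lt_trans st)// ger0_norm ?powR_ge0//.
  by apply: ge0_ler_powR; rewrite ?nnegrE; lra.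
have := convol_bound cx cy it bnd.
have -> : prim (fun s => `|y0 s|) t = F t.
  rewrite (@prim_y0 R T y t (ltW tT)); apply: eq_Rintegral => s _.
  by rewrite ger0_norm// y0_ge0.
rewrite e => /(le_trans (ler_norm _)) h1.
have h2 : t * survival t <= prim survival t.
  have -> : t * survival t = \int[mu]_(s in `]0, t[) survival t.
    rewrite Rintegral_cst//; change (t * survival t = survival t * fine (mu `]0%R, t[)).
    by rewrite lebesgue_measure_itv/= lte_fin t0 -EFinB subr0 mulrC.
  apply: le_Rintegral.
  - exact: measurable_itv.
  - by apply: integrable_cst_itv; [exact: measurable_itv|exact: mu_itv_oo_fin].
  - exact: L1_integrableS cs.1.
  move=> s; rewrite /= in_itv/= => /andP[s0 st].
  by apply: survival_homo => //; exact: ltW.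
have h3 : lam * F t <= 1 by apply: prim_solution_le; rewrite t0.
have tx : t `^ x = t * t `^ (x - 1).
  by rewrite -{2}[t]powRr1 ?ltW// -powRD ?(gt_eqF t0) ?implybT//; congr (_ `^ _); ring.
have p0 : 0 <= t `^ x by exact: powR_ge0.
rewrite subr_ge0 mulrC ler_pdivlMr ?mulr_gt0// -(ler_pM2l t0) -tx.
apply: (@le_trans _ _ (lam * (g * prim survival t))).
  have -> : t * (survival t * (g * lam)) = lam * (g * (t * survival t)) by ring.
  by rewrite !ler_pM2l.
apply: (@le_trans _ _ (t `^ x * (lam * F t))).
  by rewrite [leRHS]mulrCA ler_pM2l.
by rewrite ler_piMr.
Qed.

(** By [ae_solution], with [survival] between 0 and 1, t y(t) is at most rho F(t) <= rho / lam. *)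
Lemma solution_upper t : 0 < t < T -> t * (lam * y t) <= 1.
Proof.
move=> tT; have l0 := lam_gt0; have [yc _ _] := sol.
have cy := causal_y0 sol; have cs := causal_survival.
have x0 := x_ge0; have x1 := x_lt1.
rewrite -subr_ge0.
apply: (@ae_ge0_continuous R 0 T (fun t => 1 - t * (lam * y t))) => //; last first.
  apply: continuousB; first exact: cst_continuous.
  apply: continuousM => //; apply: continuousM; [exact: cst_continuous|exact: yc].
apply: ae_imp2 ae_solution (conv_ae_integrable cs.1 cy.1) => {tT}t e it /andP[t0 tT].
have bnd s : 0 < s < t -> `|survival s| <= 1.
  move=> /andP[s0 st]; have sT : 0 < s < T by rewrite s0 (lt_trans st).
  by rewrite ger0_norm ?survival_nonneg// survival_le1.
have := convol_bound cs cy it bnd.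
have -> : prim (fun s => `|y0 s|) t = F t.
  rewrite (@prim_y0 R T y t (ltW tT)); apply: eq_Rintegral => s _.
  by rewrite ger0_norm// y0_ge0.
rewrite mul1r => /(le_trans (ler_norm _)) h1.
have h3 : lam * F t <= 1 by apply: prim_solution_le; rewrite t0.
rewrite mulrCA e ?t0// subr_ge0 mulrCA.
have h4 := ler_wpM2l (ltW l0) h1.
apply: (@le_trans _ _ ((1 - x) * 1)); last by lra.
by rewrite ler_pM2l; lra.
Qed.

Lemma relaxation_eq : X * emb T (fun s => lam * y0 s) + c_ (g * lam) * (O * O) * emb T (fun s => lam * y0 s) =
  c_ (g * lam) * (O * O).
Proof.
have cy := causal_y0 sol; have e := volterra_eq1; rewrite -(embZ T lam cy) acstM.
transitivity (c_ lam * (X * Y + c_ g * c_ lam * (O * O) * Y)); first by ring.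
rewrite e; ring.
Qed.

Lemma aD_relaxation : aD (emb T (fun s => lam * y0 s)) =
  c_ (1 - x) * ((O - O * emb T (fun s => lam * y0 s)) * emb T (fun s => lam * y0 s)).
Proof.
have cy := causal_y0 sol; have e := aD_solution; rewrite -(embZ T lam cy) aDM aDcst e emb_survival.
ring.
Qed.

(** The constant decreases in [lam], so its value at the first eigenvalue serves all of them. The 1
    covers [solution_upper] and the trivial tail bound for [t <= 1]; the term 2 e / lam comes from
    [survival_upper] and [Gamma_lower] for [t > 1]. *)
Lemma relaxation_tame (a : R) : 0 < a -> a <= 1 - x ->
  tame T a (1 + 2 * expR 1 / lam) (fun s => lam * y0 s).
Proof.
move=> a0 ax; have l0 := lam_gt0; have cy := causal_y0 sol.
have primA t : prim (fun s => lam * y0 s) t = lam * prim y0 t.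
  by rewrite /prim RintegralZl//; exact: L1_integrableS cy.1.
have K0 : 0 < 2 * expR 1 / lam by rewrite divr_gt0// mulr_gt0// expR_gt0.
have h1 t : 0 < t < T -> lam * prim y0 t <= 1.
  move=> /andP[t0 tT]; rewrite -(@prim_y0 R T y t (ltW tT)).
  by apply: prim_solution_le; rewrite t0.
split.
- exact: causalZ.
- by move=> s; rewrite mulr_ge0 ?y0_ge0// ltW.
- move=> s; have [s0|s0] := leP s 0; first by rewrite cy.2// !mulr0; lra.
  have [sT|sT] := ltP s T; last first.
    by rewrite patchE mem_setE in_itv/= [s < T]ltNge sT andbF !mulr0; lra.
  rewrite y0E ?s0//; have := @solution_upper s; rewrite s0 sT => /(_ isT); lra.
- rewrite RintegralZl//; last exact: cy.1.
  have -> : \int[mu]_s y0 s = prim y0 T.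
    rewrite /prim [RHS]Rintegral_mkcond; apply: eq_Rintegral => s _.
    by rewrite !patchE; case: ifP.
  rewrite -subr_ge0; apply: (@ae_ge0_left R 0 T (fun t => 1 - lam * prim y0 t)) => //.
    by apply: aeW => t tT; rewrite subr_ge0 h1.
  apply: continuousB; first exact: cst_continuous.
  apply: continuousM; first exact: cst_continuous.
  by apply: prim_continuous => //; exact: cy.1.
move=> t tT; rewrite primA; have /andP[t0 t1] := tT.
have p0 : 0 < t `^ (- a) by exact: powR_gt0.
have [tl|tl] := leP t 1.
  have h : 1 <= t `^ (- a).
    by rewrite -(powRr0 t); apply: ger_powR; rewrite ?t0//; lra.
  have h2 : 0 <= lam * prim y0 t.
    by rewrite mulr_ge0 ?(ltW l0)//; apply: Rintegral_ge0 => s _; exact: y0_ge0.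
  apply: (@le_trans _ _ (1 * 1)); first by lra.
  by apply: ler_pM => //; lra.
have := survival_upper tT; rewrite survivalE// (@prim_y0 R T y t (ltW t1)) => /le_trans; apply.
apply: ler_pM; rewrite ?powR_ge0//.
- by rewrite invr_ge0 mulr_ge0// ltW//; exact: g_gt0 x_ge0 x_lt1.
- have g0 : expR (- 1) / 2 <= g.
    by apply: Gamma_lower; have := x_lt1; have := x_ge0; move=> ? ?; apply/andP; split; lra.
  apply: (@le_trans _ _ (2 * expR 1 / lam)); last by lra.
  rewrite invfM ler_pM2r ?invr_gt0//.
  rewrite invf_ple ?posrE; last by rewrite mulr_gt0// expR_gt0.
    by apply: le_trans g0; rewrite invfM -expRN mulrC.
  exact: g_gt0 x_ge0 x_lt1.
by apply: ler_powR; [exact: ltW|lra].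
Qed.

End positivity.

(** * Comparison of two orders *)

Section kernels.
Context {R : realType}.
Local Notation mu := (@lebesgue_measure R).

Lemma L1_reflect (f : R -> R) t : L1 f -> L1 (fun s => f (t - s)).
Proof.
move=> fi; have := @integrable_affine R (-1) t f; rewrite oppr_eq0 oner_eq0 => /(_ isT fi).
by apply: eq_integrable => // s _ /=; rewrite mulN1r addrC.
Qed.

Lemma Rintegral_reflect (f : R -> R) t : L1 f -> \int[mu]_s f (t - s) = \int[mu]_s f s.
Proof.
move=> fi; rewrite [RHS](@Rintegral_affine R (-1) t)// ?oppr_eq0 ?oner_eq0//.
by rewrite normrN1 mul1r; apply: eq_Rintegral => s _; rewrite mulN1r addrC.
Qed.

Lemma prim_le_total (f : R -> R) t : L1 f -> (forall s, 0 <= f s) -> prim f t <= \int[mu]_s f s.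
Proof. by move=> fi f0; apply: Rintegral_subset_le. Qed.

Lemma prim_ge0 (f : R -> R) t : (forall s, 0 <= f s) -> 0 <= prim f t.
Proof. by move=> f0; apply: Rintegral_ge0. Qed.

(** Pointwise: write t = (t - s) + s and give each summand to the function with that argument. Tail:
    two delays below [t / 2] add up to less than [t], so the mass before [t] is at least the product
    of the masses before [t / 2]; returning from [t / 2] to [t] costs a factor 2 since [a <= 1]. *)
Lemma tame_conv (T a K K' : R) (u v : R -> R) : 0 <= a <= 1 -> 0 <= K -> 0 <= K' ->
  tame T a K u -> tame T a K' v -> tame T a (2 * (K + K')) (convol u v).
Proof.
move=> /andP[a0 a1] K0 K'0 [cu u0 uK ui ut] [cv v0 vK vi vt].
have cuv := causal_conv cu cv.
have mfu := L1_meas cu.1; have mfv := L1_meas cv.1.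
have iu0 : 0 <= \int[mu]_s u s by apply: Rintegral_ge0.
have iv0 : 0 <= \int[mu]_s v s by apply: Rintegral_ge0.
have uv0 t : 0 <= convol u v t by apply: Rintegral_ge0 => s _; rewrite mulr_ge0.
split => //.
- move=> t; have [it|nit] := pselect (L1 (fun s => u (t - s) * v s)); last first.
    rewrite /convol Rintegral_not_integrable ?mulr0//; last exact: measurable_conv_arg.
    by rewrite mulr_ge0// addr_ge0.
  apply: (@le_trans _ _ (K + K')); last by rewrite ler_peMl ?addr_ge0// ler1n.
  rewrite /convol -RintegralZl//.
  apply: (@le_trans _ _ (\int[mu]_s (K * v s + K' * u (t - s)))).
    apply: le_Rintegral => //; first exact: L1Z.
      by apply: L1D; apply: L1Z; [exact: cv.1|exact: L1_reflect cu.1].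
    move=> s _; have -> : t * (u (t - s) * v s) = (t - s) * u (t - s) * v s + u (t - s) * (s * v s) by ring.
    apply: lerD; first exact: ler_wpM2r.
    by rewrite [leRHS]mulrC; exact: ler_wpM2l.
  rewrite RintegralD//; [|exact: L1Z cv.1|exact: L1Z (L1_reflect _ cu.1)].
  rewrite !RintegralZl//; [|exact: L1_reflect cu.1|exact: cv.1].
  rewrite Rintegral_reflect; last exact: cu.1.
  by apply: lerD; rewrite ler_piMr.
- rewrite (Rintegral_conv cu.1 cv.1); exact: mulr_ile1.
move=> t tT; have /andP[t0 _] := tT.
have h : 0 <= prim (convol u v) t - prim u (t / 2) * prim v (t / 2).
  apply: (@ae_ge0_continuous R 0 T (fun t => prim (convol u v) t - prim u (t / 2) * prim v (t / 2))) => //; last first.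
    have c2 : {for t, continuous (fun t : R => t / 2)} by exact: mulrr_continuous.
    apply: continuousB; first by apply: prim_continuous => //; exact: cuv.1.
    apply: continuousM; (apply: continuous_comp; first exact: c2);
      apply: prim_continuous; rewrite ?divr_gt0//; [exact: cu.1|exact: cv.1].
  have co := causal_pw0 T; have cou := causal_conv co cu.
  apply: ae_imp2 (convolA co.1 cu.1 cv.1) (conv_ae_integrable cou.1 cv.1) => {tT t0}t e it /andP[t0 tT].
  rewrite -(prim_conv cuv (ltW tT)) e subr_ge0.
  have -> : prim u (t / 2) * prim v (t / 2) = \int[mu]_s (prim u (t / 2) * (v \_ `]0, (t / 2)[) s).
    rewrite RintegralZl//; last by apply: L1_restrict => //; apply: L1_integrableS => //; exact: cv.1.
    by rewrite {2}/prim [in LHS]Rintegral_mkcond.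
  apply: le_Rintegral => //.
    by apply: L1Z; apply: L1_restrict => //; apply: L1_integrableS => //; exact: cv.1.
  move=> s _; rewrite patchE mem_setE in_itv/=; case: ifP => [/andP[s0 s2]|_].
    apply: ler_wpM2r => //; rewrite prim_conv//; last lra.
    by apply: prim_homo; [exact: cu.1|by []|lra].
  rewrite mulr0 mulr_ge0//.
  have [ts|ts] := leP (t - s) T; first by rewrite prim_conv// prim_ge0.
  by apply: Rintegral_ge0 => r _; rewrite mulr_ge0 ?pw_ge0.
have t2 : 0 < t / 2 < T by apply/andP; split; lra.
have := ut _ t2; have := vt _ t2.
have := le_trans (prim_le_total (t / 2) cu.1 u0) ui; have := le_trans (prim_le_total (t / 2) cv.1 v0) vi.
have := prim_ge0 (t / 2) u0; have := prim_ge0 (t / 2) v0.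
have e : (t / 2) `^ (- a) <= 2 * t `^ (- a).
  rewrite powRM ?invr_ge0 ?(ltW t0)// mulrC ler_wpM2r ?powR_ge0//.
  rewrite -[2^-1]powR_inv1// -powRrM mulN1r opprK.
  by rewrite -[leRHS]powRr1// ler_powR// ler1n.
have := ler_wpM2l K0 e; have := ler_wpM2l K'0 e.
set U := prim u _ in h *; set V := prim v _ in h *; set W := prim _ t in h *.
move=> ? ? ? ? ? ? ? ?; nra.
Qed.

Lemma integral_inv_sqrt : L1 (pw 1 (- 2^-1) : R -> R) /\ \int[mu]_s pw 1 (- 2^-1) s = 2 :> R.
Proof.
have c : causal (pw 1 (- 2^-1) : R -> R) by apply: causal_pw; lra.
split; first exact: c.1.
have <- : prim (pw 1 (- 2^-1)) 1 = \int[mu]_s pw 1 (- 2^-1) s :> R.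
  rewrite /prim Rintegral_mkcond; apply: eq_Rintegral => s _.
  by rewrite patchE mem_setE in_itv /pw; case: ifP => // ->.
have e := @Rintegral_powR R (- 2^-1) 1 _ ler01.
transitivity (\int[mu]_(s in `]0, 1]) (s `^ (- 2^-1)) : R); last by rewrite e ?powR1; [field|lra].
have i1 := @integrable_powR R (- 2^-1) 1 _.
rewrite -Rintegral_itv_bndo_bndc; last first.
  have h : mu.-integrable `]0, 1] (EFin \o (fun s : R => s `^ (- 2^-1))) by apply: i1; lra.
  by apply: integrableS h => // s; rewrite /= !in_itv/= => /andP[-> /ltW].
by apply: eq_Rintegral => s; rewrite inE/= in_itv/= => s01; rewrite pw_in.
Qed.

(** Split at r, the root of t. For [s < r] the kernel has hardly moved; for [s >= r] little mass of
    [w] is left, and the inverse square root singularity of the kernel near [s = t] meets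
    [w s <= K' / r]. The 13 is 4 + 2 + 6 from these three pieces, plus 1 for the mass that [w] lacks
    on []0, t[]. *)
Lemma kernel_word (T a K' Z t r : R) (Q w : R -> R) :
  0 <= a <= 1 -> 1 <= K' -> 0 <= Z -> tame T a K' w -> causal Q ->
  L1 (fun s => Q (t - s) * w s) -> 1 <= r -> r * r = t -> r < t -> t < T ->
  (forall s, 0 < s < t -> `|Q s| <= Z * (1 + 3 * pw 1 (- 2^-1) s)) -> `|Q t| <= Z ->
  (forall s, 0 < s < r -> `|Q (t - s) - Q t| <= 4 * Z / r) ->
  `|convol Q w t - Q t| <= 13 * K' * Z * r `^ (- a).
Proof.
move=> /andP[a0 a1] K1 Z0 [cw w0 wK wi wt] cQ it r1 rt r_t tT H1 H2 H3.
have r0 : 0 < r by lra.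
have t0 : 0 < t by lra.
have [pi pI] := integral_inv_sqrt.
have wr := wt r; have {}wr : 1 - prim w r <= K' * r `^ (- a) by apply: wr; rewrite r0 (lt_trans r_t).
have wt' : 1 - prim w t <= K' * t `^ (- a) by apply: wt; rewrite t0.
have ir (s : R) : L1 (w \_ `]0, s[) by apply: L1_restrict => //; apply: L1_integrableS => //; exact: cw.1.
have pE (s : R) : prim w s = \int[mu]_u (w \_ `]0, s[) u by rewrite /prim Rintegral_mkcond.
have ra0 : 0 < r `^ (- a) by exact: powR_gt0.
have rinv : r^-1 <= r `^ (- a).
  by rewrite -powR_inv1 ?(ltW r0)//; apply: ler_powR => //; lra.
have ta : t `^ (- a) <= r `^ (- a).
  rewrite !powRN lef_pV2 ?posrE ?powR_gt0//.
  by apply: ge0_ler_powR; rewrite ?nnegrE ?(ltW r0) ?(ltW t0) ?(ltW r_t).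
have p0 := pw_ge0 1 (- 2^-1 : R).
have main : `|convol Q w t - Q t * prim w t| <=
    4 * Z / r * \int[mu]_s w s + 2 * Z * (\int[mu]_s w s - prim w r) + 3 * Z * K' / r * 2.
  have e1 : convol Q w t - Q t * prim w t = \int[mu]_s (Q (t - s) * w s - Q t * (w \_ `]0, t[) s).
    have z : \int[mu]_s (Q t * (w \_ `]0, t[) s) = Q t * prim w t.
      by rewrite pE; apply: RintegralZl; [exact: measurableT|exact: ir].
    by rewrite -z [RHS]RintegralB//; exact: L1Z.
  have i1 : L1 (fun s => Q (t - s) * w s - Q t * (w \_ `]0, t[) s).
    by apply: L1D => //; apply: L1N; exact: L1Z.
  rewrite e1; apply: (le_trans (le_normr_Rintegral _ i1)) => //.
  have j1 := L1Z (4 * Z / r) cw.1.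
  have j2 : L1 (fun s => 2 * Z * (w s - (w \_ `]0, r[) s)).
    by apply: L1Z; apply: L1D; [exact: cw.1|exact: L1N].
  have j3 := L1Z (3 * Z * K' / r) (L1_reflect t pi).
  have -> : 4 * Z / r * \int[mu]_s w s + 2 * Z * (\int[mu]_s w s - prim w r) + 3 * Z * K' / r * 2 =
      \int[mu]_s (4 * Z / r * w s + 2 * Z * (w s - (w \_ `]0, r[) s) + 3 * Z * K' / r * pw 1 (- 2^-1) (t - s)).
    have k1 : \int[mu]_s (4 * Z / r * w s) = 4 * Z / r * \int[mu]_s w s.
      by apply: RintegralZl; [exact: measurableT|exact: cw.1].
    have j2' : L1 (fun s => w s - (w \_ `]0, r[) s) by apply: L1D; [exact: cw.1|exact: L1N].
    have k2 : \int[mu]_s (2 * Z * (w s - (w \_ `]0, r[) s)) = 2 * Z * (\int[mu]_s w s - prim w r).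
      rewrite (pE r) -RintegralB; [|exact: measurableT|exact: cw.1|exact: ir].
      by apply: RintegralZl; [exact: measurableT|exact: j2'].
    have k3 : \int[mu]_s (3 * Z * K' / r * pw 1 (- 2^-1) (t - s)) = 3 * Z * K' / r * 2.
      transitivity (3 * Z * K' / r * \int[mu]_s pw 1 (- 2^-1) (t - s)); last first.
        by rewrite (Rintegral_reflect t pi) pI.
      by apply: RintegralZl; [exact: measurableT|exact: L1_reflect].
    rewrite -k1 -k2 -k3 -RintegralD; [|exact: measurableT|exact: j1|exact: j2].
    by rewrite -RintegralD; [|exact: measurableT|exact: L1D|exact: j3].
  apply: le_Rintegral => //.
  - exact: L1_abs.
  - by apply: L1D j3; exact: L1D.
  move=> s _; rewrite !patchE !mem_setE !in_itv/=.
  have z1 : 0 <= 4 * Z / r by rewrite divr_ge0 ?mulr_ge0// ltW.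
  have z2 : 0 <= 3 * Z * K' / r by rewrite divr_ge0 ?mulr_ge0 ?(le_trans ler01 K1) ?(ltW r0).
  have q1 := mulr_ge0 z1 (w0 s); have q2 := mulr_ge0 z2 (p0 (t - s)).
  have [s0|s0] := leP s 0; first by rewrite cw.2// !mulr0 !subrr normr0; clear -q1 q2; lra.
  have [sr|sr] := ltP s r.
    rewrite (lt_trans sr)// subrr mulr0 -mulrBl normrM (ger0_norm (w0 s)).
    have := H3 s; rewrite s0 sr => /(_ isT) h3.
    have h4 := ler_wpM2r (w0 s) h3; clear -q2 h4; lra.
  have [st|st] := ltP s t; last first.
    rewrite cQ.2 ?subr_le0// mul0r mulr0 !subr0 normr0.
    have h4 := mulr_ge0 Z0 (w0 s); clear -q1 q2 h4; lra.
  rewrite subr0 -mulrBl normrM (ger0_norm (w0 s)).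
  have h1 : `|Q (t - s)| <= Z * (1 + 3 * pw 1 (- 2^-1) (t - s)) by apply: H1; clear -sr st r0; apply/andP; split; lra.
  have h2 := ler_normB (Q (t - s)) (Q t).
  have h3 : `|Q (t - s) - Q t| <= 2 * Z + 3 * Z * pw 1 (- 2^-1) (t - s) by clear -h1 h2 H2; lra.
  have h4 := ler_wpM2r (w0 s) h3.
  have h5 : w s <= K' / r.
    rewrite ler_pdivlMr//; apply: le_trans (wK s); rewrite mulrC ler_wpM2r// ltW.
  have h6 : 0 <= 3 * Z * pw 1 (- 2^-1) (t - s) by rewrite !mulr_ge0.
  have h7 := ler_wpM2l h6 h5.
  have -> : 3 * Z * K' / r * pw 1 (- 2^-1) (t - s) = 3 * Z * pw 1 (- 2^-1) (t - s) * (K' / r) by ring.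
  clear -q1 h4 h7; lra.
have iw0 : 0 <= \int[mu]_s w s by apply: Rintegral_ge0.
have pt1 : prim w t <= 1 by exact: le_trans (prim_le_total t cw.1 w0) wi.
move: main iw0 wi; move: (\int[mu]_s w s) => I main iw0 wi.
have b1 : `|Q t * prim w t - Q t| <= Z * (K' * r `^ (- a)).
  have -> : Q t * prim w t - Q t = - (Q t * (1 - prim w t)) by ring.
  rewrite normrN normrM [`|1 - _|]ger0_norm ?subr_ge0//.
  have K0 : 0 <= K' by exact: le_trans K1.
  have h : 1 - prim w t <= K' * r `^ (- a) by apply: (le_trans wt'); exact: ler_wpM2l.
  by apply: ler_pM => //; rewrite subr_ge0.
have b2 : 4 * Z / r * I <= 4 * Z * (K' * r `^ (- a)).
  have z : 0 <= 4 * Z by rewrite mulr_ge0.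
  rewrite -mulrA; apply: ler_wpM2l => //.
  have ri0 : 0 <= r^-1 by rewrite invr_ge0 ltW.
  have h1 : r^-1 * I <= r^-1 by rewrite ler_piMr.
  have h2 : r `^ (- a) <= K' * r `^ (- a) by rewrite ler_peMl// ltW.
  clear -h1 h2 rinv; lra.
have b3 : 2 * Z * (I - prim w r) <= 2 * Z * (K' * r `^ (- a)).
  by apply: ler_wpM2l; [rewrite mulr_ge0|clear -wr iw0 wi; lra].
have b4 : 3 * Z * K' / r * 2 <= 6 * Z * (K' * r `^ (- a)).
  have z : 0 <= 6 * Z * K' by rewrite !mulr_ge0//; clear -K1; lra.
  have h := ler_wpM2l z rinv; clear -h; lra.
have -> : convol Q w t - Q t = (convol Q w t - Q t * prim w t) + (Q t * prim w t - Q t) by ring.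
apply: (le_trans (ler_normD _ _)).
clear -main b1 b2 b3 b4; lra.
Qed.

(** The kernels P, N and M of the overview have this form, with coefficients f(x) / Gamma(x + 1). *)
Definition powdiff (T r1 x1 r2 x2 : R) : R -> R := fun s => r2 * pw T x2 s - r1 * pw T x1 s.

(** From ln z <= z - 1 at z = 1 / q, where 1 / q <= 2. *)
Lemma ln_inv_le (q : R) : 2^-1 <= q <= 1 -> - ln q <= 2 * (1 - q).
Proof.
move=> /andP[q1 q2]; have q0 : 0 < q by lra.
rewrite -lnV ?posrE//.
have h : ln q^-1 <= q^-1 - 1.
  have := @le_ln1Dx R (q^-1 - 1); rewrite (addrC 1) subrK; apply.
  have : 0 < q^-1 by rewrite invr_gt0.
  lra.
apply: (le_trans h).
have : q * q^-1 = 1 by rewrite mulfV// gt_eqF.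
have : 0 < q^-1 by rewrite invr_gt0.
move: (q^-1) => z z0 e; nra.
Qed.

(** In (r2 - r1) s^x2 + r1 (s^x2 - s^x1) both terms carry the factor [x1 - x2]. Below [s = 1] the
    logarithm is unbounded and is absorbed by s^(-1/2); from [s = 1] on it is at most [ln t]. *)
Lemma kernel_size (T K r1 x1 r2 x2 s t : R) : 0 <= x2 -> x2 <= x1 -> x1 <= 1 ->
  `|r1| <= K -> `|r2 - r1| <= K * (x1 - x2) -> 1 <= t -> 0 < s -> s <= t -> s < T ->
  `|powdiff T r1 x1 r2 x2 s| <= K * (x1 - x2) * t `^ x1 * (1 + ln t) * (1 + 3 * pw 1 (- 2^-1) s)
  /\ (1 <= s -> `|powdiff T r1 x1 r2 x2 s| <= K * (x1 - x2) * t `^ x1 * (1 + ln t)).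
Proof.
move=> x20 x21 x11 r1K rK t1 s0 st sT; rewrite /powdiff (@pw_in _ T x2) ?s0// (@pw_in _ T x1) ?s0//.
have K0 : 0 <= K by exact: le_trans r1K.
have d0 : 0 <= x1 - x2 by clear -x21; lra.
have e : r2 * s `^ x2 - r1 * s `^ x1 = (r2 - r1) * s `^ x2 + r1 * (s `^ x2 - s `^ x1) by ring.
have l0 : 0 <= ln t by exact: ln_ge0.
have tx : 1 <= t `^ x1 by rewrite -(powRr0 t); apply: ler_powR => //; clear -x20 x21; lra.
have p2 : 0 <= s `^ x2 by exact: powR_ge0.
have n1 : `|r2 * s `^ x2 - r1 * s `^ x1| <= K * (x1 - x2) * s `^ x2 + K * `|s `^ x2 - s `^ x1|.
  rewrite e; apply: (le_trans (ler_normD _ _)); apply: lerD.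
    by rewrite normrM (ger0_norm p2); exact: ler_wpM2r.
  by rewrite normrM; exact: ler_wpM2r.
have big : 1 <= s -> `|r2 * s `^ x2 - r1 * s `^ x1| <= K * (x1 - x2) * t `^ x1 * (1 + ln t).
  move=> s1; apply: (le_trans n1).
  have /andP[h1 h2] := powR_sub_ge1 s1 x21.
  have h3 : s `^ x1 <= t `^ x1 by apply: ge0_ler_powR; rewrite ?nnegrE ?(ltW s0) ?(le_trans x20 x21) ?(le_trans ler01 t1).
  have h4 : s `^ x2 <= s `^ x1 by apply: ler_powR.
  have h5 : ln s <= ln t by rewrite ler_ln ?posrE// (lt_le_trans s0).
  have h6 : 0 <= ln s by exact: ln_ge0.
  rewrite distrC (ger0_norm h1).
  have h7 : s `^ x1 - s `^ x2 <= (x1 - x2) * (ln t * t `^ x1).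
    apply: (le_trans h2); rewrite -mulrA; apply: ler_wpM2l => //.
    by apply: ler_pM => //; exact: powR_ge0.
  have h8 := ler_wpM2l K0 h7.
  have h9 : K * (x1 - x2) * s `^ x2 <= K * (x1 - x2) * t `^ x1.
    by apply: ler_wpM2l; [exact: mulr_ge0|exact: le_trans h3].
  clear -h7 h8 h9; lra.
split => //.
have Z0 : 0 <= K * (x1 - x2) * t `^ x1 * (1 + ln t).
  by apply: mulr_ge0; [rewrite mulr_ge0 ?powR_ge0// mulr_ge0|exact: addr_ge0].
have [s1|s1] := leP 1 s.
  apply: (le_trans (big s1)); rewrite ler_peMr//.
  by rewrite lerDl mulr_ge0// pw_ge0.
have s01 : 0 < s <= 1 by rewrite s0 ltW.
have /andP[h1 h2] := powR_sub_le1 s01 x21.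
have h3 := opp_ln_le s0.
have h4 : s `^ x2 <= 1 by rewrite -(powRr0 s); apply: ger_powR.
rewrite pw_in ?s0//.
have h5 : 1 <= s `^ (- 2^-1).
  by rewrite -[leLHS](powRr0 s); apply: ger_powR => //; lra.
have h6 : 0 <= - ln s by rewrite oppr_ge0 ln_le0// ltW.
apply: (le_trans n1); rewrite (ger0_norm h1).
have h7 : s `^ x2 - s `^ x1 <= (x1 - x2) * (2 * s `^ (- 2^-1)).
  apply: (le_trans h2); rewrite -mulrA; apply: ler_wpM2l => //.
  by apply: (le_trans _ h3); rewrite ler_piMr.
have h8 := ler_wpM2l K0 h7.
have kd : 0 <= K * (x1 - x2) by exact: mulr_ge0.
have h9 : K * (x1 - x2) * s `^ x2 <= K * (x1 - x2) by rewrite ler_piMr.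
have h10 : K * (x1 - x2) <= K * (x1 - x2) * t `^ x1 * (1 + ln t).
  by rewrite -mulrA ler_peMr//; apply: mulr_ege1 => //; rewrite lerDl.
have p0 : 0 <= s `^ (- 2^-1) by exact: powR_ge0.
have h11 : K * (x1 - x2) * (1 + 3 * s `^ (- 2^-1)) <= K * (x1 - x2) * t `^ x1 * (1 + ln t) * (1 + 3 * s `^ (- 2^-1)).
  by apply: ler_wpM2r => //; rewrite addr_ge0// mulr_ge0.
have h12 := ler_wpM2l kd p0; rewrite mulr0 in h12.
clear -h8 h9 h11 h12; lra.
Qed.

(** Write t - s = t q; since [s / t <= r^-1], q differs from 1 by at most 1 / r. With Q the power
    difference, the variation is - Q(t) (1 - q^x2) + r1 t^x1 (q^x2 - q^x1), and each term is at most
    2 / r times the bound of [kernel_size]. *)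
Lemma kernel_variation (T K r1 x1 r2 x2 s t r : R) : 0 <= x2 -> x2 <= x1 -> x1 <= 1 ->
  `|r1| <= K -> `|r2 - r1| <= K * (x1 - x2) -> 2 <= r -> r * r = t -> 0 < s -> s < r -> t < T ->
  `|powdiff T r1 x1 r2 x2 (t - s) - powdiff T r1 x1 r2 x2 t| <= 4 * (K * (x1 - x2) * t `^ x1 * (1 + ln t)) / r.
Proof.
move=> x20 x21 x11 r1K rK r2' rt s0 sr tT.
have r0 : 0 < r by lra.
have t1 : 1 <= t by nra.
have t0 : 0 < t by lra.
have rlt : r < t by nra.
have [_ Q1] := kernel_size x20 x21 x11 r1K rK t1 t0 (lexx t) tT.
have {}Q1 := Q1 t1.
move: Q1; rewrite /powdiff !pw_in; [|by clear -rlt t0 s0 sr tT; apply/andP; split; lra..] => Q1.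
pose q := 1 - s / t.
have th : s / t <= r^-1.
  rewrite ler_pdivrMr// -rt mulrA mulVf ?mul1r ?ltW//; by rewrite gt_eqF.
have ri : r^-1 <= 2^-1 by rewrite lef_pV2 ?posrE.
have st0 : 0 < s / t by rewrite divr_gt0.
have q01 : 2^-1 <= q <= 1 by rewrite /q; clear -th ri st0; apply/andP; split; lra.
have ts : t - s = t * q by rewrite /q mulrBr mulr1 mulrCA mulfV ?mulr1// gt_eqF.
have q0 : 0 < q <= 1 by apply/andP; move/andP: q01 => [? ?]; split; lra.
have qq : 0 <= q by case/andP: q0 => /ltW.
rewrite ts !powRM ?(ltW t0)//.
have -> : r2 * (t `^ x2 * q `^ x2) - r1 * (t `^ x1 * q `^ x1) - (r2 * t `^ x2 - r1 * t `^ x1) =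
  - ((r2 * t `^ x2 - r1 * t `^ x1) * (1 - q `^ x2)) + r1 * t `^ x1 * (q `^ x2 - q `^ x1) by ring.
have K0 : 0 <= K by exact: le_trans r1K.
have d0 : 0 <= x1 - x2 by lra.
have /andP[a1 a2] := powR_sub_le1 q0 x20.
have /andP[b1 b2] := powR_sub_le1 q0 x21.
have lq := ln_inv_le q01.
have lq0 : 0 <= - ln q by rewrite oppr_ge0 ln_le0//; case/andP: q0.
have qr : - ln q <= 2 / r by apply: (le_trans lq); rewrite /q; clear -th; lra.
have qx2 : q `^ x2 <= 1 by rewrite -(powRr0 q); apply: ger_powR.
rewrite powRr0 subr0 mulr1 in a1 a2.
have c1 : 1 - q `^ x2 <= 2 / r.
  apply: (le_trans a2); by apply: (le_trans _ qr); rewrite ler_piMl// (le_trans x21).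
have c2 : q `^ x2 - q `^ x1 <= (x1 - x2) * (2 / r).
  apply: (le_trans b2); rewrite -mulrA; apply: ler_wpM2l => //.
  by apply: (le_trans _ qr); rewrite ler_piMr.
set Z := K * (x1 - x2) * t `^ x1 * (1 + ln t) in Q1 *.
have l0 : 0 <= ln t by exact: ln_ge0.
have ri0 : 0 <= 2 / r by rewrite divr_ge0// ltW.
have n1 : `|(r2 * t `^ x2 - r1 * t `^ x1) * (1 - q `^ x2)| <= Z * (2 / r).
  by rewrite normrM (ger0_norm a1); apply: ler_pM.
have p0 := powR_ge0 t x1.
have n2 : `|r1 * t `^ x1 * (q `^ x2 - q `^ x1)| <= Z * (2 / r).
  rewrite normrM normrM (ger0_norm b1) (ger0_norm p0).
  apply: (@le_trans _ _ (K * t `^ x1 * ((x1 - x2) * (2 / r)))).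
    by apply: ler_pM => //; [exact: mulr_ge0|exact: ler_wpM2r].
  have -> : K * t `^ x1 * ((x1 - x2) * (2 / r)) = K * (x1 - x2) * t `^ x1 * (2 / r) by ring.
  apply: ler_wpM2r => //; rewrite /Z ler_peMr//; last by rewrite lerDl.
  by rewrite !mulr_ge0.
apply: (le_trans (ler_normD _ _)); rewrite normrN.
have -> : 4 * Z / r = Z * (2 / r) + Z * (2 / r) by field; rewrite gt_eqF.
exact: lerD.
Qed.

End kernels.

(* With [q_i a_i = l o^2 (1 - a_i)], both sides are [l o^2] times the same polynomial in [a], [b]. *)
Lemma comparison_alg (A : comNzRingType) (D : A -> A) (a b o q1 q2 l x1 x2 : A) :
  (forall p q, D (p + q) = D p + D q) ->
  (forall p q, D (p * q) = D p * q + p * D q) ->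
  D x1 = 0 -> D x2 = 0 -> D o = o * o ->
  D a = (1 - x1) * ((o - o * a) * a) -> D b = (1 - x2) * ((o - o * b) * b) ->
  q1 * a + l * (o * o) * a = l * (o * o) -> q2 * b + l * (o * o) * b = l * (o * o) ->
  let r1 := 1 - x1 in let r2 := 1 - x2 in
  let N := (2 * x2 - 1) * q2 - (2 * x1 - 1) * q1 in let M := q2 - q1 in
  l * D (D (a - b)) = - (x2 * (1 - x2) * q2 - x1 * (1 - x1) * q1) * (a * b)
   + ((r1 + r2) * (N * (a * b)) - r1 * (N * (a * a * b)) - r2 * (N * (a * b * b)))
   + ((r1 + r2) ^+ 2 * (M * (a * b)) - (3 * r1 ^+ 2 + 2 * (r1 * r2)) * (M * (a * a * b))
      - (3 * r2 ^+ 2 + 2 * (r1 * r2)) * (M * (a * b * b))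
      + 2 * r1 ^+ 2 * (M * (a * a * a * b)) + 2 * (r1 * r2) * (M * (a * a * b * b))
      + 2 * r2 ^+ 2 * (M * (a * b * b * b))).
Proof.
move=> DD DM Dx1 Dx2 Do Da Db e1 e2 r1 r2 N M.
have D0 : D 0 = 0 by apply: (addrI (D 0)); rewrite -DD !addr0.
have DN p : D (- p) = - D p by apply: (addrI (D p)); rewrite -DD !subrr.
have D1 : D 1 = 0.
  by apply: (addrI (D 1)); rewrite addr0 -[in RHS](mulr1 1) DM mulr1 mul1r.
have {}e1 : q1 * a = l * (o * o) - l * (o * o) * a by rewrite -[X in _ = X - _]e1 addrK.
have {}e2 : q2 * b = l * (o * o) - l * (o * o) * b by rewrite -[X in _ = X - _]e2 addrK.
rewrite /N /M !(DD, DN, Da, Db, DM, Do, Dx1, Dx2, D1).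
set S := (X in _ = X).
have -> : S = (q1 * a) * (b * (x1 * (1 - x1)
     - (2 * x1 - 1) * (r1 + r2 - r1 * a - r2 * b)
     - ((r1 + r2) ^+ 2 - (3 * r1 ^+ 2 + 2 * (r1 * r2)) * a - (3 * r2 ^+ 2 + 2 * (r1 * r2)) * b
       + 2 * r1 ^+ 2 * (a * a) + 2 * (r1 * r2) * (a * b) + 2 * r2 ^+ 2 * (b * b))))
   + (q2 * b) * (a * (- (x2 * (1 - x2))
     + (2 * x2 - 1) * (r1 + r2 - r1 * a - r2 * b)
     + ((r1 + r2) ^+ 2 - (3 * r1 ^+ 2 + 2 * (r1 * r2)) * a - (3 * r2 ^+ 2 + 2 * (r1 * r2)) * b
       + 2 * r1 ^+ 2 * (a * a) + 2 * (r1 * r2) * (a * b) + 2 * r2 ^+ 2 * (b * b)))).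
  rewrite /S; ring.
rewrite e1 e2 /r1 /r2; ring.
Qed.

(** The identity [comparison_alg] with its coefficients brought under the scalar embedding [c], the
    form that [asympZ] consumes. The weights of the [N] terms add up to zero, and so do those of the
    [M] terms. *)
Lemma comparison_alg_cst (K A : comNzRingType) (c : K -> A) (D : A -> A) (a b o q1 q2 P N M : A) (l x1 x2 : K) :
  (forall u v, c (u + v) = c u + c v) -> (forall u v, c (u * v) = c u * c v) ->
  (forall u, c (- u) = - c u) -> c 1 = 1 ->
  (forall p q, D (p + q) = D p + D q) ->
  (forall p q, D (p * q) = D p * q + p * D q) -> (forall u, D (c u) = 0) -> D o = o * o ->
  D a = c (1 - x1) * ((o - o * a) * a) -> D b = c (1 - x2) * ((o - o * b) * b) ->
  q1 * a + c l * (o * o) * a = c l * (o * o) -> q2 * b + c l * (o * o) * b = c l * (o * o) ->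
  P = c (x2 * (1 - x2)) * q2 - c (x1 * (1 - x1)) * q1 ->
  N = c (2 * x2 - 1) * q2 - c (2 * x1 - 1) * q1 ->
  M = c 1 * q2 - c 1 * q1 ->
  let r1 := 1 - x1 in let r2 := 1 - x2 in
  c l * D (D (a - b)) = c (- 1) * (P * (a * b))
   + (c (r1 + r2) * (N * (a * b)) + c (- r1) * (N * (a * a * b)) + c (- r2) * (N * (a * b * b)))
   + (c ((r1 + r2) * (r1 + r2)) * (M * (a * b)) + c (- (3 * (r1 * r1) + 2 * (r1 * r2))) * (M * (a * a * b))
      + c (- (3 * (r2 * r2) + 2 * (r1 * r2))) * (M * (a * b * b))
      + c (2 * (r1 * r1)) * (M * (a * a * a * b)) + c (2 * (r1 * r2)) * (M * (a * a * b * b))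
      + c (2 * (r2 * r2)) * (M * (a * b * b * b))).
Proof.
move=> cD cM cN c1 DD DM Dc Do Da Db e1 e2 EP EN EM r1 r2.
have c2 : c 2 = 2 by rewrite -[2 in LHS]/(1 + 1) cD c1.
have c3 : c 3 = 3 by rewrite (_ : 3 = 2 + 1 :> K) ?cD ?c2 ?c1; ring.
rewrite cD cN c1 in Da; rewrite cD cN c1 in Db.
have := comparison_alg DD DM (Dc x1) (Dc x2) Do Da Db e1 e2 => /= ->.
rewrite EP EN EM /r1 /r2 !(cD, cM, cN, c1, c2, c3).
ring.
Qed.

(** * Uniform constants and the comparison of scalar solutions *)

Section comparison.
Context {R : realType}.
Local Notation mu := (@lebesgue_measure R).

Lemma inv_Gamma_lip : exists2 c : R, 1 <= c &
  [/\ forall x, 0 <= x <= 1 -> `|(Gamma (x + 1))^-1| <= c,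
      forall x : R, 0 <= x <= 1 -> Gamma (x + 1) <= c &
      forall x y : R, 0 <= x -> x <= y -> y <= 1 ->
        `|(Gamma (x + 1))^-1 - (Gamma (y + 1))^-1| <= c * (y - x)].
Proof.
have [K K0 lip] := @Gamma_lip R.
pose m : R := expR (- 1) / 2; have m0 : 0 < m by rewrite divr_gt0 ?expR_gt0.
have mi0 : 0 < m^-1 by rewrite invr_gt0.
have inv_le (x : R) : 0 <= x <= 1 -> (Gamma (x + 1))^-1 <= m^-1.
  by move=> x01; rewrite lef_pV2 ?posrE ?Gamma_succ_gt0//; exact: Gamma_lower.
have inv_ge0 (x : R) : 0 <= x <= 1 -> 0 <= (Gamma (x + 1))^-1.
  by move=> x01; rewrite invr_ge0 ltW ?Gamma_succ_gt0.
have kmm : 0 <= K * (m^-1 * m^-1) by rewrite !mulr_ge0// ltW.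
exists (1 + m^-1 + K + K * (m^-1 * m^-1)); first by lra.
split=> [x x01|x x01|x y x0 xy y1].
- by rewrite ger0_norm ?inv_ge0//; have := inv_le x x01; lra.
- have /andP[x0 x1] := x01; have := lip 0 x (lexx 0) x0 x1.
  rewrite add0r Gamma1 subr0 => /(le_trans (ler_norm _)) h.
  have : K * x <= K by rewrite ler_piMr// ltW.
  lra.
have x01 : 0 <= x <= 1 by apply/andP; split; lra.
have y01 : 0 <= y <= 1 by apply/andP; split; lra.
have gx := Gamma_succ_gt0 x01; have gy := Gamma_succ_gt0 y01.
have := lip x y x0 xy y1; have := inv_le _ x01; have := inv_le _ y01.
move: (Gamma (x + 1)) (Gamma (y + 1)) gx gy => p q p0 q0 qm pm pq.
have pi0 : 0 <= p^-1 by rewrite invr_ge0 ltW.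
have qi0 : 0 <= q^-1 by rewrite invr_ge0 ltW.
have -> : p^-1 - q^-1 = (q - p) * (p^-1 * q^-1) by field; rewrite !gt_eqF.
rewrite normrM (ger0_norm (mulr_ge0 pi0 qi0)).
apply: (@le_trans _ _ (K * (y - x) * (m^-1 * m^-1))).
  by apply: ler_pM => //; [exact: mulr_ge0|exact: ler_pM].
by rewrite mulrAC ler_wpM2r ?subr_ge0//; clear -kmm mi0 K0; lra.
Qed.

Lemma coef_bound (c x y f1 f2 g1 g2 : R) : 0 <= c -> x <= y -> `|g1| <= c -> `|g2| <= c ->
  `|g2 - g1| <= c * (y - x) -> `|f1| <= 1 -> `|f2| <= 1 -> `|f2 - f1| <= 2 * (y - x) ->
  `|f1 * g1| <= 3 * c /\ `|f2 * g2 - f1 * g1| <= 3 * c * (y - x).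
Proof.
move=> c0 xy g1c g2c g12 f1c f2c f12; split.
  rewrite normrM; apply: (@le_trans _ _ (1 * c)); first exact: ler_pM.
  lra.
have -> : f2 * g2 - f1 * g1 = f2 * (g2 - g1) + (f2 - f1) * g1 by ring.
apply: (le_trans (ler_normD _ _)); rewrite !normrM.
have h1 : `|f2| * `|g2 - g1| <= 1 * (c * (y - x)) by exact: ler_pM.
have h2 : `|f2 - f1| * `|g1| <= 2 * (y - x) * c by exact: ler_pM.
lra.
Qed.

(** With L = ln t, the power -a of the root of t is the inverse square of e^(a L / 4), and e^(a L /
    4) >= a L / 4. The second claim reduces to 2 C L <= w a^2 L^2 / 16, the origin of the 32 in
    [L0]. The 4 in [L0] gives both L >= 1 and [tau >= 4], the range of [asymp_word]. *)
Lemma threshold (C w a : R) : 0 <= C -> 0 < w -> 0 < a -> exists2 tau : R, 4 <= tau &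
  forall t, tau < t -> C <= w * ln t /\ C * (1 + ln t) * (Num.sqrt t) `^ (- a) <= w.
Proof.
move=> C0 w0 a0.
have wa0 : 0 < w * (a * a) by rewrite !mulr_gt0.
pose L0 : R := 4 + C / w + 32 * C / (w * (a * a)).
have h1 : 0 <= C / w by rewrite divr_ge0// ltW.
have h2 : 0 <= 32 * C / (w * (a * a)) by rewrite divr_ge0 ?mulr_ge0// ltW.
have e0 : 1 + L0 <= expR L0 by exact: expR_ge1Dx.
exists (expR L0); first by rewrite /L0 in e0 *; lra.
move=> t te; have t0 : 0 < t by apply: lt_trans te; exact: expR_gt0.
have Lt : L0 < ln t by rewrite -ltr_expR lnK.
move: (ln t) Lt (lnK (t0 : t \is Num.pos)) => L Lt Le.
have L4 : 4 < L by rewrite /L0 in Lt; lra.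
split.
  have : C / w <= L by rewrite /L0 in Lt; lra.
  by rewrite ler_pdivrMr// mulrC.
have s0 : 0 < Num.sqrt t by rewrite sqrtr_gt0.
have e1 : (Num.sqrt t) `^ (- a) * (expR (a * L / 4) * expR (a * L / 4)) = 1.
  rewrite -expRD -powR12_sqrt ?ltW// -powRrM powR_exp// -Le expRK -expRD -[RHS]expR0.
  by congr expR; field.
have h3 : C * 32 <= w * (a * a) * L.
  have : 32 * C / (w * (a * a)) <= L by rewrite /L0 in Lt; lra.
  by rewrite ler_pdivrMr//; lra.
have e2 : 1 + a * L / 4 <= expR (a * L / 4) by exact: expR_ge1Dx.
have aL : 0 < a * L by rewrite mulr_gt0//; lra.
have p0 : 0 < (Num.sqrt t) `^ (- a) by exact: powR_gt0.
have h4 : C * (1 + L) <= w * (expR (a * L / 4) * expR (a * L / 4)).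
  apply: (@le_trans _ _ (w * ((a * L / 4) * (a * L / 4)))); last first.
    by rewrite ler_pM2l//; clear -e2 aL; apply: ler_pM; lra.
  have : C * (1 + L) <= C * (2 * L) by apply: ler_wpM2l => //; lra.
  have : C * 32 * L <= w * (a * a) * L * L by rewrite ler_pM2r//; lra.
  lra.
have := ler_wpM2r (ltW p0) h4; have -> : w * (expR (a * L / 4) * expR (a * L / 4)) * Num.sqrt t `^ (- a) =
  w * (Num.sqrt t `^ (- a) * (expR (a * L / 4) * expR (a * L / 4))) by ring.
by rewrite e1 mulr1.
Qed.

(** Here [b1] and [b2] stand for (1 - x) / Gamma(x + 1); the factor x is kept apart because [x2] may
    be 0. In (x1 - x2) b1 t^x1 + x2 (b1 t^x1 - b2 t^x2) the second term is nonnegative: t^x1 is at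
    least t^x2 (1 + (x1 - x2) ln t), and this logarithm outweighs the possible growth from [b1] to
    [b2]. *)
Lemma leading_kernel (c rho0 x1 x2 b1 b2 t : R) : 0 < c -> 0 <= x2 -> x2 <= x1 ->
  rho0 / c <= b1 -> `|b2 - b1| <= 3 * c * (x1 - x2) -> 1 <= t -> 3 * c <= rho0 / c * ln t ->
  0 <= rho0 / c ->
  rho0 / c * (x1 - x2) * t `^ x1 <= x1 * b1 * t `^ x1 - x2 * b2 * t `^ x2.
Proof.
move=> c0 x20 x21 h1 h2 t1 h3 r0; have t0 : 0 < t by lra.
have p2 : 0 < t `^ x2 by exact: powR_gt0.
have e : t `^ x2 * (1 + (x1 - x2) * ln t) <= t `^ x1.
  have -> : t `^ x1 = t `^ x2 * expR ((x1 - x2) * ln t).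
    by rewrite !powR_exp// -expRD; congr expR; ring.
  by rewrite ler_pM2l// expR_ge1Dx.
have b0 : 0 <= b1 by lra.
have d0 : 0 <= x1 - x2 by lra.
have l0 : 0 <= ln t by exact: ln_ge0.
have h4 : 0 <= b1 * t `^ x1 - b2 * t `^ x2.
  have h5 : b1 * (t `^ x2 * (1 + (x1 - x2) * ln t)) <= b1 * t `^ x1 by exact: ler_wpM2l.
  have h6 : b2 - b1 <= 3 * c * (x1 - x2) by apply: le_trans h2; exact: ler_norm.
  have h7 : rho0 / c * ln t <= b1 * ln t by exact: ler_wpM2r.
  have h8 : 3 * c * (x1 - x2) <= b1 * ln t * (x1 - x2) by apply: ler_wpM2r => //; lra.
  have h9 : b2 * t `^ x2 <= (b1 + b1 * ln t * (x1 - x2)) * t `^ x2 by rewrite ler_pM2r//; lra.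
  lra.
have -> : x1 * b1 * t `^ x1 - x2 * b2 * t `^ x2 = (x1 - x2) * b1 * t `^ x1 + x2 * (b1 * t `^ x1 - b2 * t `^ x2) by ring.
rewrite -[leLHS]addr0; apply: lerD; last exact: mulr_ge0.
apply: ler_wpM2r; first exact: powR_ge0.
by rewrite mulrC; apply: ler_wpM2l.
Qed.

Lemma tame_le (T a K K' : R) w : K <= K' -> tame T a K w -> tame T a K' w.
Proof.
move=> KK [cw w0 wK wi wt]; split => //; first by move=> s; exact: le_trans KK.
by move=> t tT; apply: (le_trans (wt t tT)); rewrite ler_wpM2r ?powR_ge0.
Qed.

Definition tame_class (T a K : R) (p : calg T) : Prop := exists2 w, tame T a K w & p = emb T w.

Lemma tame_class_le (T a K K' : R) (p : calg T) : K <= K' -> tame_class a K p -> tame_class a K' p.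
Proof. by move=> KK [w tw ->]; exists w => //; exact: tame_le tw. Qed.

Lemma tame_mul (T a K K' K'' : R) (p q : calg T) : 0 <= a <= 1 -> 0 <= K -> 0 <= K' ->
  2 * (K + K') <= K'' -> tame_class a K p -> tame_class a K' q -> tame_class a K'' (p * q).
Proof.
move=> a01 K0 K'0 KK [u tu ->] [v tv ->]; exists (convol u v).
  by apply: tame_le KK _; exact: tame_conv.
by apply: embM; [case: tu|case: tv].
Qed.

(** Main term [V] and error [B] of a class. Both are additive, so the long identity can be evaluated
    term by term. *)
Definition asymp (T tau : R) (p : calg T) (V B : R -> R) : Prop :=
  exists2 f, causal f & p = emb T f /\ {ae mu, forall t, tau < t < T -> `|f t - V t| <= B t}.

Lemma asympD (T tau : R) (p q : calg T) V V' B B' : asymp tau p V B -> asymp tau q V' B' ->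
  asymp tau (p + q) (fun t => V t + V' t) (fun t => B t + B' t).
Proof.
move=> [f cf [-> hf]] [h ch [-> hh]]; exists (fun t => f t + h t); first exact: causalD.
split; first exact: embD.
apply: ae_imp2 hf hh => t h1 h2 tT.
have -> : f t + h t - (V t + V' t) = (f t - V t) + (h t - V' t) by ring.
by apply: (le_trans (ler_normD _ _)); apply: lerD; [exact: h1|exact: h2].
Qed.

Lemma asympZ (T tau c : R) (p : calg T) V B : asymp tau p V B ->
  asymp tau (acst T c * p) (fun t => c * V t) (fun t => `|c| * B t).
Proof.
move=> [f cf [-> hf]]; exists (fun t => c * f t); first exact: causalZ.
split; first exact: embZ.
by apply: ae_imp hf => t h1 tT; rewrite -mulrBr normrM ler_wpM2l//; exact: h1.
Qed.

Lemma causal_kernel (T r1 x1 r2 x2 : R) : 0 <= x1 -> 0 <= x2 -> causal (powdiff T r1 x1 r2 x2).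
Proof. by move=> x10 x20; apply: causalBZ; apply: causal_pw; lra. Qed.

Lemma asymp_word (T a K K' r1 x1 r2 x2 : R) (p : calg T) : 0 <= a <= 1 -> 1 <= K' ->
  0 <= x2 -> x2 <= x1 -> x1 <= 1 -> `|r1| <= K -> `|r2 - r1| <= K * (x1 - x2) ->
  tame_class a K' p ->
  asymp 4 (emb T (powdiff T r1 x1 r2 x2) * p) (powdiff T r1 x1 r2 x2)
    (fun t => 13 * K' * (K * (x1 - x2) * t `^ x1 * (1 + ln t)) * (Num.sqrt t) `^ (- a)).
Proof.
move=> a01 K1 x20 x21 x11 r1K rK [w tw ->].
have cw : causal w by case: tw.
have ck : causal (powdiff T r1 x1 r2 x2) by apply: causal_kernel => //; exact: le_trans x21.
exists (convol (powdiff T r1 x1 r2 x2) w); first exact: causal_conv.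
split; first exact: embM.
apply: ae_imp (conv_ae_integrable ck.1 cw.1) => t it /andP[t4 tT].
have K0 : 0 <= K by exact: le_trans r1K.
have t0 : 0 <= t by lra.
have rr : Num.sqrt t * Num.sqrt t = t by rewrite -expr2 sqr_sqrtr.
have r2' : 2 <= Num.sqrt t.
  have -> : 2 = Num.sqrt (4 : R) by rewrite (_ : 4 = 2 ^+ 2) ?sqrtr_sqr ?ger0_norm//; ring.
  by rewrite ler_sqrt//; lra.
have rt : Num.sqrt t < t by move: (Num.sqrt t) rr r2' => r rr ?; nra.
have t1 : 1 <= t by lra.
have l0 : 0 <= ln t by exact: ln_ge0.
apply: (@kernel_word R T a K' _ t (Num.sqrt t)) => //.
- by rewrite !mulr_ge0 ?powR_ge0//; lra.
- lra.
- move=> s /andP[s0 st]; have sT : s < T by lra.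
  by have [] := kernel_size x20 x21 x11 r1K rK t1 s0 (ltW st) sT.
- have tt : 0 < t by lra.
  by have [_] := kernel_size x20 x21 x11 r1K rK t1 tt (lexx t) tT; apply.
by move=> s /andP[s0 sr]; exact: kernel_variation.
Qed.

Lemma scaled_relaxation (T x lam : R) (y : R -> R) : 0 < T -> 0 <= x -> x < 1 -> 0 < lam ->
  scalar_solution T x lam 1 y ->
  let p := emb T (fun s => lam * (y \_ `]0, T[) s) in
  let q := acst T (Gamma (x + 1))^-1 * emb T (pw T x) in
  q * p + acst T lam * (oo T * oo T) * p = acst T lam * (oo T * oo T).
Proof.
move=> T0 x0 x1 l0 sol p q; have e := relaxation_eq x0 x1 sol; rewrite -/p acstM in e.
have g0 : Gamma (x + 1) != 0 by apply: lt0r_neq0; exact: g_gt0.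
have h : acst T (Gamma (x + 1))^-1 * acst T (Gamma (x + 1)) = 1 by rewrite mulrC; exact: acst_mulV.
rewrite /q; move: (acst T (Gamma (x + 1))^-1) (acst T (Gamma (x + 1))) (acst T lam) h e => gi g l h e.
transitivity (gi * (emb T (pw T x) * p + g * l * (oo T * oo T) * p) + (1 - gi * g) * (l * (oo T * oo T) * p)); first by ring.
rewrite e h subrr mul0r addr0; transitivity (gi * g * (l * (oo T * oo T))); first by ring.
rewrite h; exact: mul1r.
Qed.

Lemma emb_powdiff (T g1 g2 f1 f2 x1 x2 : R) : 0 <= x1 -> 0 <= x2 ->
  emb T (powdiff T (f1 * g1) x1 (f2 * g2) x2) =
  acst T f2 * (acst T g2 * emb T (pw T x2)) - acst T f1 * (acst T g1 * emb T (pw T x1)).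
Proof.
move=> x10 x20; rewrite /powdiff embBZ; [|apply: causal_pw; lra..].
by rewrite !acstM !mulrA.
Qed.

Lemma comparison_class (T lam x1 x2 : R) (y1 y2 : R -> R) :
  0 < T -> 0 <= x1 -> x1 < 1 -> 0 <= x2 -> x2 < 1 -> 0 < lam ->
  scalar_solution T x1 lam 1 y1 -> scalar_solution T x2 lam 1 y2 ->
  let a := emb T (fun s => lam * (y1 \_ `]0, T[) s) in
  let b := emb T (fun s => lam * (y2 \_ `]0, T[) s) in
  let Q f := emb T (powdiff T (f x1 * (Gamma (x1 + 1))^-1) x1 (f x2 * (Gamma (x2 + 1))^-1) x2) in
  let P := Q (fun x => x * (1 - x)) in let N := Q (fun x => 2 * x - 1) in let M := Q (fun=> 1) in
  let r1 := 1 - x1 in let r2 := 1 - x2 in let c_ := acst T in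
  c_ lam * aD (aD (a - b)) = c_ (- 1) * (P * (a * b))
   + (c_ (r1 + r2) * (N * (a * b)) + c_ (- r1) * (N * (a * a * b)) + c_ (- r2) * (N * (a * b * b)))
   + (c_ ((r1 + r2) * (r1 + r2)) * (M * (a * b)) + c_ (- (3 * (r1 * r1) + 2 * (r1 * r2))) * (M * (a * a * b))
      + c_ (- (3 * (r2 * r2) + 2 * (r1 * r2))) * (M * (a * b * b))
      + c_ (2 * (r1 * r1)) * (M * (a * a * a * b)) + c_ (2 * (r1 * r2)) * (M * (a * a * b * b))
      + c_ (2 * (r2 * r2)) * (M * (a * b * b * b))).
Proof.
move=> T0 x10 x11 x20 x2_1 l0 s1 s2 a b Q P N M r1 r2 c_.
have eq1 := scaled_relaxation T0 x10 x11 l0 s1; have eq2 := scaled_relaxation T0 x20 x2_1 l0 s2.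
have D1 := aD_relaxation T0 x10 x11 s1; have D2 := aD_relaxation T0 x20 x2_1 s2.
rewrite -/a in eq1 D1; rewrite -/b in eq2 D2.
move: eq1 eq2 => /= eq1 eq2.
exact: (@comparison_alg_cst R (calg T) (acst T) (@aD R T) a b (oo T)
  (acst T (Gamma (x1 + 1))^-1 * emb T (pw T x1)) (acst T (Gamma (x2 + 1))^-1 * emb T (pw T x2)) P N M lam x1 x2
  (acstD T) (acstM T) (acstN T) (acst1 T) (@aDD R T) (@aDM R T) (aDcst T) (@aD_oo R T) D1 D2 eq1 eq2
  (emb_powdiff T _ _ (x1 * (1 - x1)) (x2 * (1 - x2)) x10 x20)
  (emb_powdiff T _ _ (2 * x1 - 1) (2 * x2 - 1) x10 x20)
  (emb_powdiff T _ _ 1 1 x10 x20)).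
Qed.

(** 25 = 1 + 4 + 20, the largest sums of absolute weights in the P, N and M groups for orders in
    [0, 1]. *)
Lemma weights_le (E r1 r2 : R) : 0 <= E -> 0 <= r1 <= 1 -> 0 <= r2 <= 1 ->
  `|- 1| * E + (`|r1 + r2| * E + `|- r1| * E + `|- r2| * E)
  + (`|(r1 + r2) * (r1 + r2)| * E + `|- (3 * (r1 * r1) + 2 * (r1 * r2))| * E
     + `|- (3 * (r2 * r2) + 2 * (r1 * r2))| * E + `|2 * (r1 * r1)| * E + `|2 * (r1 * r2)| * E
     + `|2 * (r2 * r2)| * E) <= 25 * E.
Proof.
move=> E0 /andP[a0 a1] /andP[b0 b1].
have aa : 0 <= r1 * r1 <= 1 by rewrite mulr_ge0// mulr_ile1.
have ab : 0 <= r1 * r2 <= 1 by rewrite mulr_ge0// mulr_ile1.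
have bb : 0 <= r2 * r2 <= 1 by rewrite mulr_ge0// mulr_ile1.
have -> : (r1 + r2) * (r1 + r2) = r1 * r1 + 2 * (r1 * r2) + r2 * r2 by ring.
move: (r1 * r1) (r1 * r2) (r2 * r2) aa ab bb => u v w /andP[u0 u1] /andP[v0 v1] /andP[w0 w1].
rewrite !normrN normr1 !ger0_norm; try lra.
rewrite -!mulrDl ler_wpM2r//; lra.
Qed.

(** The identity of [comparison_class] read at a point: [aD] twice gives t^2, and each word acts as
    the Dirac mass up to the error [E]. Both orders are at least [rho0], which can therefore serve
    as their common tail exponent. *)
Lemma comparison_ae (rho0 c K0 T lam lam1 x1 x2 : R) (y1 y2 : R -> R) :
  0 < rho0 -> rho0 < 1 -> 0 < lam1 -> 1 <= c ->
  (forall x, 0 <= x <= 1 -> `|(Gamma (x + 1))^-1| <= c) ->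
  (forall x y : R, 0 <= x -> x <= y -> y <= 1 ->
        `|(Gamma (x + 1))^-1 - (Gamma (y + 1))^-1| <= c * (y - x)) ->
  K0 = 1 + 2 * expR 1 / lam1 -> 0 < T -> lam1 <= lam -> 0 < lam ->
  0 <= x2 -> x2 < x1 -> x1 <= 1 - rho0 ->
  scalar_solution T x1 lam 1 y1 -> scalar_solution T x2 lam 1 y2 ->
  let K' := 22 * K0 in
  let E (t : R) := 13 * K' * (3 * c * (x1 - x2) * t `^ x1 * (1 + ln t)) * (Num.sqrt t) `^ (- rho0) in
  let Q (f : R -> R) := powdiff T (f x1 * (Gamma (x1 + 1))^-1) x1 (f x2 * (Gamma (x2 + 1))^-1) x2 in
  let kP (x : R) := x * (1 - x) in
  {ae mu, forall t, 4 < t < T -> `|lam * lam * (t * t) * (y1 t - y2 t) - - Q kP t| <= 25 * E t}.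
Proof.
move=> r0 r1 l10 c1 Gb Gl EK T0 ll l0 x20 x21 x1r s1 s2 K' E Q kP.
have c0 : 0 < c by lra.
have K01 : 1 <= K0.
  have : 0 <= 2 * expR 1 / lam1 by rewrite divr_ge0 ?mulr_ge0 ?expR_ge0// ltW.
  by rewrite EK; lra.
have K'1 : 1 <= K' by rewrite /K'; lra.
have x10 : 0 <= x1 by clear -x20 x21; lra.
have x11 : x1 < 1 by clear -x1r r0; lra.
have x2_1 : x2 < 1 by clear -x21 x11; lra.
have a01 : 0 <= rho0 <= 1 by clear -r0 r1; apply/andP; split; lra.
have ta1 := relaxation_tame T0 x10 x11 l0 s1 r0 (_ : rho0 <= 1 - x1).
have {}ta1 := ta1 ltac:(clear -x1r; lra).
have ta2 := relaxation_tame T0 x20 x2_1 l0 s2 r0 (_ : rho0 <= 1 - x2).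
have {}ta2 := ta2 ltac:(clear -x1r x21; lra).
have KK : 1 + 2 * expR 1 / lam <= K0.
  rewrite EK; by rewrite lerD2l ler_wpM2l ?mulr_ge0 ?expR_ge0// lef_pV2 ?posrE//; lra.
have {}ta1 := tame_le KK ta1; have {}ta2 := tame_le KK ta2.
set f1 := (fun s => lam * (y1 \_ `]0, T[) s) in ta1.
set f2 := (fun s => lam * (y2 \_ `]0, T[) s) in ta2.
have cf1 : causal f1 by case: ta1.
have cf2 : causal f2 by case: ta2.
have A0 : tame_class rho0 K0 (emb T f1) by exists f1.
have B0 : tame_class rho0 K0 (emb T f2) by exists f2.
have := comparison_class T0 x10 x11 x20 x2_1 l0 s1 s2.
rewrite -/f1 -/f2; set a := emb T f1 in A0 *; set b := emb T f2 in B0 *.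
have K00 : 0 <= K0 by clear -K01; lra.
have K40 : 0 <= 4 * K0 by clear -K01; lra.
have K100 : 0 <= 10 * K0 by clear -K01; lra.
(* The multiples 4, 10, 22 of [K0] follow the rule 2 (K + K') of [tame_conv], one factor at a time;
   every word is finally given the largest constant. *)
have aa : tame_class rho0 (4 * K0) (a * a) by apply: (tame_mul a01 K00 K00 _ A0 A0); clear -K01; lra.
have ab : tame_class rho0 (4 * K0) (a * b) by apply: (tame_mul a01 K00 K00 _ A0 B0); clear -K01; lra.
have aab : tame_class rho0 (10 * K0) (a * a * b) by apply: (tame_mul a01 K40 K00 _ aa B0); clear -K01; lra.
have aaa : tame_class rho0 (10 * K0) (a * a * a) by apply: (tame_mul a01 K40 K00 _ aa A0); clear -K01; lra.
have abb : tame_class rho0 (10 * K0) (a * b * b) by apply: (tame_mul a01 K40 K00 _ ab B0); clear -K01; lra.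
have aaab : tame_class rho0 K' (a * a * a * b).
  by apply: (tame_mul a01 K100 K00 _ aaa B0); rewrite /K'; clear -K01; lra.
have aabb : tame_class rho0 K' (a * a * b * b).
  by apply: (tame_mul a01 K100 K00 _ aab B0); rewrite /K'; clear -K01; lra.
have abbb : tame_class rho0 K' (a * b * b * b).
  by apply: (tame_mul a01 K100 K00 _ abb B0); rewrite /K'; clear -K01; lra.
have K4' : 4 * K0 <= K' by rewrite /K'; clear -K01; lra.
have K10' : 10 * K0 <= K' by rewrite /K'; clear -K01; lra.
have {}ab := tame_class_le K4' ab; have {}aab := tame_class_le K10' aab; have {}abb := tame_class_le K10' abb.
have x2u : 0 <= x2 <= 1 by rewrite x20 ltW.
have x1u : 0 <= x1 <= 1 by rewrite x10 ltW.
have x11' : x1 <= 1 by exact: ltW.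
have word (f : R -> R) p : (forall x, 0 <= x <= 1 -> `|f x| <= 1) -> `|f x1 - f x2| <= 2 * (x1 - x2) ->
    tame_class rho0 K' p -> asymp 4 (emb T (Q f) * p) (Q f) E.
  move=> fb f12 tp; have c0' : 0 <= c by exact: ltW.
  have h := @coef_bound c x2 x1 (f x2) (f x1) (Gamma (x2 + 1))^-1 (Gamma (x1 + 1))^-1 c0' (ltW x21)
    (Gb _ x2u) (Gb _ x1u).
  rewrite distrC in h.
  have {h}[_ h2] := h (Gl _ _ x20 (ltW x21) x11') (fb _ x2u) (fb _ x1u) f12.
  rewrite distrC in h2.
  apply: asymp_word => //; first exact: ltW.
  rewrite normrM; have := fb _ x1u; have := Gb _ x1u => h3 h4.
  by apply: (@le_trans _ _ (1 * c)); [exact: ler_pM|rewrite ler_wpM2r// ler1n].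
pose kN (x : R) := 2 * x - 1; pose kM (x : R) : R := 1.
have wP := word kP (a * b) _ _ ab.
have wN p := word kN p _ _.
have wM p := word kM p _ _.
have {}wP : asymp 4 (emb T (Q kP) * (a * b)) (Q kP) E.
  apply: wP => [x /andP[h1 h2]|].
    by rewrite /kP ger0_norm ?mulr_ge0 ?subr_ge0//; clear -h1 h2; nra.
  rewrite (_ : kP x1 - kP x2 = (x1 - x2) * (1 - x1 - x2)); last by rewrite /kP; ring.
  rewrite normrM ger0_norm; last by rewrite subr_ge0 ltW.
  rewrite mulrC ler_wpM2r//; first by clear -x21; lra.
  by rewrite ler_norml; clear -x10 x20 x11 x2_1; apply/andP; split; lra.
have {}wN p : tame_class rho0 K' p -> asymp 4 (emb T (Q kN) * p) (Q kN) E.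
  apply: wN => [x /andP[h1 h2]|]; first by rewrite /kN ler_norml; clear -h1 h2; apply/andP; split; lra.
  by rewrite (_ : kN x1 - kN x2 = 2 * (x1 - x2)) ?ger0_norm//; rewrite /kN; [clear -x21; lra|ring].
have {}wM p : tame_class rho0 K' p -> asymp 4 (emb T (Q kM) * p) (Q kM) E.
  apply: wM => [x _|]; first by rewrite normr1.
  by rewrite subrr normr0 mulr_ge0// subr_ge0 ltW.
set r1' := 1 - x1; set r2' := 1 - x2 => /= eq.
have := asympD (asympD (asympZ (- 1) wP)
    (asympD (asympD (asympZ (r1' + r2') (wN _ ab)) (asympZ (- r1') (wN _ aab))) (asympZ (- r2') (wN _ abb))))
  (asympD (asympD (asympD (asympD (asympD (asympZ ((r1' + r2') * (r1' + r2')) (wM _ ab))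
    (asympZ (- (3 * (r1' * r1') + 2 * (r1' * r2'))) (wM _ aab)))
    (asympZ (- (3 * (r2' * r2') + 2 * (r1' * r2'))) (wM _ abb)))
    (asympZ (2 * (r1' * r1')) (wM _ aaab))) (asympZ (2 * (r1' * r2')) (wM _ aabb)))
    (asympZ (2 * (r2' * r2')) (wM _ abbb))).
move=> [F cF [eF aF]].
have {eq}eq : acst T lam * aD (aD (a - b)) = emb T F by rewrite -eF; exact: eq.
have cd : causal (fun t => 1 * f1 t - 1 * f2 t) by exact: causalBZ.
have ed : a - b = emb T (fun t => 1 * f1 t - 1 * f2 t) by rewrite embBZ// acst1 !mul1r.
have ct := causal_tmul T cd; have ctt := causal_tmul T ct.
rewrite ed emb_aD// emb_aD// [acst T lam * _]embZ// in eq.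
have {}eq := (embP T (causalZ lam ctt) cF).1 eq.
have r1u : 0 <= r1' <= 1 by rewrite /r1'; move/andP: x1u => [? ?]; apply/andP; split; rewrite ?subr_ge0// gerBl.
have r2u : 0 <= r2' <= 1 by rewrite /r2'; move/andP: x2u => [? ?]; apply/andP; split; rewrite ?subr_ge0// gerBl.
apply: ae_imp2 eq aF => t h1 h2 t4T; have {}h2 := h2 t4T.
have /andP[t4 tT] := t4T.
have t0 : 0 < t by exact: lt_trans t4.
have {}h1 := h1 tT; rewrite /tmul tT /f1 /f2 !y0E ?t0// in h1.
have E0 : 0 <= E t.
  have t1 : 1 <= t by apply: le_trans (ltW t4); rewrite ler1n.
  rewrite /E mulr_ge0 ?powR_ge0// mulr_ge0 ?mulr_ge0 ?powR_ge0 ?subr_ge0 ?(ltW c0) ?(ltW x21)//.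
  by rewrite addr_ge0// ln_ge0.
apply: le_trans (le_trans h2 (weights_le E0 r1u r2u)).
(* In this [ring] the main terms of the [N] and [M] groups cancel, as their weights add up to zero;
   only that of [P] remains. *)
by rewrite le_eqVlt; apply/orP; left; apply/eqP; rewrite -h1; congr (`| _ |); ring.
Qed.

(** The gap is bounded below by one positive [kappa] on the whole open interval, so that the strict
    inequality survives the passage to its right endpoint. *)
Theorem scalar_comparison (rho0 lam1 : R) : 0 < rho0 -> rho0 < 1 -> 0 < lam1 ->
  exists2 T0 : R, 0 < T0 & forall (T lam x1 x2 : R) (y1 y2 : R -> R),
    T0 < T -> lam1 <= lam -> 0 <= x2 -> x2 < x1 -> x1 <= 1 - rho0 ->
    scalar_solution T x1 lam 1 y1 -> scalar_solution T x2 lam 1 y2 ->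
    exists2 kappa : R, 0 < kappa & forall t, T0 < t < T -> kappa <= y1 t - y2 t.
Proof.
move=> r0 r1 l10; have [c c1 [Gb Gu Gl]] := inv_Gamma_lip.
have c0 : 0 < c by lra.
pose K0 : R := 1 + 2 * expR 1 / lam1.
have K01 : 1 <= K0.
  have : 0 <= 2 * expR 1 / lam1 by rewrite divr_ge0 ?mulr_ge0 ?expR_ge0// ltW.
  by rewrite /K0; lra.
(* Lower bound of (1 - x) / Gamma(x + 1) for all admissible orders. *)
pose w0 : R := rho0 / c; have w00 : 0 < w0 by rewrite divr_gt0.
(* The first summand is the Lipschitz constant that [leading_kernel] has to beat, the second
   collects the error constants. [threshold] is applied with [w0 / 2], so the error uses up at most
   half of the leading term. *)
pose C : R := 3 * c + 25 * (13 * (22 * K0) * (3 * c)).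
have C2 : 0 <= 25 * (13 * (22 * K0) * (3 * c)) by rewrite !mulr_ge0//; lra.
have C0 : 0 <= C by rewrite /C addr_ge0//; lra.
have w02 : 0 < w0 / 2 by rewrite divr_gt0.
have [tau tau4 th] := threshold C0 w02 r0.
exists tau; first by lra.
move=> T lam x1 x2 y1 y2 tT ll x20 x21 x1r s1 s2.
have l0 : 0 < lam by clear -l10 ll; lra.
have T0 : 0 < T by clear -tT tau4; lra.
pose E (t : R) := 13 * (22 * K0) * (3 * c * (x1 - x2) * t `^ x1 * (1 + ln t)) * (Num.sqrt t) `^ (- rho0).
pose Q := powdiff T (x1 * (1 - x1) * (Gamma (x1 + 1))^-1) x1 (x2 * (1 - x2) * (Gamma (x2 + 1))^-1) x2.
have aF : {ae mu, forall t, 4 < t < T -> `|lam * lam * (t * t) * (y1 t - y2 t) - - Q t| <= 25 * E t}.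
  exact: (comparison_ae r0 r1 l10 c1 Gb Gl (erefl K0) T0 ll l0 x20 x21 x1r s1 s2).
have d0 : 0 < x1 - x2 by rewrite subr_gt0.
have x1u : 0 <= x1 <= 1 by clear -x20 x21 x1r r0; apply/andP; split; lra.
have x2u : 0 <= x2 <= 1 by clear -x20 x21 x1r r0; apply/andP; split; lra.
pose kappa : R := w0 / 2 * (x1 - x2) / (lam * lam * (T * T)).
have kappa0 : 0 < kappa by apply: divr_gt0; [exact: mulr_gt0|apply: mulr_gt0; exact: mulr_gt0].
exists kappa => // t tT'; rewrite -subr_ge0.
have [yc1 _ _] := s1; have [yc2 _ _] := s2.
apply: (@ae_ge0_continuous R tau T (fun t => y1 t - y2 t - kappa)) => //; last first.
  have tT'' : 0 < t < T by move/andP: tT' => [h1 h2]; clear -h1 h2 tau4; apply/andP; split; lra.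
  apply: continuousB; last exact: cst_continuous.
  by apply: continuousB; [exact: yc1|exact: yc2].
apply: ae_imp aF => {tT'}t h2 /andP[tt tT'].
have t0 : 0 < t by clear -tt tau4; lra.
have t1 : 1 <= t by clear -tt tau4; lra.
have {}h2 := h2 ltac:(clear -tt tau4 tT'; apply/andP; split; lra).
have [th1 th2] := th t tt.
have p1 : 1 <= t `^ x1 by rewrite -(powRr0 t); apply: ler_powR => //; case/andP: x1u.
have p0 : 0 < t `^ x1 by exact: lt_le_trans p1.
have E25 : 25 * E t <= w0 / 2 * ((x1 - x2) * t `^ x1).
  have q0 : 0 <= (x1 - x2) * t `^ x1 by rewrite mulr_ge0// ltW.
  have -> : 25 * E t = 25 * (13 * (22 * K0) * (3 * c)) * ((1 + ln t) * Num.sqrt t `^ (- rho0)) * ((x1 - x2) * t `^ x1).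
    by rewrite /E; ring.
  apply: ler_wpM2r => //; apply: le_trans th2; rewrite -[leRHS]mulrA; apply: ler_wpM2r.
    by rewrite mulr_ge0 ?powR_ge0// addr_ge0 ?ln_ge0.
  by rewrite /C lerDr; clear -c0; lra.
have lead : w0 * (x1 - x2) * t `^ x1 <= - Q t.
  have -> : - Q t = x1 * ((1 - x1) * (Gamma (x1 + 1))^-1) * t `^ x1 - x2 * ((1 - x2) * (Gamma (x2 + 1))^-1) * t `^ x2.
    rewrite /Q /powdiff (@pw_in _ T x1) ?t0 // (@pw_in _ T x2) ?t0 //.
    by rewrite opprB !mulrA.
  apply: (@leading_kernel c) => //; try exact: ltW.
  - have g1 := Gamma_succ_gt0 x1u.
    apply: ler_pM; rewrite ?invr_ge0 ?(ltW r0) ?(ltW c0)//; first by clear -x1r; lra.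
    by rewrite lef_pV2 ?posrE// Gu.
  - have h := @coef_bound c x2 x1 (1 - x2) (1 - x1) (Gamma (x2 + 1))^-1 (Gamma (x1 + 1))^-1 (ltW c0) (ltW x21)
      (Gb _ x2u) (Gb _ x1u).
    rewrite distrC in h; have x11' : x1 <= 1 by case/andP: x1u.
    have {h}[_ h3] := h (Gl _ _ x20 (ltW x21) x11') ltac:(clear -x2u; case/andP: x2u => *; rewrite ger0_norm; lra)
      ltac:(clear -x1u; case/andP: x1u => *; rewrite ger0_norm; lra)
      ltac:(clear -x21; rewrite ler_norml; apply/andP; split; lra).
    by rewrite distrC in h3.
  - have h1 : 3 * c <= C by rewrite /C; clear -C2; lra.
    have h5 : 0 <= w0 * ln t by rewrite mulr_ge0 ?(ltW w00)// ln_ge0.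
    rewrite -/w0; clear -h1 h5 th1; lra.
have tt0 : 0 < lam * lam * (t * t) by rewrite !mulr_gt0.
have low : w0 / 2 * (x1 - x2) <= lam * lam * (t * t) * (y1 t - y2 t).
  rewrite ler_norml in h2; case/andP: h2 => h3 _.
  have h4 : w0 / 2 * (x1 - x2) * 1 <= w0 / 2 * (x1 - x2) * t `^ x1.
    by apply: ler_wpM2l => //; rewrite mulr_ge0// ltW.
  clear -h3 h4 E25 lead; lra.
rewrite subr_ge0 /kappa ler_pdivrMr ?mulr_gt0//; apply: (le_trans low).
have y12 : 0 <= y1 t - y2 t.
  rewrite -(pmulr_rge0 _ tt0); apply: le_trans low; rewrite mulr_ge0//; exact: ltW.
rewrite [leLHS]mulrC; apply: ler_wpM2l => //.
by rewrite ler_pM2l ?mulr_gt0//; apply: ler_pM => //; exact: ltW.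
Qed.

End comparison.

(** * Coefficients of Hilbert space solutions *)

Section scalars.
Context {R : realType} {k : scalar_kind}.
Local Notation C := (scalars R k).

Lemma ofRD (a b : R) : ofR k (a + b) = ofR k a + ofR k b.
Proof. by case: k => //; exact: rmorphD. Qed.

Lemma ofRM (a b : R) : ofR k (a * b) = ofR k a * ofR k b.
Proof. by case: k => //; exact: rmorphM. Qed.

Lemma ofR0 : ofR k (0 : R) = 0. Proof. by case: k. Qed.
Lemma ofR1 : ofR k (1 : R) = 1. Proof. by case: k. Qed.

Lemma ofR_lt (a b : R) : (ofR k a < ofR k b) = (a < b).
Proof. by case: k => //; exact: ltcR. Qed.

Lemma ofR_le (a b : R) : (ofR k a <= ofR k b) = (a <= b).
Proof. by case: k => //; exact: lecR. Qed.

Lemma reS_ofR (a : R) : reS (ofR k a) = a. Proof. by case: k. Qed.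

Lemma reSD (z w : C) : reS (z + w) = reS z + reS w.
Proof. by case: k z w => // -[a b] [c d]. Qed.

Lemma reS0 : reS (0 : C) = 0.
Proof. by case: k. Qed.

Lemma reS_N (z : C) : reS (- z) = - reS z.
Proof. by case: k z => // -[a b]. Qed.

Lemma reSZ (a : R) (z : C) : reS (ofR k a * z) = a * reS z.
Proof. by case: k z => // -[b c] /=; rewrite mul0r subr0. Qed.

Lemma reS_lt (z w : C) : z < w -> reS z < reS w.
Proof. by case: k z w => // z w; rewrite ltcE => /andP[]. Qed.

Lemma reS_le (z w : C) : z <= w -> reS z <= reS w.
Proof. by case: k z w => // z w; rewrite lecE => /andP[]. Qed.

Lemma ofR_reS (z : C) : 0 <= z -> ofR k (reS z) = z.
Proof. by case: k z => // -[a b]; rewrite lecE/= => /andP[/eqP-> _]. Qed.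

Lemma reS_norm_ge0 (K : normedZmodType C) (z : K) : 0 <= reS `|z|.
Proof. by rewrite -(reS_ofR 0) ofR0; exact: reS_le. Qed.

Lemma reS_le_norm (z : C) : `|reS z| <= reS `|z|.
Proof.
case: k z => // z; have := normc_ge_Re z; rewrite lecE => /andP[_].
by rewrite /=.
Qed.

Lemma norm_ofR (a : R) : `|ofR k a| = ofR k `|a|.
Proof. by case: k => //=; rewrite normc_def/= expr0n addr0 sqrtr_sqr. Qed.

Lemma reS_mul_norm (z w : C) : reS (`|z| * `|w|) = reS `|z| * reS `|w|.
Proof. by rewrite -[in LHS](ofR_reS (normr_ge0 z)) reSZ. Qed.

Lemma conjS_ofR (a : R) : conjS (ofR k a) = ofR k a.
Proof. by case: k => //=; exact: conjc_real. Qed.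

Lemma mul_conjS (z : C) : z * conjS z = `|z| ^+ 2.
Proof. by case: k z => z /=; [rewrite real_normK ?num_real// expr2|rewrite normCK]. Qed.

Lemma conjS0 : conjS (0 : C) = 0. Proof. by case: k => //=; exact: rmorph0. Qed.

Lemma conjSM (z w : C) : conjS (z * w) = conjS z * conjS w.
Proof. by case: k z w => // z w /=; exact: rmorphM. Qed.

Lemma reS_eq0 (w : C) : (forall z : C, reS (z * w) = 0) -> w = 0.
Proof.
move=> h; apply/eqP; apply/negPn/negP => w0.
by have := h w^-1; rewrite mulVf// -ofR1 reS_ofR => /eqP; rewrite oner_eq0.
Qed.

End scalars.

(** * Bounded real functionals and the Bochner integral *)

Section functional.
Context {R : realType} {k : scalar_kind} {H : completeNormedModType (scalars R k)}.
Local Notation mu := (@lebesgue_measure R).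

(** Real-linear even over complex scalars: composing with such functionals brings both kinds of
    scalars to real equations. *)
Definition real_functional (l : H -> R) : Prop :=
  [/\ forall x y, l (x + y) = l x + l y, forall (a : R) x, l (ofR k a *: x) = a * l x &
      exists2 M, 0 < M & forall x, `|l x| <= M * reS `|x| ].

Lemma functionalN l x : real_functional l -> l (- x) = - l x.
Proof.
move=> [lD lZ _]; have <- : ofR k (-1) *: x = - x; last by rewrite lZ mulN1r.
suff -> : ofR k (-1 : R) = -1 by rewrite scaleN1r.
by apply: (addrI 1); rewrite subrr -{1}ofR1 -ofRD subrr ofR0.
Qed.

Lemma functional0 l : real_functional l -> l 0 = 0.
Proof. by move=> [_ lZ _]; rewrite -(scale0r (0 : H)) -ofR0 lZ mul0r. Qed.

Lemma functional_sum l n (F : 'I_n -> H) : real_functional l ->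
  l (\sum_(i < n) F i) = \sum_(i < n) l (F i).
Proof.
move=> lf; have [lD _ _] := lf; apply: (big_morph l lD); exact: functional0.
Qed.

Lemma functional_cvg l (T : Type) (F : set_system T) {FF : Filter F} (f : T -> H) x :
  real_functional l -> f t @[t --> F] --> x -> l (f t) @[t --> F] --> l x.
Proof.
move=> lf fx; have [lD lZ [M M0 lb]] := lf.
apply/cvgrPdist_lt => e e0.
have e0' : 0 < ofR k (e / M) by rewrite -ofR0 ofR_lt divr_gt0.
have h := (@cvgrPdist_lt _ _ T F FF f x).1 fx _ e0'; apply: filterS h => t.
move=> /reS_lt; rewrite reS_ofR ltr_pdivlMr// mulrC; apply: le_lt_trans.
by rewrite -functionalN// -lD lb.
Qed.

(* no measurability is required of [g]: the integral of a nonnegative function is a supremum over simple functions *)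
Lemma le_integral_nonmeas (D : set R) (f g : R -> \bar R) :
  (forall x, D x -> 0 <= f x)%E -> (forall x, D x -> f x <= g x)%E ->
  (\int[mu]_(x in D) f x <= \int[mu]_(x in D) g x)%E.
Proof.
move=> f0 fg; rewrite !ge0_integralE//; last by move=> x Dx; exact: le_trans (f0 _ Dx) (fg _ Dx).
apply: le_ereal_sup => _ [h /= hf <-]; exists h => //= x.
apply: (le_trans (hf x)); rewrite !patchE; case: ifPn => // xD; apply: fg; exact: set_mem.
Qed.

Lemma integrable_indic_itv (D A : set R) : measurable D -> measurable A -> A `<=` D -> (mu A < +oo)%E ->
  mu.-integrable D (EFin \o (\1_A : R -> R)).
Proof.
move=> mD mA AD fA; apply/integrableP; split.
  by apply/measurable_EFinP; exact: measurable_funTS.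
rewrite (_ : (\int[mu]_(x in D) _ = \int[mu]_(x in D) (\1_A x)%:E)%E).
  by rewrite integral_indic// setIidl.
by apply: eq_integral => x _ /=; rewrite ger0_norm// indicE; case: (_ \in _).
Qed.

Lemma functional_step (l : H -> R) (D : set R) (s : step_fun H) : real_functional l -> measurable D -> sf_wf D s ->
  mu.-integrable D (EFin \o (l \o sf_eval s)) /\ \int[mu]_(x in D) l (sf_eval s x) = l (sf_integral s).
Proof.
move=> lf mD ws; have [lD lZ _] := lf.
have e x : l (sf_eval s x) = \sum_(i < sf_size s) (\1_(@sf_set _ _ _ s i) x * l (@sf_val _ _ _ s i)).
  rewrite functional_sum//; apply: eq_bigr => i _; rewrite -lZ; congr (l (_ *: _)).
  by rewrite !indicE; case: (_ \in _); rewrite ?ofR1 ?ofR0.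
have ii i : mu.-integrable D (EFin \o (fun x : R => \1_(@sf_set _ _ _ s i) x * l (@sf_val _ _ _ s i))).
  have [mA AD fA] := ws i.
  have h : mu.-integrable D (EFin \o (\1_(@sf_set _ _ _ s i) : R -> R)).
    by apply: integrable_indic_itv.
  exact: integrable_realZr.
have E : l \o sf_eval s = (fun x => \sum_(i < sf_size s) (\1_(@sf_set _ _ _ s i) x * l (@sf_val _ _ _ s i))).
  by apply/funext => x /=; rewrite e.
have sum_int n (F : 'I_n -> R -> R) : (forall i, mu.-integrable D (EFin \o F i)) ->
    mu.-integrable D (EFin \o (fun x => \sum_(i < n) F i x)) /\
    \int[mu]_(x in D) (\sum_(i < n) F i x) = \sum_(i < n) \int[mu]_(x in D) F i x.
  elim: n F => [|n IH] F iF.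
    split; last by under eq_Rintegral do rewrite big_ord0; rewrite Rintegral_cst ?mul0r ?big_ord0.
    by apply: eq_integrable (integrable0 mu D) => // x _ /=; rewrite big_ord0.
  have [i1 e1] := IH (fun i => F (widen_ord (leqnSn n) i)) (fun i => iF _).
  split.
    have h := integrable_realD mD i1 (iF ord_max).
    by apply: eq_integrable h => // x _ /=; rewrite big_ord_recr.
  under eq_Rintegral do rewrite big_ord_recr/=.
  by rewrite RintegralD// e1 big_ord_recr.
have [i1 e1] := sum_int _ _ ii.
split; first by rewrite E.
have -> : \int[mu]_(x in D) l (sf_eval s x) = \int[mu]_(x in D) (\sum_(i < sf_size s) (\1_(@sf_set _ _ _ s i) x * l (@sf_val _ _ _ s i))).
  by apply: eq_Rintegral => x _.
rewrite e1 /sf_integral functional_sum//; apply: eq_bigr => i _; rewrite lZ.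
have [mA AD fA] := ws i.
have h : mu.-integrable D (EFin \o (\1_(@sf_set _ _ _ s i) : R -> R)).
  by apply: integrable_indic_itv.
rewrite RintegralZr//; congr (_ * _).
by rewrite /Rintegral integral_indic// setIidl.
Qed.

(** The claim is exact on step functions, and |l f - l s_n| is at most [M] times the norm of f -
    s_n, so the integrals of l s_n converge both to that of l f and to [l I]. The norm is not known
    to be measurable here, hence the appeal to [le_integral_nonmeas]. *)
Lemma bochner_functional (l : H -> R) (D : set R) (f : R -> H) (I : H) : real_functional l ->
  measurable D -> measurable_fun D (l \o f) -> is_bochner_integral D f I ->
  mu.-integrable D (EFin \o (l \o f)) /\ \int[mu]_(x in D) l (f x) = l I.
Proof.
move=> lf mD mf [s [ws _ s0 sI]]; have [lD lZ [M M0 lb]] := lf.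
pose d n : \bar R := (\int[mu]_(x in D) (`|M^-1 * (l (f x) - l (sf_eval (s n) x))|)%:E)%E.
have dle n : (d n <= \int[mu]_(x in D) (reS `|f x - sf_eval (s n) x|)%:E)%E.
  apply: le_integral_nonmeas => x _; rewrite lee_fin//.
  rewrite -functionalN// -lD normrM gtr0_norm ?invr_gt0// mulrC ler_pdivrMr// mulrC.
  exact: lb.
have d0 n : (0 <= d n)%E by apply: integral_ge0 => x _; rewrite lee_fin.
have ms n : measurable_fun D (fun x => M^-1 * (l (f x) - l (sf_eval (s n) x))).
  apply: measurable_funM => //; apply: measurable_funB => //; have [+ _] := functional_step lf mD (ws n).
  by move=> /measurable_int/measurable_EFinP.
have d_small e : 0 < e -> \forall n \near \oo, (d n < e%:E)%E.
  move=> e0; have [fn] := (fine_cvgP _ _).1 s0.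
  move=> /(cvgrPdist_lt _ _).1 /(_ _ e0); move: fn; apply: filterS2 => n fn h.
  apply: le_lt_trans (dle n) _; rewrite -(fineK fn) lte_fin.
  by move: h; rewrite sub0r normrN; apply: le_lt_trans; exact: ler_norm.
have di n : (d n < +oo)%E -> mu.-integrable D (EFin \o (fun x => M^-1 * (l (f x) - l (sf_eval (s n) x)))).
  move=> dn; apply/integrableP; split; last exact: dn.
  apply/measurable_EFinP; exact: ms.
have di' n : (d n < +oo)%E -> mu.-integrable D (EFin \o (fun x => l (f x) - l (sf_eval (s n) x))).
  move=> /di /(integrable_realZl M mD); apply: eq_integrable => // x _ /=.
  by rewrite mulrA mulfV ?mul1r// gt_eqF.
have int : mu.-integrable D (EFin \o (l \o f)).
  have [n _ /(_ n (leqnn n)) /= dn] := d_small 1 ltr01.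
  have h := di' n (lt_trans dn (ltry 1)).
  have [h' _] := functional_step lf mD (ws n).
  have h2 := integrable_realD mD h h'.
  by apply: eq_integrable h2 => // x _ /=; rewrite subrK.
split => //.
have c1 : l (sf_integral (s n)) @[n --> \oo] --> l I by exact: functional_cvg.
suff c2 : l (sf_integral (s n)) @[n --> \oo] --> \int[mu]_(x in D) l (f x).
  exact: (cvg_unique _ c2 c1).
apply/cvgrPdist_lt => e e0.
have eM : 0 < e / M by rewrite divr_gt0.
have := d_small _ eM; apply: filterS => n dn.
have [h' <-] := functional_step lf mD (ws n).
rewrite -RintegralB//.
have din := di n (lt_trans dn (ltry _)).
have -> : \int[mu]_(x in D) (l (f x) - l (sf_eval (s n) x)) =
    M * \int[mu]_(x in D) (M^-1 * (l (f x) - l (sf_eval (s n) x))).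
  rewrite -RintegralZl//; apply: eq_Rintegral => x _.
  by rewrite mulrA mulfV ?mul1r// gt_eqF.
rewrite normrM gtr0_norm// -ltr_pdivlMl// mulrC.
apply: le_lt_trans (le_normr_Rintegral _ din) _ => //.
rewrite -lte_fin fineK//.
by rewrite ge0_fin_numE; [exact: lt_trans dn (ltry _)|exact: d0].
Qed.

End functional.

(** * From the forward problem to the scalar equation *)

Section forward.
Context {R : realType}.
Local Notation mu := (@lebesgue_measure R).

Lemma continuous_itvoc_oo (T : R) (y : R -> R) : {within `]0, T], continuous y} ->
  forall t, 0 < t < T -> {for t, continuous y}.
Proof.
move=> cy t tT; have h : {within `]0, T[, continuous y}.
  by apply: continuous_subspaceW cy => s; rewrite /= !in_itv/= => /andP[-> /ltW].
move: h; rewrite continuous_open_subspace; last exact: interval_open.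
by apply; rewrite inE/= in_itv/=.
Qed.

Lemma continuous_itvoc_left (T : R) (y : R -> R) : 0 < T -> {within `]0, T], continuous y} ->
  y t @[t --> T^'-] --> y T.
Proof.
move=> T0 cy; have T2 : T / 2 < T by lra.
have h : {within `[T / 2, T], continuous y}.
  apply: continuous_subspaceW cy => s; rewrite /= !in_itv/= => /andP[s1 ->].
  by rewrite andbT; lra.
by have [] := (continuous_within_itvP _ T2).1 h.
Qed.

Lemma itvoc_le_left (T tau c : R) (y : R -> R) : 0 < T -> tau < T -> {within `]0, T], continuous y} ->
  (forall t, tau < t < T -> c <= y t) -> c <= y T.
Proof.
move=> T0 tT cy h; apply: (cvgr_to_ge (continuous_itvoc_left T0 cy)).
near=> t; apply: h; apply/andP; split; near: t; [exact: nbhs_left_gt|exact: nbhs_left_lt].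
Unshelve. all: by end_near.
Qed.

Lemma within_scale (S : set R) (y : R -> R) (c : R) : {within S, continuous y} ->
  {within S, continuous (fun t => c * y t)}.
Proof. by move=> cy x; apply: cvgM; [exact: cvg_cst|exact: cy]. Qed.

(** On the interval the weight (T - s)^(-c) is at least T^(-c). *)
Lemma integrable_weight (T c : R) (y : R -> R) : 0 < T -> 0 <= c ->
  (forall t, 0 < t < T -> {for t, continuous y}) ->
  mu.-integrable `]0, T[ (EFin \o (fun s => (T - s) `^ (- c) * y s)) -> mu.-integrable `]0, T[ (EFin \o y).
Proof.
move=> T0 c0 cy h.
have my : measurable_fun `]0, T[ y.
  apply: open_continuous_measurable_fun; first exact: interval_open.
  by move=> t; rewrite inE/= in_itv/=; exact: cy.
have hm : mu.-integrable `]0, T[ (EFin \o (fun s => T `^ c * ((T - s) `^ (- c) * y s))).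
  by apply: integrable_realZl.
apply: (@le_integrable _ _ _ mu `]0, T[ _ (EFin \o y) _ _ _ hm).
- exact: measurable_itv.
- by apply/measurable_EFinP; exact: my.
move=> s; rewrite /= in_itv/= => /andP[s0 sT]; rewrite lee_fin mulrA [leRHS]normrM ler_peMl//.
have ts : 0 < T - s by lra.
rewrite ger0_norm ?mulr_ge0 ?powR_ge0// powRN ler_pdivlMr ?powR_gt0//.
by rewrite mul1r; apply: ge0_ler_powR; rewrite ?nnegrE; lra.
Qed.

Lemma measurable_weight (T c : R) (y : R -> R) : 
  (forall t, 0 < t < T -> {for t, continuous y}) ->
  measurable_fun `]0, T[ (fun s => (T - s) `^ c * y s).
Proof.
move=> cy; apply: open_continuous_measurable_fun; first exact: interval_open.
move=> t; rewrite inE/= in_itv/= => /andP[t0 tT].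
suff : {for t, continuous (fun s : R => (T - s) `^ c * y s)} by [].
apply: continuousM; last by apply: cy; rewrite t0.
apply: (@continuous_comp _ _ _ (fun s : R => T - s) (fun s : R => s `^ c)).
  by apply: continuousB; [exact: cst_continuous|].
by apply: continuous_powR_pos; lra.
Qed.

Lemma prim_split (y : R -> R) (T a b : R) : 0 < a -> a < b -> b < T -> mu.-integrable `]0, T[ (EFin \o y) ->
  prim y b = prim y a + \int[mu]_(s in `[a, b]) y s.
Proof.
move=> a0 ab bT iy.
have iS (S : set R) : measurable S -> S `<=` `]0, T[ -> mu.-integrable S (EFin \o y).
  by move=> mS ST; apply: integrableS iy.
have sub1 : `]0, b[ `<=` (`]0, T[ : set R).
  by move=> s; rewrite /= !in_itv/= => /andP[-> h]; exact: lt_trans bT.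
have sub2 : `[a, b[ `<=` (`]0, T[ : set R).
  by move=> s; rewrite /= !in_itv/= => /andP[h1 h2]; apply/andP; split; lra.
rewrite -Rintegral_itv_bndo_bndc; last exact: iS.
rewrite /prim -Rintegral_setU.
- congr Rintegral; apply/seteqP; split => s; rewrite /= !in_itv/=.
    by move=> /andP[h1 h2]; have [h|h] := ltP s a; [left; rewrite h1|right].
  by case=> /andP[h1 h2]; apply/andP; split; lra.
- exact: measurable_itv.
- exact: measurable_itv.
- apply: iS; first exact: measurableU.
  move=> s [|]; last exact: sub2.
  by rewrite /= !in_itv/= => /andP[-> h]; lra.
- apply/disj_set2P; rewrite -subset0 => s [/=]; rewrite !in_itv/= => /andP[_ h1] /andP[h2 _]; lra.
Qed.

(** The fundamental theorem of calculus on [[a, t]], then [a] tends to 0: the derivative is known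
    only inside the interval, and the datum only as a limit. *)
Lemma derive_to_prim (T lam eta : R) (G y : R -> R) : 0 < T ->
  (forall t, 0 < t < T -> is_derive t 1 G (- lam * y t)) ->
  (forall t, 0 < t < T -> {for t, continuous y}) -> mu.-integrable `]0, T[ (EFin \o y) ->
  G t @[t --> 0^'+] --> eta ->
  forall t, 0 < t < T -> G t = eta - lam * prim y t.
Proof.
move=> T0 dG cy iy G0 t /andP[t0 tT].
have cG s : 0 < s < T -> {for s, continuous G}.
  move=> sT; apply: differentiable_continuous; apply/derivable1_diffP.
  by have [] := dG _ sT.
have step a : 0 < a -> a < t -> G a = G t + lam * (prim y t - prim y a).
  move=> a0 at_.
  have h : (\int[mu]_(x in `[a, t]) (- lam * y x)%:E = (G t)%:E - (G a)%:E)%E.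
    apply: continuous_FTC2 => //.
    - apply: continuous_in_subspaceT => x; rewrite inE/= in_itv/= => /andP[ax xt].
      suff : {for x, continuous (fun x : R => - lam * y x)} by [].
      apply: continuousM; first exact: cst_continuous.
      by apply: cy; apply/andP; split; lra.
    - split.
      + move=> x; rewrite in_itv/= => /andP[ax xt].
        have xT : 0 < x < T by apply/andP; split; lra.
        by have [] := dG _ xT.
      + apply: cvg_at_right_filter; apply: cG; apply/andP; split; lra.
      + apply: cvg_at_left_filter; apply: cG; apply/andP; split; lra.
    - move=> x; rewrite in_itv/= => /andP[ax xt].
      have xT : 0 < x < T by apply/andP; split; lra.
      by have [dd <-] := dG _ xT; rewrite derive1E.
  have h' : \int[mu]_(x in `[a, t]) (- lam * y x) = G t - G a by rewrite /Rintegral h.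
  rewrite (prim_split a0 at_ tT iy) [prim y a + _]addrC addrK.
  have iat : mu.-integrable `[a, t] (EFin \o y).
    by apply: integrableS iy => // s; rewrite /= !in_itv/= => /andP[h1 h2]; apply/andP; split; lra.
  rewrite RintegralZl// in h'; move: (\int[mu]_(s in `[a, t]) y s) h' => I h'; lra.
have p0 : prim y a @[a --> 0^'+] --> 0.
  have := prim_cvg0 (L1_restrict (measurable_itv _) iy); apply: cvg_trans; apply: near_eq_cvg; near=> a.
  have aT : a < T by near: a; exact: nbhs_right_lt.
  apply: eq_Rintegral => s; rewrite inE/= in_itv/= => /andP[s0 sa].
  by rewrite patchE mem_setE in_itv/= s0 (lt_trans sa).
have lim : G t + lam * (prim y t - prim y a) @[a --> 0^'+] --> G t + lam * (prim y t - 0).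
  by apply: cvgD; [exact: cvg_cst|apply: cvgM; [exact: cvg_cst|apply: cvgB => //; exact: cvg_cst]].
have : G t + lam * (prim y t - 0) = eta.
  apply: (cvg_unique _ _ G0) => //; apply: cvg_trans lim; apply: near_eq_cvg; near=> a.
  have a0 : 0 < a by near: a; exact: nbhs_right_gt.
  have at_ : a < t by near: a; exact: nbhs_right_lt.
  by rewrite -step.
by lra.
Unshelve. all: by end_near.
Qed.

End forward.

Section forward_functional.
Context {R : realType} {k : scalar_kind} {H : completeNormedModType (scalars R k)}.
Local Notation mu := (@lebesgue_measure R).

(** At an interior point the derivative within []0, T]] is two-sided; [q] keeps the increments
    inside the interval. *)
Lemma strong_derivative_functional (l : H -> R) (T t : R) (g : R -> H) (w : H) : real_functional l ->
  0 < t < T -> is_strong_derivative T g t w -> is_derive t 1 (l \o g) (l w).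
Proof.
move=> lf /andP[t0 tT] /(functional_cvg lf) h; have [lD lZ lb] := lf.
have c : h^-1 *: ((l \o g \o shift t) (h *: (1 : R)) - (l \o g) t) @[h --> 0^'] --> l w.
  apply/cvgrPdist_lt => e e0.
  have : nbhs t (fun s => s != t -> `]0%R, T]%classic s -> `|l w - l (ofR k (s - t)^-1 *: (g s - g t))| < e).
    exact: ((cvgrPdist_lt _ _).1 h e e0).
  move=> /nbhs_ballP[r /= r0 hr].
  pose q : R := Num.min r (Num.min t (T - t)).
  have q0 : 0 < q by rewrite !lt_min r0 t0 subr_gt0.
  apply/nbhs_ballP; exists q => // s; rewrite /ball/= sub0r normrN => sq s0.
  have [sr /andP[st sT]] : `|s| < r /\ (`|s| < t) && (`|s| < T - t).
    by move: sq; rewrite /q !lt_min => /andP[-> /andP[-> ->]].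
  have := hr (s + t); rewrite /ball/= opprD addrA addrAC subrr add0r normrN => /(_ sr).
  rewrite -subr_eq0 addrK => /(_ s0); rewrite in_itv/= => hh.
  have : 0 < s + t <= T by move: st sT; rewrite !ltr_norml => /andP[? ?] /andP[? ?]; apply/andP; split; lra.
  move=> /hh; rewrite lZ lD functionalN//=; rewrite (_ : s%:A = s); [exact|exact: mulr1].
apply: DeriveDef; first by apply/cvg_ex; exists (l w).
exact: (cvg_lim _ c).
Qed.

Lemma forward_functional (l : H -> R) (D : set H) (A : H -> H) (rho T lam : R) (phi : H) (u : R -> H) :
  real_functional l -> 0 < rho <= 1 -> 0 < T -> 0 < lam -> (forall x, D x -> l (A x) = lam * l x) ->
  forward_solution D A rho T phi u ->
  scalar_solution T (1 - rho) lam (l phi) (l \o u) /\ {within `]0, T], continuous (l \o u)}.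
Proof.
move=> lf /andP[r0 r1] T0 l0 lA [g [w [Hfi Hd cw [Du cAu] [eq gphi u0]]]].
have [lD lZ lb] := lf.
have cAl : {within `]0, T], continuous (fun t => l (A (u t)))}.
  by move=> x; apply: functional_cvg lf (cAu x).
(* Continuity is given for [A \o u]; since [l] is an eigenfunctional of [A], dividing by [lam]
   transfers it to [l \o u]. *)
have cy : {within `]0, T], continuous (l \o u)}.
  have := within_scale (c := lam^-1) cAl; apply: subspace_eq_continuous => t.
  rewrite inE/= in_itv/= => /Du tT; rewrite /from_subspace /= lA// mulKf//; exact: lt0r_neq0.
split => //.
have cyo := continuous_itvoc_oo cy.
have dG t : 0 < t < T -> is_derive t 1 (l \o g) (- lam * (l \o u) t).
  move=> /andP[t0 tT]; have t0T : 0 < t <= T by rewrite t0 ltW.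
  have -> : - lam * (l \o u) t = l (w t).
    have := eq _ t0T => /(congr1 l); rewrite lD functional0// lA; last exact: Du.
    by rewrite /=; lra.
  by apply: strong_derivative_functional (Hd t t0T) => //; rewrite t0.
have G0 : (l \o g) t @[t --> 0^'+] --> l phi by exact: functional_cvg lf gphi.
have frac t : 0 < t <= T -> rho != 1 ->
    mu.-integrable `]0, t[ (EFin \o (fun s => (t - s) `^ (- rho) * (l \o u) s)) /\
    l (g t) = (Gamma (1 - rho))^-1 * \int[mu]_(s in `]0, t[) ((t - s) `^ (- rho) * (l \o u) s).
  move=> tT r_1; have := Hfi t tT; rewrite /is_frac_integral subr_eq0 (negbTE r_1) => -[I bI ->].
  have ml : measurable_fun `]0, t[ (l \o (fun xi => ofR k ((t - xi) `^ (- (rho - 1 + 1))) *: u xi)).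
    have -> : l \o (fun xi => ofR k ((t - xi) `^ (- (rho - 1 + 1))) *: u xi) = (fun s => (t - s) `^ (- rho) * (l \o u) s).
      by apply/funext => s /=; rewrite lZ subrK.
    apply: measurable_weight => s /andP[s0 st]; apply: cyo; rewrite s0.
    by case/andP: tT => _; exact: lt_le_trans.
  have [i1 i2] := bochner_functional lf (measurable_itv _) ml bI.
  split; first by apply: eq_integrable i1 => // s _ /=; rewrite lZ subrK.
  rewrite lZ opprB -i2; congr (_ * _); apply: eq_Rintegral => s _.
  by rewrite lZ subrK.
(* At order one [g] is [u], and integrability comes from continuity on the closed interval, with the
   initial condition at 0. At lower orders it comes from the Bochner integral at the endpoint
   [T]. *)
have [r_1|r_1] := eqVneq rho 1.
  have gu t : 0 < t <= T -> g t = u t by move=> tT; have := Hfi t tT; rewrite /is_frac_integral r_1 subrr eqxx.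
  have c0 : {within `[0, T], continuous (l \o u)}.
    apply/(continuous_within_itvP _ T0); split.
    - by move=> t; rewrite in_itv/=; exact: cyo.
    - rewrite /= (u0 r_1); apply: cvg_trans G0; apply: near_eq_cvg; near=> t.
      rewrite /= gu//; apply/andP; split; first by near: t; exact: nbhs_right_gt.
      by apply: ltW; near: t; exact: nbhs_right_lt.
    - exact: continuous_itvoc_left.
  have iy : mu.-integrable `]0, T[ (EFin \o (l \o u)).
    have := continuous_compact_integrable (@segment_compact _ 0 T) c0.
    by apply: integrableS => // s; rewrite /= !in_itv/= => /andP[/ltW-> /ltW].
  split => // t tT; rewrite r_1 subrr eqxx -(derive_to_prim T0 dG cyo iy G0 tT)/= gu//.
  by move/andP: tT => [-> /ltW].
have TT : 0 < T <= T by rewrite T0 lexx.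
have iy : mu.-integrable `]0, T[ (EFin \o (l \o u)).
  by apply: (integrable_weight T0 (ltW r0) cyo); have [] := frac T TT r_1.
split => // t tT; have tT' : 0 < t <= T by move/andP: tT => [-> /ltW].
rewrite -(derive_to_prim T0 dG cyo iy G0 tT) subr_eq0 eq_sym (negbTE r_1)/=.
have [_ ->] := frac t tT' r_1.
by rewrite (_ : 1 - rho - 1 = - rho)//; ring.
Unshelve. all: by end_near.
Qed.

End forward_functional.

(** * Fourier coefficients in the Hilbert space *)

Section hilbert.
Context {R : realType} {k : scalar_kind} {H : completeNormedModType (scalars R k)}.
Local Notation C := (scalars R k).
Variable inner : {dot H for @conjS R k}.
Hypothesis norm_inner : norm_of_dot inner.

Lemma innerC x y : inner x y = conjS (inner y x).
Proof. by rewrite (hermitian_subproof x y) expr0 mul1r. Qed.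

Lemma innerZl a x y : inner (a *: x) y = a * inner x y.
Proof. by rewrite linearZl_LR. Qed.

Lemma innerZr a x y : inner x (a *: y) = conjS a * inner x y.
Proof. by rewrite innerC innerZl conjSM -innerC. Qed.

Lemma norm_sub_proj x v : inner v v = 1 ->
  `|x - inner x v *: v| ^+ 2 = `|x| ^+ 2 - `|inner x v| ^+ 2.
Proof.
move=> v1; rewrite !norm_inner !linearBl !linearBr/= !innerZl !innerZr v1 mulr1 (innerC v x).
by rewrite -mul_conjS [conjS _ * _]mulrC; ring.
Qed.

Lemma inner_le_norm x v : inner v v = 1 -> `|inner x v| <= `|x|.
Proof.
move=> v1; rewrite -(@ler_pXn2r _ 2) ?nnegrE//.
by rewrite -subr_ge0 -norm_sub_proj// exprn_ge0.
Qed.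

Lemma inner_functional (z : C) v : inner v v = 1 -> real_functional (fun x => reS (z * inner x v)).
Proof.
move=> v1; split.
- by move=> x y; rewrite linearDl mulrDr reSD.
- by move=> a x; rewrite innerZl mulrCA reSZ.
exists (1 + reS `|z|); first by rewrite ltr_pwDl// reS_norm_ge0.
move=> x; apply: (le_trans (reS_le_norm _)); rewrite normrM reS_mul_norm.
have h := reS_le (inner_le_norm x v1).
apply: ler_pM; rewrite ?reS_norm_ge0//.
by rewrite lerDr.
Qed.

Variable v : nat -> H.
Hypothesis orthonormal_v : forall i j, inner (v i) (v j) = (i == j)%:R.
Hypothesis complete_v : forall x, (forall j, inner x (v j) = 0) -> x = 0.

Lemma unit_v j : inner (v j) (v j) = 1.
Proof. by rewrite orthonormal_v eqxx. Qed.

Lemma inner_comb (a : nat -> C) n p i :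
  inner (\sum_(n <= j < n + p) a j *: v j) (v i) = if (n <= i < n + p)%N then a i else 0.
Proof.
elim: p => [|p IH].
  by rewrite addn0 big_geq// linear0l; case: ifP => //; lia.
rewrite addnS big_nat_recr ?leq_addr//= linearDl/= IH innerZl orthonormal_v.
have [ni|ni] := eqVneq (n + p)%N i.
  by rewrite -ni mulr1 ltnn andbF add0r leq_addr ltnSn.
rewrite mulr0 addr0; have -> : (i < (n + p).+1)%N = (i < n + p)%N by lia.
by [].
Qed.

Lemma norm_comb (a : nat -> C) n p :
  `|\sum_(n <= j < n + p) a j *: v j| ^+ 2 = \sum_(n <= j < n + p) `|a j| ^+ 2.
Proof.
elim: p => [|p IH]; first by rewrite addn0 !big_geq// normr0 expr0n.
rewrite addnS !big_nat_recr ?leq_addr//= -IH norm_inner [in RHS]norm_inner.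
set S := \sum_(n <= j < n + p) _.
have z : inner S (v (n + p)%N) = 0 by rewrite inner_comb ltnn andbF.
rewrite !linearDl !linearDr/= !innerZl !innerZr (innerC (v (n + p)%N) S) z conjS0 unit_v !mulr0 addr0 add0r mulr1.
by rewrite -mul_conjS.
Qed.

Definition partial_sum (x : H) n : H := \sum_(0 <= j < n) inner x (v j) *: v j.
Definition energy (x : H) n : R := \sum_(0 <= j < n) (reS `|inner x (v j)|) ^+ 2.

Lemma ofR_sqr_norm (K : normedZmodType C) (z : K) : ofR k (reS `|z| ^+ 2) = `|z| ^+ 2.
Proof. by rewrite expr2 ofRM ofR_reS ?expr2. Qed.

Lemma ofR_sum m n (F : nat -> R) : ofR k (\sum_(m <= j < n) F j) = \sum_(m <= j < n) ofR k (F j).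
Proof. by apply: (big_morph _ ofRD); exact: ofR0. Qed.

Lemma bessel_eq x n : `|x - partial_sum x n| ^+ 2 = `|x| ^+ 2 - ofR k (energy x n).
Proof.
elim: n => [|n IH]; first by rewrite /partial_sum /energy !big_geq// !subr0 ofR0 subr0.
rewrite /partial_sum big_nat_recr//= opprD addrA -/(partial_sum x n).
have e : inner (x - partial_sum x n) (v n) = inner x (v n).
  have := inner_comb (fun j => inner x (v j)) 0 n n; rewrite add0n ltnn andbF => h.
  by rewrite linearBl/= h subr0.
rewrite -{1}e norm_sub_proj ?unit_v// IH e /energy big_nat_recr//= ofRD ofR_sqr_norm.
by rewrite opprD addrA.
Qed.

Lemma energy_le x n : energy x n <= reS `|x| ^+ 2.
Proof.
by rewrite -(@ofR_le R k) ofR_sqr_norm -subr_ge0 -bessel_eq exprn_ge0.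
Qed.

Lemma energy_homo x : {homo energy x : m n / (m <= n)%N >-> m <= n}.
Proof.
move=> m n mn; rewrite /energy (big_cat_nat _ mn)//= lerDl.
by apply: sumr_ge0 => j _; exact: sqr_ge0.
Qed.

Lemma partial_sum_diff x N n : (N <= n)%N ->
  `|partial_sum x N - partial_sum x n| ^+ 2 = ofR k (energy x n - energy x N).
Proof.
move=> Nn; have e : partial_sum x n = partial_sum x N + \sum_(N <= j < n) inner x (v j) *: v j.
  by rewrite /partial_sum (big_cat_nat _ Nn).
rewrite distrC e addrAC subrr add0r.
rewrite /energy [in RHS](big_cat_nat _ Nn)//= addrAC subrr add0r ofR_sum.
have -> : n = (N + (n - N))%N by lia.
by rewrite norm_comb; apply: eq_bigr => j _; rewrite ofR_sqr_norm.
Qed.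

(** Bessel bounds the energies, so they converge and the partial sums are Cauchy. Their limit has
    the coefficients of [x], and completeness of the system identifies it with [x]. *)
Lemma partial_sum_cvg x : partial_sum x n @[n --> \oo] --> x.
Proof.
have ce : cvgn (energy x).
  apply: nondecreasing_is_cvgn; first exact: energy_homo.
  by exists (reS `|x| ^+ 2) => _ [n _ <-]; exact: energy_le.
have cp : cvg (partial_sum x n @[n --> \oo]).
  apply: cauchy_cvg; apply: cauchy_exP => e e0.
  have eE : ofR k (reS e) = e by rewrite ofR_reS// ltW.
  have e0' : 0 < reS e by rewrite -(@ofR_lt R k) eE ofR0.
  have e2 : 0 < reS e ^+ 2 by rewrite exprn_gt0.
  have [N _ hN] := (cvgrPdist_lt _ _).1 ce _ e2.
  exists (partial_sum x N); exists N => // n /= Nn; rewrite -ball_normE/=.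
  rewrite -(@ltr_pXn2r _ 2) ?nnegrE//; last exact: ltW.
  rewrite partial_sum_diff// -eE expr2 -ofRM -expr2 ofR_lt.
  have := hN N (leqnn N); have := nondecreasing_cvgn_le (@energy_homo x) ce n.
  move=> h1 h2; have := ler_norm (limn (energy x) - energy x N); lra.
have [p hp] := (cvg_ex _).1 cp.
suff {2}-> : x = p by [].
apply/eqP; rewrite -subr_eq0; apply/eqP; apply: complete_v => j.
rewrite linearBl/=; apply: reS_eq0 => z; rewrite mulrBr reSD reS_N.
have c2 : reS (z * inner (partial_sum x n) (v j)) @[n --> \oo] --> reS (z * inner p (v j)).
  exact: functional_cvg (inner_functional z (unit_v j)) hp.
have c : reS (z * inner (partial_sum x n) (v j)) @[n --> \oo] --> reS (z * inner x (v j)).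
  apply: cvg_near_cst; exists j.+1 => // n /= jn.
  have := inner_comb (fun j => inner x (v j)) 0 n j; rewrite add0n jn => h.
  by apply/eqP; rewrite h.
by rewrite (cvg_unique _ c c2) ?subrr.
Qed.

(** The half of Parseval that rests on completeness, in epsilon form. *)
Lemma energy_approx x (e : R) : 0 < e -> \forall n \near \oo, reS `|x| ^+ 2 < energy x n + e.
Proof.
(* [d <= 1] and [d <= e] together give [d ^+ 2 <= e]. *)
move=> e0; pose d : R := Num.min 1 e; have d0 : 0 < d by rewrite lt_min ltr01.
have d0' : 0 < ofR k d by rewrite -(ofR0 (k := k)) ofR_lt.
have near_x : \forall n \near \oo, `|x - partial_sum x n| < ofR k d.
  exact: ((cvgrPdist_lt _ _).1 (@partial_sum_cvg x) _ d0').
apply: filterS near_x => n h.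
rewrite -ltrBlDl -(@ofR_lt R k) ofRD ofR_sqr_norm.
have -> : ofR k (- energy x n) = - ofR k (energy x n).
  by apply: (addrI (ofR k (energy x n))); rewrite -ofRD !subrr ofR0.
rewrite -bessel_eq; apply: (@lt_le_trans _ _ (ofR k d ^+ 2)).
  by rewrite ltr_pXn2r ?nnegrE// ltW.
rewrite expr2 -ofRM ofR_le; have h1 : d <= 1 by rewrite ge_min lexx.
have h2 : d <= e by rewrite ge_min lexx orbT.
by apply: le_trans h2; rewrite ler_piMl// ltW.
Qed.

Lemma norm_le_coef x y : (forall j, reS `|inner y (v j)| <= reS `|inner x (v j)|) ->
  reS `|y| ^+ 2 <= reS `|x| ^+ 2.
Proof.
move=> h; apply/ler_addgt0Pr => e e0.
have [n _ /(_ n (leqnn n)) /= hn] := energy_approx y e0.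
apply: (le_trans (ltW hn)); rewrite lerD2r; apply: le_trans (energy_le x n).
by apply: ler_sum => j _; rewrite ler_sqr ?nnegrE ?reS_norm_ge0.
Qed.

(** The gap at index [i] is taken as the tolerance in [energy_approx] for [y]; truncating beyond [i]
    keeps that gap inside the finite sums. *)
Lemma norm_lt_coef x y i : (forall j, reS `|inner y (v j)| <= reS `|inner x (v j)|) ->
  reS `|inner y (v i)| < reS `|inner x (v i)| -> reS `|y| ^+ 2 < reS `|x| ^+ 2.
Proof.
move=> h hi.
pose e : R := reS `|inner x (v i)| ^+ 2 - reS `|inner y (v i)| ^+ 2.
have e0 : 0 < e by rewrite subr_gt0 ltr_sqr ?nnegrE ?reS_norm_ge0.
have [N _ hN] := energy_approx y e0.
pose n := maxn N i.+1; have {hN}/= hn := hN n (leq_maxl _ _).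
apply: (lt_le_trans hn); apply: le_trans (energy_le x n).
have iN : (i < n)%N by rewrite leq_maxr.
rewrite /energy !big_mkord (bigD1 (Ordinal iN))//= [leRHS](bigD1 (Ordinal iN))//= /e.
have : \sum_(j < n | j != Ordinal iN) reS `|inner y (v j)| ^+ 2 <= \sum_(j < n | j != Ordinal iN) reS `|inner x (v j)| ^+ 2.
  by apply: ler_sum => j _; rewrite ler_sqr ?nnegrE ?reS_norm_ge0.
move: (\sum_(j < n | _) _) (\sum_(j < n | _) _) (_ ^+ 2) (_ ^+ 2) => a b c d; lra.
Qed.

Section eigen.
Variables (D : set H) (A : H -> H) (lambda : nat -> R).
Hypothesis self_adjoint_A : self_adjoint inner D A.
Hypothesis eigen_v : forall j, D (v j) /\ A (v j) = ofR k (lambda j) *: v j.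

(** Self-adjointness moves [A] onto [v j], which lies in the domain; the eigenvalue is real, so
    conjugation fixes it. *)
Lemma inner_eigen x j : D x -> inner (A x) (v j) = ofR k (lambda j) * inner x (v j).
Proof.
move=> Dx; have [_ h] := self_adjoint_A (v j) (A (v j)).
have [Dv Av] := eigen_v j; rewrite h//.
by rewrite Av innerZr conjS_ofR.
Qed.

Lemma coefficient_solution (rho T : R) (phi : H) (u : R -> H) j (z : C) :
  0 < rho <= 1 -> 0 < T -> 0 < lambda j -> forward_solution D A rho T phi u ->
  scalar_solution T (1 - rho) (lambda j) (reS (z * inner phi (v j))) (fun t => reS (z * inner (u t) (v j))) /\
  {within `]0, T], continuous (fun t => reS (z * inner (u t) (v j)))}.
Proof.
move=> r01 T0 l0 sol.
apply: (@forward_functional R k H (fun x => reS (z * inner x (v j))) D A) => //.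
- exact: inner_functional (unit_v j).
- by move=> x Dx; rewrite inner_eigen// mulrCA reSZ.
Qed.

(** Scalar solutions are real. A test scalar for which the datum has real part 0 yields a solution
    that vanishes by [scalar_uniq]; letting the test scalar vary shows that a coefficient of [u t]
    is a real multiple of that of [phi], also over the complex field. *)
Lemma coefficientE (rho T t : R) (phi : H) (u : R -> H) j :
  0 < rho <= 1 -> 0 < T -> 0 < lambda j -> forward_solution D A rho T phi u -> 0 < t <= T ->
  inner (u t) (v j) = ofR k (reS ((inner phi (v j))^-1 * inner (u t) (v j))) * inner phi (v j).
Proof.
move=> r01 T0 l0 sol tT.
set p := inner phi (v j); apply/eqP; rewrite -subr_eq0; apply/eqP; apply: reS_eq0 => z.
(* Correction of [z] along [p^-1] that makes the real part of [z' * p] zero; for [p = 0] the inverse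
   is 0 by convention and the datum vanishes anyway. *)
pose z' := z - ofR k (reS (z * p)) * p^-1.
have [sol' cs] := coefficient_solution z' r01 T0 l0 sol.
have /andP[r0 r1] := r01.
have datum : reS (z' * p) = 0.
  rewrite /z' mulrBl reSD reS_N -mulrA reSZ; have [->|p0] := eqVneq p 0.
    by rewrite !mulr0 reS0 mul0r subrr.
  by rewrite mulVf// -ofR1 reS_ofR mulr1 subrr.
have s0 : scalar_solution T (1 - rho) (lambda j) 0 (fun t => reS (z' * inner (u t) (v j))).
  by rewrite -datum.
have zero s : 0 < s < T -> reS (z' * inner (u s) (v j)) = 0.
  by apply: (scalar_uniq T0 _ _ s0); lra.
have zeroT : reS (z' * inner (u T) (v j)) = 0.
  apply/eqP; rewrite eq_le; apply/andP; split.
    rewrite -oppr_ge0 -mulN1r; apply: (@itvoc_le_left R T 0 0 _ T0 T0 (within_scale (c := -1) cs)) => s sT.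
    by rewrite zero// mulr0.
  by apply: (@itvoc_le_left R T 0 0 _ T0 T0 cs) => s sT; rewrite zero.
have {zero zeroT} : reS (z' * inner (u t) (v j)) = 0.
  by move: tT => /andP[t0]; rewrite le_eqVlt => /predU1P[->//|tT]; apply: zero; rewrite t0.
rewrite /z' mulrBl reSD reS_N -mulrA reSZ mulrBr reSD reS_N mulrCA reSZ => h.
rewrite [X in _ - X]mulrC; exact: h.
Qed.

(** Both coefficients are the coefficient [p] of [phi] times scalar solutions with datum 1. The
    smaller of these, at order [rho2], is nonnegative, so the comparison passes to absolute values;
    [t0 = T] is reached by continuity from the left. *)
Lemma coefficient_comparison (tau rho0 lam1 : R) :
  (forall (T lam x1 x2 : R) (y1 y2 : R -> R),
    tau < T -> lam1 <= lam -> 0 <= x2 -> x2 < x1 -> x1 <= 1 - rho0 ->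
    scalar_solution T x1 lam 1 y1 -> scalar_solution T x2 lam 1 y2 ->
    exists2 kappa : R, 0 < kappa & forall t, tau < t < T -> kappa <= y1 t - y2 t) ->
  0 < rho0 -> 0 < lam1 -> 0 < tau ->
  forall (T t0 rho1 rho2 : R) (phi : H) (u1 u2 : R -> H) j,
  tau < t0 -> t0 <= T -> rho0 <= rho1 -> rho1 < rho2 -> rho2 <= 1 -> lam1 <= lambda j ->
  forward_solution D A rho1 T phi u1 -> forward_solution D A rho2 T phi u2 ->
  reS `|inner (u2 t0) (v j)| <= reS `|inner (u1 t0) (v j)| /\
  (inner phi (v j) != 0 -> reS `|inner (u2 t0) (v j)| < reS `|inner (u1 t0) (v j)|).
Proof.
move=> cmp r0 l10 tau0 T t0 rho1 rho2 phi u1 u2 j tt tT r01 r12 r21 ll s1 s2.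
have t00 : 0 < t0 by lra.
have T0 : 0 < T by lra.
have t0T : 0 < t0 <= T by rewrite t00.
have l0 : 0 < lambda j by lra.
have r1 : 0 < rho1 <= 1 by apply/andP; split; lra.
have r2 : 0 < rho2 <= 1 by apply/andP; split; lra.
rewrite (coefficientE r1 T0 l0 s1 t0T) (coefficientE r2 T0 l0 s2 t0T).
set p := inner phi (v j).
rewrite !normrM !norm_ofR !reSZ.
have [->|p0] := eqVneq p 0; first by rewrite normr0 reS0 !mulr0.
have [e1 c1] := coefficient_solution p^-1 r1 T0 l0 s1.
have [e2 c2] := coefficient_solution p^-1 r2 T0 l0 s2.
have datum : reS (p^-1 * p) = 1 by rewrite mulVf// -ofR1 reS_ofR.
rewrite -/p datum in e1 e2.
set y1 := fun t => _ in e1 c1; set y2 := fun t => _ in e2 c2.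
rewrite -[reS (p^-1 * inner (u1 t0) _)]/(y1 t0) -[reS (p^-1 * inner (u2 t0) _)]/(y2 t0).
have tauT : tau < T by lra.
have x2_ge0 : 0 <= 1 - rho2 by lra.
have x2_lt1 : 1 - rho2 < 1 by lra.
have x12 : 1 - rho2 < 1 - rho1 by lra.
have x1_le : 1 - rho1 <= 1 - rho0 by lra.
have [kap kap0 hk] := cmp T (lambda j) _ _ y1 y2 tauT ll x2_ge0 x12 x1_le e1 e2.
have c12 : {within `]0, T], continuous (fun t => y1 t - y2 t)}.
  by move=> x; apply: cvgB; [exact: c1|exact: c2].
have y12 : kap <= y1 t0 - y2 t0.
  move: tT; rewrite le_eqVlt => /predU1P[->|tT]; last by apply: hk; rewrite tt.
  exact: (itvoc_le_left T0 tauT c12 hk).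
have y2_ge0 : 0 <= y2 t0.
  have pos s : 0 < s < T -> 0 <= y2 s.
    by move=> sT; apply: ltW; exact: (solution_gt0 T0 x2_ge0 x2_lt1 l0 e2 sT).
  move: tT; rewrite le_eqVlt => /predU1P[->|tT]; last by apply: pos; rewrite t00.
  exact: (itvoc_le_left T0 T0 c2 pos).
have y1_ge0 : 0 <= y1 t0 by clear -y2_ge0 y12 kap0; lra.
have n0 : 0 < reS `|p| by rewrite -(@ofR_lt R k) ofR_reS// ofR0 normr_gt0.
rewrite (ger0_norm y1_ge0) (ger0_norm y2_ge0).
have lt12 : y2 t0 * reS `|p| < y1 t0 * reS `|p| by rewrite ltr_pM2r//; clear -y12 kap0; lra.
by split => //; exact: ltW.
Qed.

End eigen.

End hilbert.

Theorem lemma1p4 (R : realType) (rho0 lambda1 : R)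
    (rho0_gt0 : 0 < rho0) (rho0_lt1 : rho0 < 1) (lambda1_gt0 : 0 < lambda1) :
  exists2 T0 : R, 0 < T0 &
    forall (k : scalar_kind) (H : completeNormedModType (scalars R k))
      (inner : {dot H for @conjS R k}) (D : set H) (A : H -> H)
      (v : nat -> H) (lambda : nat -> R),
      norm_of_dot inner ->
      separable_space H ->
      densely_defined_linear D A ->
      self_adjoint inner D A ->
      positive_operator inner D A ->
      eigen_system inner D A v lambda ->
      lambda 0%N = lambda1 ->
    forall (T t0 : R) (phi : H) (u : R -> R -> H),
      T0 <= t0 -> t0 <= T ->
      (forall rho : R, rho0 <= rho <= 1 ->
         forward_solution D A rho T phi (u rho)) ->
    let W := fun rho : R => `|u rho t0| ^+ 2 in
    (forall rho1 rho2 : R, rho0 <= rho1 -> rho1 < rho2 -> rho2 <= 1 ->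
       W rho2 <= W rho1) /\
    (phi != 0 ->
     forall rho1 rho2 : R, rho0 <= rho1 -> rho1 < rho2 -> rho2 <= 1 ->
       W rho2 < W rho1).
Proof.
have [tau tau0 cmp] := scalar_comparison rho0_gt0 rho0_lt1 lambda1_gt0.
(* The scalar comparison holds for times strictly beyond [tau], while [t0] may equal the
   threshold. *)
exists (tau + 1); first by lra.
move=> k H inner D A v lambda norm_inner _ _ sa _ [[on_v complete_v] eigen_v lam0 lam_homo] lam01.
move=> T t0 phi u tt tT sol W.
have tau_t : tau < t0 by lra.
have ll j : lambda1 <= lambda j by rewrite -lam01; exact: lam_homo.
have comparison rho1 rho2 j : rho0 <= rho1 -> rho1 < rho2 -> rho2 <= 1 ->
    reS `|inner (u rho2 t0) (v j)| <= reS `|inner (u rho1 t0) (v j)| /\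
    (inner phi (v j) != 0 -> reS `|inner (u rho2 t0) (v j)| < reS `|inner (u rho1 t0) (v j)|).
  move=> r1 r12 r2.
  apply: (coefficient_comparison norm_inner on_v sa eigen_v cmp rho0_gt0 lambda1_gt0 tau0 tau_t tT r1 r12 r2 (ll j)).
    by apply: sol; apply/andP; split; lra.
  by apply: sol; apply/andP; split; lra.
have WE rho : W rho = ofR k (reS `|u rho t0| ^+ 2) by rewrite /W ofR_sqr_norm.
split=> [rho1 rho2 r1 r12 r2|phi0 rho1 rho2 r1 r12 r2].
  rewrite !WE ofR_le; apply: (norm_le_coef norm_inner on_v complete_v) => j.
  by have [] := comparison rho1 rho2 j r1 r12 r2.
have [i phi_i] : exists i, inner phi (v i) != 0.
  apply: contrapT => none; move/eqP: phi0; apply; apply: complete_v => j.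
  by apply/eqP; apply: contrapT => /negP h; apply: none; exists j.
rewrite !WE ofR_lt; apply: (norm_lt_coef norm_inner on_v complete_v (i := i)).
  by move=> j; have [] := comparison rho1 rho2 j r1 r12 r2.
by have [_] := comparison rho1 rho2 i r1 r12 r2; exact.
Qed.
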